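(* Let $\phi\in L^{2}(\mathbb{R}^{2n})$ and $A,B>0$. Then $\{T^{t}_{(k,l)}\phi : k,l\in\mathbb{Z}^{n}\}$ is a frame sequence with frame bounds $A,B$ if and only if $$0<A\leq [\phi,\phi](\xi,\xi')\leq B<\infty\quad\text{for a.e. }(\xi,\xi')\in\Omega_{\phi},$$ where $\Omega_{\phi}:=\{(\xi,\xi')\in\mathbb{T}^{n}\times\mathbb{T}^{n} : [\phi,\phi](\xi,\xi')\neq 0\}$.
   Context: Notation: $\mathbb{T}^{n}$ is identified with $[0,1)^{n}$ with Lebesgue measure. Twisted translation: for $\phi\in L^{2}(\mathbb{R}^{2n})$ and $(k,l)\in\mathbb{Z}^{n}\times\mathbb{Z}^{n}$, $T^{t}_{(k,l)}\phi(x,y)=e^{\pi i(x\cdot l-y\cdot k)}\phi(x-k,y-l)$ for $(x,y)\in\mathbb{R}^{n}\times\mathbb{R}^{n}$. Weyl kernel: for $\phi\in L^{1}\cap L^{2}(\mathbb{R}^{2n})$, $K_{\phi}(\xi,\eta)=\int_{\mathbb{R}^{n}}\phi(x,\eta-\xi)e^{\pi i x\cdot(\xi+\eta)}\,dx$, $\xi,\eta\in\mathbb{R}^{n}$ (the integral kernel of the Weyl transform of $\phi$). The map $\phi\mapsto K_{\phi}$ is isometric for the $L^{2}(\mathbb{R}^{2n})$ norm and is extended by density to all of $L^{2}(\mathbb{R}^{2n})$. Weyl-Zak transform: $Z_{W}:L^{2}(\mathbb{R}^{2n})\to L^{2}(\mathbb{T}^{n}\times\mathbb{T}^{n}\times\mathbb{R}^{n})$,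 $Z_{W}\phi(\xi,\xi',\eta)=\sum_{m\in\mathbb{Z}^{n}}K_{\phi}(m+\xi,\eta)e^{-2\pi i m\cdot\xi'}$. Bracket: for $\phi,\psi\in L^{2}(\mathbb{R}^{2n})$, $[\phi,\psi](\xi,\xi')=\int_{\mathbb{R}^{n}}Z_{W}\phi(\xi,\xi',\eta)\overline{Z_{W}\psi(\xi,\xi',\eta)}\,d\eta$ for a.e. $(\xi,\xi')\in\mathbb{T}^{n}\times\mathbb{T}^{n}$. A countable family $\{f_{j}\}$ in a Hilbert space is a frame sequence with frame bounds $A,B>0$ if $A\|f\|^{2}\leq\sum_{j}|\langle f,f_{j}\rangle|^{2}\leq B\|f\|^{2}$ for all $f$ in the closed linear span of $\{f_{j}\}$. *)

(* Defs.v *)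
From HB Require Import structures.
From mathcomp Require Import all_boot all_order all_algebra finmap.
From mathcomp Require Export complex.
From mathcomp Require Import all_classical all_reals all_analysis.

Set Implicit Arguments.
Unset Strict Implicit.
Unset Printing Implicit Defensive.

Import Order.TTheory GRing.Theory Num.Theory.
Import numFieldNormedType.Exports.
Import ComplexField.

Local Open Scope classical_set_scope.
Local Open Scope complex_scope.
Local Open Scope ring_scope.

Notation Rn R n := (n.-tuple (measurableTypeR R)).
Notation Zn n := (n.-tuple int).

Definition consRn (R : realType) (n : nat) (p : measurableTypeR R * Rn R n) :
  Rn R n.+1 := [tuple of p.1 :: p.2].

(* R^0 is a point of mass 1, and R^{n+1} carries the image of the product
   measure of R and R^n. *)
Fixpoint lebesgue_Rn {R : realType} {n : nat} : set (Rn R n) -> \bar R :=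
  match n with
  | 0 => dirac ([tuple] : Rn R 0)
  | m.+1 => pushforward
      (product_measure1 (@lebesgue_measure R) (@lebesgue_Rn R m))
      (@consRn R m)
  end.

Lemma measurable_consRn (R : realType) (n : nat) :
  measurable_fun setT (@consRn R n).
Proof. exact: measurable_cons. Qed.

Definition unconsRn (R : realType) (n : nat) (x : Rn R n.+1) :
  measurableTypeR R * Rn R n := (thead x, [tuple of behead x]).

Lemma consRnK (R : realType) (n : nat) : cancel (@consRn R n) (@unconsRn R n).
Proof. by case=> a t; congr pair; apply/val_inj. Qed.

Lemma measurable_unconsRn (R : realType) (n : nat) :
  measurable_fun setT (@unconsRn R n).
Proof.
apply/measurable_fun_pairP; split.
- exact: measurable_tnth.
- exact: measurable_behead.
Qed.

Lemma product_sigma_finite d1 d2 (T1 : measurableType d1)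
    (T2 : measurableType d2) (R : realType)
    (m1 : {sigma_finite_measure set T1 -> \bar R})
    (m2 : {sigma_finite_measure set T2 -> \bar R}) :
  sigma_finite setT (m1 \x m2)%E.
Proof.
have /sigma_finiteP[F [TF ndF Foo]] := sigma_finiteT m1.
have /sigma_finiteP[G [TG ndG Goo]] := sigma_finiteT m2.
exists (fun n => F n `*` G n).
  rewrite -setXTT TF TG predeqE => -[x y]; split.
    move=> [/= [n _ Fnx] [k _ Gky]]; exists (maxn n k) => //; split.
    - by move: x Fnx; exact/subsetPset/ndF/leq_maxl.
    - by move: y Gky; exact/subsetPset/ndG/leq_maxr.
  by move=> [n _ []/= ? ?]; split; exists n.
move=> k; have [? ?] := Foo k; have [? ?] := Goo k.
split; first exact: measurableX.
by rewrite product_measure1E// lte_mul_pinfty// ge0_fin_numE.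
Qed.

Lemma pushforward_sigma_finite d1 d2 (T1 : measurableType d1)
    (T2 : measurableType d2) (R : realType)
    (m : set T1 -> \bar R) (f : T1 -> T2) (g : T2 -> T1) :
  measurable_fun setT g -> cancel f g ->
  sigma_finite setT m -> sigma_finite setT (pushforward m f).
Proof.
move=> mg fK [F TF Foo].
exists (fun k => g @^-1` F k).
  apply/seteqP; split => // x _.
  have : setT (g x) by [].
  by rewrite TF => -[k _ Fk]; exists k.
move=> k; have [mF Fk] := Foo k; split.
  by rewrite -[X in measurable X]setTI; exact: mg.
rewrite /pushforward -comp_preimage.
by have -> : g \o f = id by apply/funext => x /=; rewrite fK.
Qed.

Lemma lebesgue_Rn_spec (R : realType) (n : nat) :
  [/\ @lebesgue_Rn R n set0 = 0%E,
      forall A, (0 <= @lebesgue_Rn R n A)%E,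
      semi_sigma_additive (@lebesgue_Rn R n) &
      sigma_finite setT (@lebesgue_Rn R n)].
Proof.
elim: n => [|n [mu0 mu_ge0 mu_add mu_fin]].
  have @mu : {sigma_finite_measure set (Rn R 0) -> \bar R} :=
    dirac ([tuple] : Rn R 0).
  split; [exact: (measure0 mu)|exact: (measure_ge0 mu)
    |exact: (@measure_semi_sigma_additive _ _ _ mu)|exact: (sigma_finiteT mu)].
have [mu muE] : exists mu : {sigma_finite_measure set (Rn R n) -> \bar R},
    (mu : set (Rn R n) -> \bar R) = @lebesgue_Rn R n.
  pose M := isMeasure.Build _ _ _ (@lebesgue_Rn R n) mu0 mu_ge0 mu_add.
  pose mu' : {measure set (Rn R n) -> \bar R} := HB.pack (@lebesgue_Rn R n) M.
  pose S := Measure_isSigmaFinite.Build _ _ _ mu' mu_fin.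
  pose mu : {sigma_finite_measure set (Rn R n) -> \bar R} :=
    HB.pack (@lebesgue_Rn R n) M S.
  by exists mu.
rewrite /= -muE.
pose m := [the {measure set _ -> \bar R} of
  (@lebesgue_measure R \x mu)%E].
pose nu := measure_function_pushforward__canonical__measure_function_Measure m
  (@measurable_consRn R n).
split.
- exact: (measure0 nu).
- exact: (measure_ge0 nu).
- exact: (@measure_semi_sigma_additive _ _ _ nu).
- exact: (@pushforward_sigma_finite _ _ _ _ _ m _ _
    (@measurable_unconsRn R n) (@consRnK R n)
    (product_sigma_finite _ _)).
Qed.

HB.instance Definition _ (R : realType) (n : nat) :=
  isMeasure.Build _ _ _ (@lebesgue_Rn R n)
    (let: And4 h _ _ _ := lebesgue_Rn_spec R n in h)
    (let: And4 _ h _ _ := lebesgue_Rn_spec R n in h)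
    (let: And4 _ _ h _ := lebesgue_Rn_spec R n in h).

HB.instance Definition _ (R : realType) (n : nat) :=
  Measure_isSigmaFinite.Build _ _ _ (@lebesgue_Rn R n)
    (let: And4 _ _ _ h := lebesgue_Rn_spec R n in h).

Lemma lebesgue_Rn_box (R : realType) (n : nat)
    (A : 'I_n -> set (measurableTypeR R)) :
  (forall i, measurable (A i)) ->
  lebesgue_Rn [set x : Rn R n | forall i, A i (tnth x i)] =
  (\prod_(i < n) lebesgue_measure (A i))%E.
Proof.
elim: n A => [|n IHn] A mA.
  rewrite big_ord0 /= diracE mem_set//=; by case.
rewrite big_ord_recl /= /pushforward.
rewrite [X in product_measure1 _ _ X](_ : _ =
    A ord0 `*` [set x : Rn R n | forall i, A (lift ord0 i) (tnth x i)]); last first.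
  apply/seteqP; split => -[a x] /=.
    move=> h; split; first exact: (h ord0).
    by move=> i; have := h (lift ord0 i); rewrite tnthS.
  by move=> [h0 hS] i; case: (unliftP ord0 i) => [j|] -> //; rewrite tnthS.
have mB : measurable
    [set x : Rn R n | forall i, A (lift ord0 i) (tnth x i)].
  rewrite (_ : [set x | _] = \bigcap_(i in [set: 'I_n])
    ((@tnth _ (measurableTypeR R) ^~ i) @^-1` A (lift ord0 i))).
    apply: fin_bigcap_measurable => // i _.
    by rewrite -[X in measurable X]setTI; exact: measurable_tnth.
  by apply/seteqP; split => x /= h i; [move=> _; exact: h|exact: (h i I)].
rewrite product_measure1E//.
congr (_ * _)%E; exact: IHn.
Qed.

Definition lebesgue_R2n {R : realType} {n : nat} :
  set (Rn R n * Rn R n)%type -> \bar R :=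
  product_measure1 (@lebesgue_Rn R n) (@lebesgue_Rn R n).

HB.instance Definition _ (R : realType) (n : nat) :=
  Measure.on (@lebesgue_R2n R n).
HB.instance Definition _ (R : realType) (n : nat) :=
  Measure_isSigmaFinite.Build _ _ _ (@lebesgue_R2n R n)
    (product_sigma_finite _ _).

Definition lebesgue_R3n {R : realType} {n : nat} :
  set (Rn R n * Rn R n * Rn R n)%type -> \bar R :=
  product_measure1 (@lebesgue_R2n R n) (@lebesgue_Rn R n).

HB.instance Definition _ (R : realType) (n : nat) :=
  Measure.on (@lebesgue_R3n R n).
HB.instance Definition _ (R : realType) (n : nat) :=
  Measure_isSigmaFinite.Build _ _ _ (@lebesgue_R3n R n)
    (product_sigma_finite _ _).

(* Elements of L^p(D) are represented by functions; everything below depends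
   only on their class modulo equality almost everywhere on D. *)
Section complex_Lp.
Context d (T : measurableType d) (R : realType).
Variables (mu : {measure set T -> \bar R}) (D : set T).
Implicit Types f g : T -> R[i].

Definition cmeasurable f :=
  measurable_fun D (fun x => complex.Re (f x)) /\
  measurable_fun D (fun x => complex.Im (f x)).

Definition cintegral f : R[i] :=
  (\int[mu]_(x in D) complex.Re (f x)) +i*
  (\int[mu]_(x in D) complex.Im (f x)).

Definition L1 f :=
  cmeasurable f /\ (\int[mu]_(x in D) (Normc.normc (f x))%:E < +oo)%E.

Definition L2normsq f : \bar R :=
  (\int[mu]_(x in D) ((Normc.normc (f x)) ^+ 2)%:E)%E.

Definition L2 f := cmeasurable f /\ (L2normsq f < +oo)%E.

Definition L2inner f g : R[i] := cintegral (fun x => f x * (g x)^*).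

Definition L2cvg (f_ : nat -> T -> R[i]) f :=
  (fun j => L2normsq (fun x => f_ j x - f x)) @ \oo --> (0 : \bar R)%E.

(* unconditional convergence: along the net of finite subsets of I *)
Definition L2sum (I : choiceType) (f_ : I -> T -> R[i]) f :=
  forall e : R, 0 < e -> exists J0 : {fset I}, forall J : {fset I},
    (J0 `<=` J)%fset ->
    (L2normsq (fun x => (\sum_(j <- J) f_ j x) - f x)%R < e%:E)%E.

Definition L2closed_span (I : choiceType) (f_ : I -> T -> R[i]) : set (T -> R[i]) :=
  [set f | L2 f /\ forall e : R, 0 < e ->
    exists (J : {fset I}) (c : I -> R[i]),
      (L2normsq (fun x => f x - \sum_(j <- J) c j * f_ j x)%R < e%:E)%E].

Definition frame_sequence (I : countType) (f_ : I -> T -> R[i]) (A B : R) :=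
  [/\ forall j, L2 (f_ j), 0 < A, 0 < B &
    forall f, L2closed_span f_ f ->
      (A%:E * L2normsq f <=
         \esum_(j in [set: I]) ((Normc.normc (L2inner f (f_ j))) ^+ 2)%:E)%E /\
      (\esum_(j in [set: I]) ((Normc.normc (L2inner f (f_ j))) ^+ 2)%:E <=
         B%:E * L2normsq f)%E].

End complex_Lp.

Section weyl_zak.
Context (R : realType) (n : nat).
Implicit Types (x y : Rn R n) (k l m : Zn n).
Implicit Types (phi psi : Rn R n * Rn R n -> R[i]).

Definition cexpi (t : R) : R[i] := cos t +i* sin t.

Definition addRn x y : Rn R n := [tuple (tnth x i + tnth y i : R) | i < n].
Definition subRn x y : Rn R n := [tuple (tnth x i - tnth y i : R) | i < n].
Definition dotRn x y : R := \sum_(i < n) (tnth x i : R) * (tnth y i : R).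
Definition ZnR k : Rn R n := [tuple ((tnth k i)%:~R : R) | i < n].

Definition twisted_translation k l phi : Rn R n * Rn R n -> R[i] :=
  fun p => cexpi (pi * (dotRn p.1 (ZnR l) - dotRn p.2 (ZnR k))) *
           phi (subRn p.1 (ZnR k), subRn p.2 (ZnR l)).

Definition weyl_integral phi : Rn R n * Rn R n -> R[i] :=
  fun p => cintegral lebesgue_Rn setT (fun x =>
    phi (x, subRn p.2 p.1) * cexpi (pi * dotRn x (addRn p.1 p.2))).

(* K is the value at phi of the continuous extension of weyl_integral from
   L^1 \cap L^2 to L^2. *)
Definition is_weyl_kernel phi (K : Rn R n * Rn R n -> R[i]) :=
  L2 lebesgue_R2n setT K /\
  exists phi_ : nat -> Rn R n * Rn R n -> R[i],
    [/\ forall j, L1 lebesgue_R2n setT (phi_ j) /\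
                  L2 lebesgue_R2n setT (phi_ j),
        L2cvg lebesgue_R2n setT phi_ phi &
        L2cvg lebesgue_R2n setT (fun j => weyl_integral (phi_ j)) K].

Definition weyl_kernel phi : Rn R n * Rn R n -> R[i] :=
  xget (fun=> 0) [set K | is_weyl_kernel phi K].

Definition torus : set (Rn R n) :=
  [set x | forall i, 0 <= (tnth x i : R) < 1].

Definition zak_domain : set (Rn R n * Rn R n * Rn R n)%type :=
  (torus `*` torus) `*` setT.

(* For K in L^2 the series need not converge absolutely at almost every point;
   it converges unconditionally in L^2(T^n x T^n x R^n), by orthogonality of
   the exponentials in xi'. *)
Definition is_weyl_zak phi (Z : Rn R n * Rn R n * Rn R n -> R[i]) :=
  L2 lebesgue_R3n zak_domain Z /\
  L2sum lebesgue_R3n zak_domain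
    (fun m (q : Rn R n * Rn R n * Rn R n) =>
       weyl_kernel phi (addRn (ZnR m) q.1.1, q.2) *
       cexpi (- (2 * pi * dotRn (ZnR m) q.1.2))) Z.

Definition weyl_zak phi : Rn R n * Rn R n * Rn R n -> R[i] :=
  xget (fun=> 0) [set Z | is_weyl_zak phi Z].

Definition bracket phi psi : Rn R n * Rn R n -> R[i] :=
  fun p => cintegral lebesgue_Rn setT
    (fun eta => weyl_zak phi (p, eta) * (weyl_zak psi (p, eta))^*).

Definition Omega phi : set (Rn R n * Rn R n)%type :=
  [set p | (torus `*` torus) p /\ bracket phi phi p != 0].

End weyl_zak.

(* Main.v *)
Require Import Defs.
From HB Require Import structures.
From mathcomp Require Import all_boot all_order all_algebra finmap.
From mathcomp Require Import complex.
From mathcomp Require Import all_classical all_reals all_analysis.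
From mathcomp Require Import measurable_realfun.
From mathcomp Require Import ring lra.

(** The Zak transform diagonalizes the twisted translations.  On the Weyl kernel K
    of phi, the translation by (k, l) becomes the operator
    K(xi, eta) |-> e^(pi i k.l) e^(2 pi i k.xi) K(xi + l, eta)
    (weyl_twisted_translation), and on the Zak transform it becomes the
    multiplication by e^(pi i k.l) e^(2 pi i (k.xi + l.xi')) (zak_term_twist).
    Since the Weyl kernel and the Zak transform are isometric, the square norm of a
    linear combination with coefficients c of twisted translations of phi is the
    integral over the torus of |p|^2 w, where w = [phi, phi] is the square norm of
    the Zak transform on the fibres and p is the trigonometric sum with
    coefficients c, up to unimodular constants (zak_combination_isometry and
    nsq_fiber_norm).  The family is thus unitarily equivalent to the characters of
    the torus in L^2(w), and its frame coefficients at p are the Fourier coefficients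
    of p w.  What remains is weighted_frame_sequence, a statement on a weight w and
    an orthonormal family of characters.

    If A <= w <= B wherever w does not vanish, Parseval's identity says that the
    coefficients of p have the square sum int |p|^2 w^2, which lies between A and B
    times int |p|^2 w; the two bounds extend to the closed span
    (frame_bounds_closure).

    Conversely, the upper frame bound gives by duality that int |p|^2 w is at most
    B int |p|^2 (synthesis_le).  Trigonometric sums approximate the indicator of any
    measurable set E in L^2(1 + w), hence the integral of w over E is at most B |E|,
    and w <= B almost everywhere.  Now p w is square integrable, the lower frame
    bound reads A int |p|^2 w <= int |p|^2 w^2, and the same approximation gives
    A w <= w^2 almost everywhere.

    The analytic facts behind this are all of L^2 type.  Density holds because the
    functions approximable by trigonometric sums form an algebra stable under
    bounded pointwise limits (lincomb_dense); it gives Parseval's identity, hence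
    Plancherel's theorem for functions carried by finitely many unit cells, by
    folding the Fourier integral onto the torus (plancherel_cells), and then in
    general; the isometry of the Weyl kernel is Plancherel's theorem on slices
    (weyl_isometry).  The kernel on L^2 and the Zak transform exist by completeness. *)

Set Implicit Arguments.
Unset Strict Implicit.
Unset Printing Implicit Defensive.
Import Order.TTheory GRing.Theory Num.Theory.
Import numFieldNormedType.Exports.
Import ComplexField.

Local Open Scope classical_set_scope.
Local Open Scope complex_scope.
Local Open Scope ring_scope.


(** * Square integrable complex functions *)

Section complex_pointwise.
Context {R : realType}.
Implicit Types z w c : R[i].

(** C as a Euclidean plane.  All estimates are made with this real inner
    product, so that every integral is an integral of a real function. *)
Definition redot z w : R :=
  complex.Re z * complex.Re w + complex.Im z * complex.Im w.

Lemma normc_redot z : Normc.normc z ^+ 2 = redot z z.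
Proof.
case: z => a b; rewrite /redot /= sqr_sqrtr ?expr2//.
by rewrite addr_ge0// sqr_ge0.
Qed.

Lemma redot_ge0 z : 0 <= redot z z.
Proof. by rewrite -normc_redot sqr_ge0. Qed.

Lemma normc_ge0 z : 0 <= Normc.normc z.
Proof. by case: z => a b; rewrite sqrtr_ge0. Qed.

Lemma redotC z w : redot z w = redot w z.
Proof. by rewrite /redot mulrC [X in _ + X]mulrC. Qed.

Lemma redotDl z1 z2 w : redot (z1 + z2) w = redot z1 w + redot z2 w.
Proof. by case: z1 z2 w => [a b] [c e] [u v]; rewrite /redot /=; ring. Qed.

Lemma redotDr z w1 w2 : redot z (w1 + w2) = redot z w1 + redot z w2.
Proof. by rewrite redotC redotDl !(redotC z). Qed.

Lemma redotNl z w : redot (- z) w = - redot z w.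
Proof. by case: z w => [a b] [u v]; rewrite /redot /=; ring. Qed.

Lemma redotNr z w : redot z (- w) = - redot z w.
Proof. by rewrite redotC redotNl redotC. Qed.

Lemma redotZl (r : R) z w : redot (r%:C * z) w = r * redot z w.
Proof. by case: z w => [a b] [u v]; rewrite /redot /=; ring. Qed.

Lemma conjCE z : z^* = (complex.Re z) +i* (- complex.Im z).
Proof. by case: z => a b. Qed.

Lemma redotMl c z w : redot (c * z) w = redot z (c^* * w).
Proof.
by rewrite conjCE; case: c z w => [p q] [a b] [u v]; rewrite /redot /=; ring.
Qed.

Lemma redotM c z w : redot (c * z) (c * w) = redot c c * redot z w.
Proof. by case: c z w => [p q] [a b] [u v]; rewrite /redot /=; ring. Qed.

Lemma redotMM c z : redot (c * z) (c * z) = redot c c * redot z z.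
Proof. exact: redotM. Qed.

Lemma ReMconj z w : complex.Re (z * w^*) = redot z w.
Proof. by rewrite conjCE; case: z w => [a b] [u v]; rewrite /redot /=; ring. Qed.

Lemma ImMconj z w : complex.Im (z * w^*) = redot z ('i * w).
Proof. by rewrite conjCE; case: z w => [a b] [u v]; rewrite /redot /=; ring. Qed.

Lemma redot_le z w : `|redot z w| <= (redot z z + redot w w) / 2.
Proof.
rewrite ler_norml; apply/andP; split.
  have := redot_ge0 (z + w); rewrite !(redotDl, redotDr) (redotC w z); lra.
have := redot_ge0 (z - w).
rewrite !(redotDl, redotDr, redotNl, redotNr) (redotC w z); lra.
Qed.

Lemma redot_real (r : R) : redot r%:C r%:C = r ^+ 2.
Proof. by rewrite /redot /= mulr0 addr0 expr2. Qed.

Lemma redotD_le z w : redot (z + w) (z + w) <= 2 * redot z z + 2 * redot w w.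
Proof.
have := redot_ge0 (z - w).
rewrite !(redotDl, redotDr, redotNl, redotNr) (redotC w z); lra.
Qed.

End complex_pointwise.

Section complex_L2.
Context d (T : measurableType d) (R : realType).
Variables (mu : {measure set T -> \bar R}) (D : set T).
Hypothesis mD : measurable D.
Implicit Types f g h : T -> R[i].

Lemma cmeasurable_cst (c : R[i]) : cmeasurable D (fun=> c).
Proof. by split; exact: measurable_cst. Qed.

Lemma cmeasurable_real (f : T -> R) :
  measurable_fun D f -> cmeasurable D (fun x => (f x)%:C).
Proof. by move=> mf; split => //=; exact: measurable_cst. Qed.

Lemma cmeasurableD f g : cmeasurable D f -> cmeasurable D g ->
  cmeasurable D (fun x => f x + g x).
Proof.
move=> [f1 f2] [g1 g2]; split.
  rewrite (_ : (fun x => _) =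
    (fun x => complex.Re (f x) + complex.Re (g x))); last first.
    by apply/funext => x; case: (f x) (g x) => [? ?] [? ?].
  exact: measurable_funD.
rewrite (_ : (fun x => _) =
  (fun x => complex.Im (f x) + complex.Im (g x))); last first.
  by apply/funext => x; case: (f x) (g x) => [? ?] [? ?].
exact: measurable_funD.
Qed.

Lemma cmeasurableM f g : cmeasurable D f -> cmeasurable D g ->
  cmeasurable D (fun x => f x * g x).
Proof.
move=> [f1 f2] [g1 g2]; split.
  rewrite (_ : (fun x => _) = (fun x => complex.Re (f x) * complex.Re (g x)
      - complex.Im (f x) * complex.Im (g x))); last first.
    by apply/funext => x; case: (f x) (g x) => [? ?] [? ?].
  by apply: measurable_funB; exact: measurable_funM.
rewrite (_ : (fun x => _) = (fun x => complex.Re (f x) * complex.Im (g x)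
      + complex.Im (f x) * complex.Re (g x))); last first.
  by apply/funext => x; case: (f x) (g x) => [? ?] [? ?].
by apply: measurable_funD; exact: measurable_funM.
Qed.

Lemma cmeasurableZ c f : cmeasurable D f -> cmeasurable D (fun x => c * f x).
Proof. exact/cmeasurableM/cmeasurable_cst. Qed.

Lemma cmeasurableN f : cmeasurable D f -> cmeasurable D (fun x => - f x).
Proof.
move=> mf; rewrite (_ : (fun x => _) = (fun x => (-1) * f x)).
  exact: cmeasurableZ.
by apply/funext => x; rewrite mulN1r.
Qed.

Lemma cmeasurable_conj f : cmeasurable D f -> cmeasurable D (fun x => (f x)^*).
Proof.
move=> [f1 f2]; split.
  rewrite (_ : (fun x => _) = (fun x => complex.Re (f x)))//.
  by apply/funext => x; case: (f x).
rewrite (_ : (fun x => _) = (fun x => - complex.Im (f x))).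
  exact: measurableT_comp.
by apply/funext => x; case: (f x).
Qed.

Lemma cmeasurable_sum (I : Type) (s : seq I) (F : I -> T -> R[i]) :
  (forall i, cmeasurable D (F i)) ->
  cmeasurable D (fun x => \sum_(i <- s) F i x).
Proof.
move=> mF; elim: s => [|i s ih].
  under eq_fun do rewrite big_nil; exact: cmeasurable_cst.
under eq_fun do rewrite big_cons; exact: cmeasurableD.
Qed.

Lemma eq_cmeasurable f g : (forall x, D x -> f x = g x) ->
  cmeasurable D f -> cmeasurable D g.
Proof.
by move=> fg [f1 f2]; split; [move: f1|move: f2]; apply: eq_measurable_fun => x;
  rewrite inE => Dx; rewrite fg.
Qed.

Lemma measurable_redot f g : cmeasurable D f -> cmeasurable D g ->
  measurable_fun D (fun x => redot (f x) (g x)).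
Proof.
by move=> [f1 f2] [g1 g2]; apply: measurable_funD; exact: measurable_funM.
Qed.

Lemma measurable_normc2 f : cmeasurable D f ->
  measurable_fun D (fun x => ((Normc.normc (f x)) ^+ 2)%:E).
Proof.
move=> mf; apply/measurable_EFinP.
by under eq_fun do rewrite normc_redot; exact: measurable_redot.
Qed.

Lemma integrable_scale (r : R) (F : T -> R) : mu.-integrable D (EFin \o F) ->
  mu.-integrable D (EFin \o (fun x => r * F x)).
Proof.
move=> iF; rewrite (_ : _ \o _ = fun x => (r%:E * (EFin \o F) x)%E).
  exact: integrableZl.
by apply/funext => x.
Qed.

Lemma L2_cmeasurable f : L2 mu D f -> cmeasurable D f.
Proof. by case. Qed.

Lemma L2_redot_self f : L2 mu D f ->
  mu.-integrable D (EFin \o (fun x => redot (f x) (f x))).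
Proof.
move=> [mf ff]; apply/integrableP; split.
  exact/measurable_EFinP/measurable_redot.
rewrite (eq_integral (fun x => ((Normc.normc (f x)) ^+ 2)%:E))//= => x _.
by rewrite normc_redot ger0_norm// redot_ge0.
Qed.

Lemma L2_intro f : cmeasurable D f ->
  mu.-integrable D (EFin \o (fun x => redot (f x) (f x))) -> L2 mu D f.
Proof.
move=> mf /integrableP[_ h]; split => //; move: h.
rewrite /L2normsq (eq_integral (fun x => ((Normc.normc (f x)) ^+ 2)%:E))//= => x _.
by rewrite normc_redot ger0_norm// redot_ge0.
Qed.

Lemma L2_dominated f (g : T -> R) : cmeasurable D f ->
  mu.-integrable D (EFin \o g) ->
  (forall x, D x -> redot (f x) (f x) <= g x) -> L2 mu D f.
Proof.
move=> mf ig fg; apply: L2_intro => //; apply: le_integrable ig => //.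
  exact/measurable_EFinP/measurable_redot.
move=> x Dx /=; rewrite lee_fin ger0_norm ?redot_ge0//.
by rewrite (le_trans (fg x Dx))// ler_norm.
Qed.

Lemma L2_redot f g : L2 mu D f -> L2 mu D g ->
  mu.-integrable D (EFin \o (fun x => redot (f x) (g x))).
Proof.
move=> Lf Lg.
have If := L2_redot_self Lf; have Ig := L2_redot_self Lg.
apply: (@le_integrable _ _ _ _ _ _ _
  ((fun x => (redot (f x) (f x))%:E) \+ (fun x => (redot (g x) (g x))%:E))%E) => //.
- by apply/measurable_EFinP/measurable_redot; exact: L2_cmeasurable.
- move=> x _ /=; rewrite lee_fin (le_trans (redot_le _ _))//.
  have := redot_ge0 (f x); have := redot_ge0 (g x) => ? ?.
  by rewrite ger0_norm; lra.
- exact: integrableD.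
Qed.

Lemma L2D f g : L2 mu D f -> L2 mu D g -> L2 mu D (fun x => f x + g x).
Proof.
move=> Lf Lg.
apply: (@L2_dominated _ (fun x => 2 * redot (f x) (f x) + 2 * redot (g x) (g x))).
- by apply: cmeasurableD; exact: L2_cmeasurable.
- apply: (@integrableD _ _ _ mu D mD (fun x => (2 * redot (f x) (f x))%:E)
    (fun x => (2 * redot (g x) (g x))%:E)).
    exact/integrable_scale/L2_redot_self.
  exact/integrable_scale/L2_redot_self.
- by move=> x _; exact: redotD_le.
Qed.

Lemma L2M f g (M : R) : cmeasurable D g ->
  (forall x, D x -> redot (g x) (g x) <= M) -> L2 mu D f ->
  L2 mu D (fun x => g x * f x).
Proof.
move=> mg gM Lf; apply: (@L2_dominated _ (fun x => M * redot (f x) (f x))).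
- by apply: cmeasurableM => //; exact: L2_cmeasurable.
- exact/integrable_scale/L2_redot_self.
- by move=> x Dx; rewrite redotMM ler_wpM2r ?redot_ge0// gM.
Qed.

Lemma L2Z c f : L2 mu D f -> L2 mu D (fun x => c * f x).
Proof. by apply: (@L2M _ (fun=> c) (redot c c)) => //; exact: cmeasurable_cst. Qed.

Lemma eq_L2normsq f g : (forall x, D x -> f x = g x) ->
  L2normsq mu D f = L2normsq mu D g.
Proof.
by move=> fg; apply: eq_integral => x; rewrite inE => Dx; rewrite fg.
Qed.

Lemma eq_L2 f g : (forall x, D x -> f x = g x) -> L2 mu D f -> L2 mu D g.
Proof.
move=> fg [mf ff]; split; first exact: eq_cmeasurable mf.
by rewrite -(eq_L2normsq fg).
Qed.

Lemma L2N f : L2 mu D f -> L2 mu D (fun x => - f x).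
Proof.
by move=> /(@L2Z (-1)); apply: eq_L2 => x _; rewrite mulN1r.
Qed.

Lemma L2B f g : L2 mu D f -> L2 mu D g -> L2 mu D (fun x => f x - g x).
Proof. by move=> Lf Lg; apply: L2D => //; exact: L2N. Qed.

Lemma L2_0 : L2 mu D (fun=> 0).
Proof.
apply: (@L2_dominated _ (cst 0)).
- exact: cmeasurable_cst.
- exact: integrable0.
- by move=> x _; rewrite /redot /= mulr0 addr0.
Qed.

Lemma L2_sum (I : Type) (s : seq I) (F : I -> T -> R[i]) :
  (forall i, L2 mu D (F i)) -> L2 mu D (fun x => \sum_(i <- s) F i x).
Proof.
move=> mF; elim: s => [|i s ih].
  by under eq_fun do rewrite big_nil; exact: L2_0.
by under eq_fun do rewrite big_cons; exact: L2D.
Qed.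

(** Real parts determine L2inner: the imaginary part of L2inner f g is the real
    part of L2inner f ('i g). *)
Definition rinner f g : R := \int[mu]_(x in D) redot (f x) (g x).
Definition nsq f : R := rinner f f.

Lemma L2normsqE f : L2 mu D f -> L2normsq mu D f = (nsq f)%:E.
Proof.
move=> Lf; rewrite /L2normsq /nsq /rinner /Rintegral fineK.
  by apply: eq_integral => x _; rewrite normc_redot.
exact/integrable_fin_num/L2_redot_self.
Qed.

Lemma nsqE f : nsq f = \int[mu]_(x in D) redot (f x) (f x).
Proof. by []. Qed.

Lemma nsq_ge0 f : 0 <= nsq f.
Proof. by apply: Rintegral_ge0 => x _; exact: redot_ge0. Qed.

Lemma eq_rinner f1 f2 g1 g2 : (forall x, D x -> f1 x = f2 x) ->
  (forall x, D x -> g1 x = g2 x) -> rinner f1 g1 = rinner f2 g2.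
Proof.
by move=> f12 g12; apply: eq_Rintegral => x; rewrite inE => Dx; rewrite f12 ?g12.
Qed.

Lemma eq_nsq f g : (forall x, D x -> f x = g x) -> nsq f = nsq g.
Proof. by move=> fg; exact: eq_rinner. Qed.

Lemma rinnerC f g : rinner f g = rinner g f.
Proof. by apply: eq_Rintegral => x _; exact: redotC. Qed.

Lemma rinnerDl f g h : L2 mu D f -> L2 mu D g -> L2 mu D h ->
  rinner (fun x => f x + g x) h = rinner f h + rinner g h.
Proof.
move=> Lf Lg Lh; rewrite /rinner -RintegralD//; last 2 first.
- exact: L2_redot.
- exact: L2_redot.
by apply: eq_Rintegral => x _; exact: redotDl.
Qed.

Lemma rinnerDr f g h : L2 mu D f -> L2 mu D g -> L2 mu D h ->
  rinner h (fun x => f x + g x) = rinner h f + rinner h g.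
Proof. by move=> *; rewrite rinnerC rinnerDl// !(rinnerC h). Qed.

Lemma rinnerMl c f g : rinner (fun x => c * f x) g = rinner f (fun x => c^* * g x).
Proof. by apply: eq_Rintegral => x _; exact: redotMl. Qed.

Lemma rinnerZl (r : R) f g : L2 mu D f -> L2 mu D g ->
  rinner (fun x => r%:C * f x) g = r * rinner f g.
Proof.
move=> Lf Lg; rewrite /rinner -RintegralZl//; last exact: L2_redot.
by apply: eq_Rintegral => x _; exact: redotZl.
Qed.

Lemma rinnerZr (r : R) f g : L2 mu D f -> L2 mu D g ->
  rinner f (fun x => r%:C * g x) = r * rinner f g.
Proof. by move=> *; rewrite rinnerC rinnerZl// rinnerC. Qed.

Lemma rinnerNl f g : L2 mu D f -> L2 mu D g ->
  rinner (fun x => - f x) g = - rinner f g.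
Proof.
move=> Lf Lg; rewrite -mulN1r -rinnerZl//.
by apply: eq_rinner => // x _; rewrite rmorphN1 mulN1r.
Qed.

Lemma rinnerNr f g : L2 mu D f -> L2 mu D g ->
  rinner f (fun x => - g x) = - rinner f g.
Proof. by move=> *; rewrite rinnerC rinnerNl// rinnerC. Qed.

Lemma rinnerBl f g h : L2 mu D f -> L2 mu D g -> L2 mu D h ->
  rinner (fun x => f x - g x) h = rinner f h - rinner g h.
Proof. by move=> Lf Lg Lh; rewrite rinnerDl ?rinnerNl//; exact: L2N. Qed.

Lemma nsqZ c f : L2 mu D f -> nsq (fun x => c * f x) = redot c c * nsq f.
Proof.
move=> Lf; rewrite /nsq /rinner -RintegralZl//; last exact: L2_redot.
by apply: eq_Rintegral => x _; exact: redotM.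
Qed.

Lemma nsqN f : nsq (fun x => - f x) = nsq f.
Proof. by apply: eq_Rintegral => x _; rewrite redotNl redotNr opprK. Qed.

Lemma nsqBC f g : nsq (fun x => f x - g x) = nsq (fun x => g x - f x).
Proof. by rewrite -nsqN; apply: eq_nsq => x _; rewrite opprB. Qed.

Lemma nsqD f g : L2 mu D f -> L2 mu D g ->
  nsq (fun x => f x + g x) = nsq f + nsq g + 2 * rinner f g.
Proof.
move=> Lf Lg; have Lfg := L2D Lf Lg.
rewrite /nsq rinnerDl// !rinnerDr// (rinnerC g f); lra.
Qed.

Lemma nsqB f g : L2 mu D f -> L2 mu D g ->
  nsq (fun x => f x - g x) = nsq f + nsq g - 2 * rinner f g.
Proof.
by move=> Lf Lg; rewrite nsqD ?nsqN ?rinnerNr ?mulrN//; exact: L2N.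
Qed.

Lemma nsqD_le f g : L2 mu D f -> L2 mu D g ->
  nsq (fun x => f x + g x) <= 2 * nsq f + 2 * nsq g.
Proof.
move=> Lf Lg; have := nsq_ge0 (fun x => f x - g x).
by rewrite nsqB// nsqD//; lra.
Qed.

(** The polynomial t |-> nsq (f + t g) is nonnegative, in particular at its
    minimum.  When nsq g = 0 it is affine, and a point far enough out forces
    rinner f g = 0. *)
Lemma rinner_CS f g : L2 mu D f -> L2 mu D g ->
  rinner f g ^+ 2 <= nsq f * nsq g.
Proof.
move=> Lf Lg.
have h (t : R) : 0 <= nsq f + t ^+ 2 * nsq g + 2 * t * rinner f g.
  have Lt := L2Z (t%:C) Lg.
  have := nsq_ge0 (fun x => f x + t%:C * g x).
  rewrite nsqD// nsqZ// rinnerZr//.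
  have -> : redot t%:C t%:C = t ^+ 2 by rewrite /redot /=; ring.
  by rewrite mulrA.
have [g0|g0] := eqVneq (nsq g) 0.
  have [->|fg0] := eqVneq (rinner f g) 0; first by rewrite g0 mulr0 expr0n.
  have := h (- (nsq f + 1) / (2 * rinner f g)).
  rewrite g0 mulr0 addr0.
  have -> : 2 * (- (nsq f + 1) / (2 * rinner f g)) * rinner f g = - (nsq f + 1).
    by field.
  lra.
have gp : 0 < nsq g by rewrite lt_def g0 nsq_ge0.
have := h (- rinner f g / nsq g).
have -> : nsq f + (- rinner f g / nsq g) ^+ 2 * nsq g +
    2 * (- rinner f g / nsq g) * rinner f g = nsq f - rinner f g ^+ 2 / nsq g.
  by field.
by rewrite subr_ge0 ler_pdivrMr.
Qed.

Definition nrm f : R := Num.sqrt (nsq f).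

Lemma nrm_ge0 f : 0 <= nrm f. Proof. exact: sqrtr_ge0. Qed.

Lemma nrm2 f : nrm f ^+ 2 = nsq f.
Proof. by rewrite sqr_sqrtr// nsq_ge0. Qed.

Lemma rinner_le f g : L2 mu D f -> L2 mu D g -> `|rinner f g| <= nrm f * nrm g.
Proof.
move=> Lf Lg; rewrite -sqrtrM ?nsq_ge0// -sqrtr_sqr ler_wsqrtr//.
exact: rinner_CS.
Qed.

Lemma nrmD f g : L2 mu D f -> L2 mu D g ->
  nrm (fun x => f x + g x) <= nrm f + nrm g.
Proof.
move=> Lf Lg; rewrite -(@ler_pXn2r _ 2)// ?nnegrE ?addr_ge0 ?nrm_ge0//.
rewrite sqrrD !nrm2 nsqD//.
have := ler_norm (rinner f g); have := rinner_le Lf Lg; lra.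
Qed.

Lemma nrmB_dist f g : L2 mu D f -> L2 mu D g ->
  `|nrm f - nrm g| <= nrm (fun x => f x - g x).
Proof.
move=> Lf Lg; have Lfg := L2B Lf Lg.
have Lgf := L2B Lg Lf.
have -> : nrm f = nrm (fun x => (f x - g x) + g x).
  by congr Num.sqrt; apply: eq_nsq => x _; rewrite subrK.
have gE : nrm g <= nrm f + nrm (fun x => f x - g x).
  have -> : nrm g = nrm (fun x => (g x - f x) + f x).
    by congr Num.sqrt; apply: eq_nsq => x _; rewrite subrK.
  rewrite addrC [X in _ <= X + _](_ : _ = nrm (fun x => g x - f x)).
    exact: nrmD.
  by congr Num.sqrt; exact: nsqBC.
have fE : nrm f = nrm (fun x => (f x - g x) + g x).
  by congr Num.sqrt; apply: eq_nsq => x _; rewrite subrK.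
have := nrmD Lfg Lg; rewrite -fE => h.
by rewrite ler_norml; apply/andP; split; lra.
Qed.

Lemma L2innerE f g :
  L2inner mu D f g = rinner f g +i* rinner f (fun x => 'i * g x).
Proof.
rewrite /L2inner /cintegral; congr (_ +i* _); apply: eq_Rintegral => x _.
  exact: ReMconj.
exact: ImMconj.
Qed.

Lemma L2inner_normc2 f g : Normc.normc (L2inner mu D f g) ^+ 2 =
  rinner f g ^+ 2 + rinner f (fun x => 'i * g x) ^+ 2.
Proof. by rewrite L2innerE normc_redot /redot /= !expr2. Qed.

Lemma L2innerDl f g h : L2 mu D f -> L2 mu D g -> L2 mu D h ->
  L2inner mu D (fun x => f x + g x) h = L2inner mu D f h + L2inner mu D g h.
Proof.
by move=> Lf Lg Lh; have Lih := L2Z 'i Lh; rewrite !L2innerE !rinnerDl.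
Qed.

Lemma L2innerZl c f g : L2 mu D f -> L2 mu D g ->
  L2inner mu D (fun x => c * f x) g = c * L2inner mu D f g.
Proof.
move=> Lf Lg; have Lig := L2Z 'i Lg.
have E h : L2 mu D h -> rinner (fun x => c * f x) h =
    complex.Re c * rinner f h - complex.Im c * rinner f (fun x => 'i * h x).
  move=> Lh; have Lih := L2Z 'i Lh.
  rewrite rinnerMl -!rinnerZr// -rinnerNr; last exact: L2Z.
    rewrite -rinnerDr//; last 2 first.
    - exact: L2Z.
    - exact/L2N/L2Z.
    apply: eq_rinner => // x _; rewrite conjCE.
    case: c (h x) => [p q] [u v]; apply/eqP; rewrite eq_complex /=.
    by apply/andP; split; apply/eqP; ring.
  by [].
rewrite !L2innerE !E//.
have -> : rinner f (fun x => 'i * ('i * g x)) = - rinner f g.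
  rewrite -rinnerNr//; apply: eq_rinner => // x _.
  case: (g x) => u v; apply/eqP; rewrite eq_complex /=.
  by apply/andP; split; apply/eqP; ring.
case: c {E} => p q; apply/eqP; rewrite eq_complex /=.
by apply/andP; split; apply/eqP; ring.
Qed.

Lemma L2inner0l g : L2inner mu D (fun=> 0) g = 0.
Proof.
rewrite L2innerE /rinner.
have z (F : T -> R[i]) : \int[mu]_(x in D) redot 0 (F x) = 0.
  under eq_Rintegral do rewrite /redot /= !mul0r addr0.
  by rewrite /Rintegral integral0.
by rewrite !z.
Qed.

Lemma L2innerBl f g h : L2 mu D f -> L2 mu D g -> L2 mu D h ->
  L2inner mu D (fun x => f x - g x) h = L2inner mu D f h - L2inner mu D g h.
Proof.
move=> Lf Lg Lh; rewrite L2innerDl//; last exact: L2N.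
congr (_ + _); rewrite -mulN1r -L2innerZl//.
by congr L2inner; apply/funext => x; rewrite mulN1r.
Qed.

Lemma L2inner_suml (I : Type) (s : seq I) (F : I -> T -> R[i]) g :
  (forall i, L2 mu D (F i)) -> L2 mu D g ->
  L2inner mu D (fun x => \sum_(i <- s) F i x) g =
  \sum_(i <- s) L2inner mu D (F i) g.
Proof.
move=> LF Lg; elim: s => [|i s ih].
  by under eq_fun do rewrite big_nil; rewrite big_nil L2inner0l.
under eq_fun do rewrite big_cons.
by rewrite big_cons L2innerDl ?ih//; exact: L2_sum.
Qed.

Lemma L2inner_conj f g : L2 mu D f -> L2 mu D g ->
  L2inner mu D g f = (L2inner mu D f g)^*.
Proof.
move=> Lf Lg; rewrite !L2innerE conjCE /=; congr (_ +i* _).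
  exact: rinnerC.
rewrite rinnerC rinnerMl -rinnerNr//; last exact: L2Z.
apply: eq_rinner => // x _; rewrite conjCE.
by case: (g x) => u v; apply/eqP; rewrite eq_complex /=;
  apply/andP; split; apply/eqP; ring.
Qed.

Lemma L2inner_self f : L2 mu D f -> L2inner mu D f f = (nsq f)%:C.
Proof.
move=> Lf; rewrite L2innerE; congr (_ +i* _).
rewrite /rinner; under eq_Rintegral.
  move=> x _; rewrite (_ : redot _ _ = 0); last first.
    by case: (f x) => u v; rewrite /redot /=; ring.
  over.
by rewrite /Rintegral integral0.
Qed.

(** The real inequality for f and c g with c = L2inner f g, a choice for which
    the inner product is real. *)
Lemma L2inner_CS f g : L2 mu D f -> L2 mu D g ->
  Normc.normc (L2inner mu D f g) ^+ 2 <= nsq f * nsq g.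
Proof.
move=> Lf Lg; set c := L2inner mu D f g.
have Lcg := L2Z c Lg.
have E : rinner f (fun x => c * g x) = Normc.normc c ^+ 2.
  have := L2innerE f (fun x => c * g x).
  rewrite L2inner_conj// L2innerZl// (L2inner_conj Lf Lg) -/c.
  have -> : Normc.normc c ^+ 2 = complex.Re ((c * c^*)^*).
    rewrite normc_redot !conjCE.
    by case: (c) => p q; rewrite /redot /=; ring.
  by move=> ->.
have := rinner_CS Lf Lcg; rewrite E nsqZ// -normc_redot.
have [->|c0] := eqVneq (Normc.normc c ^+ 2) 0.
  by move=> _; rewrite mulr_ge0// nsq_ge0.
have cp : 0 < Normc.normc c ^+ 2 by rewrite lt_def c0 sqr_ge0.
by rewrite expr2 (mulrCA (nsq f)) ler_pM2l.
Qed.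

End complex_L2.

(** * Completeness and orthogonal series *)

Section esum_fset.
Context {R : realType} {I : choiceType}.
Implicit Type a : I -> \bar R.
Local Open Scope ereal_scope.

Lemma fset_le_esum a (J : {fset I}) : (forall i, 0 <= a i) ->
  \sum_(i <- J) a i <= \esum_(i in [set: I]) a i.
Proof.
move=> a0; apply: ereal_sup_ubound; exists [set` J] => //=.
by rewrite fsbig_finite//= set_fsetK.
Qed.

Lemma esum_le_fset a (b : \bar R) :
  (forall J : {fset I}, \sum_(i <- J) a i <= b) ->
  \esum_(i in [set: I]) a i <= b.
Proof.
move=> ab; apply: ge_ereal_sup => _ [A [finA _] <-].
by rewrite fsbig_finite.
Qed.

Lemma lt_esum_fset a (b : \bar R) : b < \esum_(i in [set: I]) a i ->
  exists J : {fset I}, b < \sum_(i <- J) a i.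
Proof.
move=> h; apply: contrapT => /forallNP H.
have : \esum_(i in [set: I]) a i <= b.
  by apply: esum_le_fset => J; rewrite leNgt; apply/negP; exact: H.
by rewrite leNgt h.
Qed.

End esum_fset.

Lemma big_fset_split (V : nmodType) (I : choiceType) (J J0 : {fset I})
    (F : I -> V) : (J0 `<=` J)%fset ->
  \sum_(i <- J) F i = \sum_(i <- J0) F i + \sum_(i <- (J `\` J0)%fset) F i.
Proof.
move=> J0J; rewrite -big_cat; apply: perm_big; apply: uniq_perm => //.
  rewrite cat_uniq !fset_uniq /= andbT; apply/hasPn => i.
  by rewrite inE => /andP[].
move=> i; rewrite mem_cat inE.
by have [/(fsubsetP J0J) ->|] := boolP (i \in J0).
Qed.

Lemma cvg_geometric_increments (R : realType) (a : R^nat) (C : R) :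
  0 <= C -> (forall k, `|a k.+1 - a k| <= C * (2^-1) ^+ k) -> cvgn a.
Proof.
move=> C0 aC.
have cs : cvgn (series (telescope a)).
  apply: normed_cvg.
  apply: (@series_le_cvg _ _ (geometric C (2^-1))) => //.
  - by move=> k; apply: normr_ge0.
  - by move=> k; apply: mulr_ge0 => //; apply: exprn_ge0; rewrite invr_ge0.
  - apply: is_cvg_geometric_series.
    by rewrite ger0_norm ?invr_ge0// invf_lt1 ?ltr1n.
have -> : a = (fun n => a 0%N + series (telescope a) n).
  by apply/funext => n; exact: eq_sum_telescope.
by apply: is_cvgD => //; exact: is_cvg_cst.
Qed.

Section complex_L2_limits.
Context d (T : measurableType d) (R : realType).
Variables (mu : {measure set T -> \bar R}) (D : set T).
Hypothesis mD : measurable D.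
Implicit Types f g h : T -> R[i].
Local Notation nsq := (nsq mu D).
Local Notation nrm := (nrm mu D).
Local Notation rinner := (rinner mu D).

Lemma cvg_redot (u : nat -> R[i]) (z : R[i]) :
  (fun k => complex.Re (u k)) @ \oo --> complex.Re z ->
  (fun k => complex.Im (u k)) @ \oo --> complex.Im z ->
  (fun k => redot (u k) (u k)) @ \oo --> redot z z.
Proof. by move=> cr ci; apply: cvgD; exact: cvgM. Qed.

Lemma L2normsq_fatou (g_ : nat -> T -> R[i]) g (e : \bar R) :
  (forall k, cmeasurable D (g_ k)) -> cmeasurable D g ->
  {ae mu, forall x, D x ->
     (fun k => complex.Re (g_ k x)) @ \oo --> complex.Re (g x) /\
     (fun k => complex.Im (g_ k x)) @ \oo --> complex.Im (g x)} ->
  (\forall k \near \oo, (L2normsq mu D (g_ k) <= e)%E) ->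
  (L2normsq mu D g <= e)%E.
Proof.
move=> mg_ mg cg ge.
pose F k x := ((Normc.normc (g_ k x)) ^+ 2)%:E.
have mF k : measurable_fun D (F k) by exact: measurable_normc2.
have F0 k x : D x -> (0 <= F k x)%E by move=> _; rewrite lee_fin sqr_ge0.
have := fatou mu mD mF F0.
have le2 : (limn_einf (fun k => \int[mu]_(x in D) F k x) <= e)%E.
  rewrite limn_einf_lim; apply: lime_le; first exact: is_cvg_einfs.
  near=> k; apply: (@le_trans _ _ (\int[mu]_(x in D) F k x)%E).
    by apply: ereal_inf_lbound; exists k => //=.
  by near: k.
move=> /le_trans/(_ le2); apply: le_trans.
apply: ae_ge0_le_integral => //.
- by move=> x _; rewrite lee_fin sqr_ge0.
- exact: measurable_normc2.
- move=> x Dx; rewrite limn_einf_lim; apply: lime_ge; first exact: is_cvg_einfs.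
  by apply: nearW => k; apply: le_ereal_inf_tmp => _ [j _ <-]; exact: F0.
- rewrite (_ : (fun x => _) =
      (fun x => - limn_esup (fun k => - F k x))%E); last first.
    by apply/funext => x; rewrite -limn_einfN; congr limn_einf;
      apply/funext => k; rewrite /comp oppeK.
  apply: measurableT_comp => //; apply: measurable_fun_limn_esup => k.
  exact: measurableT_comp.
- move: cg; apply: filterS => x /[swap] Dx /(_ Dx) [cr ci].
  suff /cvg_limn_einf_sup[-> _] : F ^~ x @ \oo --> ((Normc.normc (g x)) ^+ 2)%:E.
    by [].
  apply: cvg_EFin; first by apply: nearW.
  rewrite normc_redot /comp /=.
  under eq_fun do rewrite normc_redot.
  exact: cvg_redot.
Unshelve. all: by end_near. Qed.

(** Riesz-Fischer.  A subsequence whose increments have square norm at most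
    8 ^- k makes the series of 4 ^ k |increment|^2 integrable, so that the
    increments are dominated by a geometric sequence almost everywhere. *)
Lemma L2_complete (f_ : nat -> T -> R[i]) :
  (forall k, L2 mu D (f_ k)) ->
  (forall e : R, 0 < e -> exists N, forall i j, (N <= i)%N -> (N <= j)%N ->
     nsq (fun x => f_ i x - f_ j x) <= e) ->
  exists f, L2 mu D f /\ forall e : R, 0 < e -> exists N, forall i,
     (N <= i)%N -> nsq (fun x => f_ i x - f x) <= e.
Proof.
move=> Lf Cf.
have /choice[N hN] k : exists N, forall i j, (N <= i)%N -> (N <= j)%N ->
     nsq (fun x => f_ i x - f_ j x) <= (8^-1) ^+ k.
  by apply: Cf; rewrite exprn_gt0// invr_gt0.
pose n k := (\max_(j < k.+1) N j + k)%N.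
have Nn k : (N k <= n k)%N.
  apply: leq_trans (leq_addr _ _).
  exact: (@leq_bigmax _ (fun j : 'I_k.+1 => N j) ord_max).
have n_ge k : (k <= n k)%N by exact: leq_addl.
have n_mono k : (n k <= n k.+1)%N.
  by rewrite /n leq_add// [X in (_ <= X)%N]big_ord_recr; exact: leq_maxl.
pose h k := f_ (n k).
pose u k x : \bar R := ((4 ^+ k) * redot (h k.+1 x - h k x) (h k.+1 x - h k x))%:E.
have Lh k : L2 mu D (fun x => h k.+1 x - h k x) by exact: (L2B mD (Lf _) (Lf _)).
have u0 k x : (0 <= u k x)%E by rewrite lee_fin mulr_ge0 ?redot_ge0 ?exprn_ge0.
have mu_ k : measurable_fun D (u k).
  apply/measurable_EFinP/measurable_funM => //.
  by apply: measurable_redot; exact: (L2_cmeasurable (Lh k)).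
have iu : (\int[mu]_(x in D) (\sum_(k <oo) u k x) < +oo)%E.
  rewrite integral_nneseries//.
  apply: (@le_lt_trans _ _ (\sum_(k <oo) ((2^-1) ^+ k)%:E)%E).
    apply: lee_nneseries; first by move=> k _ _; exact: integral_ge0.
    move=> k _.
    rewrite (_ : (\int[mu]_(x in D) u k x)%E =
        (4 ^+ k * nsq (fun x => h k.+1 x - h k x))%:E).
      rewrite lee_fin (_ : (2^-1) ^+ k = 4 ^+ k * (8^-1) ^+ k); last first.
        by rewrite -exprMn; congr (_ ^+ _); field.
      rewrite ler_pM2l ?exprn_gt0//; apply: hN => //.
      exact: leq_trans (Nn k) (n_mono k).
    rewrite EFinM /nsq /rinner /Rintegral fineK; last first.
      exact/integrable_fin_num/L2_redot_self.
    rewrite -integralZl//; last exact: L2_redot_self.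
  have cg : cvgn (series (geometric (1 : R) (2^-1))).
    apply: is_cvg_geometric_series.
    by rewrite ger0_norm ?invr_ge0// invf_lt1 ?ltr1n.
  rewrite (_ : (fun n => _) =
      (EFin \o series (geometric (1 : R) (2^-1)))); last first.
    apply/funext => j; rewrite /series /= sumEFin; congr EFin.
    by apply: eq_bigr => i _; rewrite /geometric /= mul1r.
  by rewrite EFin_lim// ltry.
pose G x := (\sum_(k <oo) u k x)%E.
have G0 x : (0 <= G x)%E by exact: nneseries_ge0.
have mG : measurable_fun D G by apply: ge0_emeasurable_sum.
pose E := D `&` [set x | (G x < +oo)%E].
have mE : measurable E by apply: emeasurable_fun_infty_o.
have ae_E : {ae mu, forall x, D x -> E x}.
  have iG : mu.-integrable D G.
    apply/integrableP; split => //.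
    by under eq_integral do rewrite gee0_abs//.
  have := integrable_ae mD iG; apply: filterS => x /[swap] Dx /(_ Dx) fG.
  by split => //=; rewrite -ge0_fin_numE.
have incr x : E x -> forall k,
    `|complex.Re (h k.+1 x) - complex.Re (h k x)| <=
      Num.sqrt (fine (G x)) * (2^-1) ^+ k /\
    `|complex.Im (h k.+1 x) - complex.Im (h k x)| <=
      Num.sqrt (fine (G x)) * (2^-1) ^+ k.
  move=> [Dx Gx] k.
  have : (u k x <= G x)%E.
    apply: le_trans (nneseries_lim_ge k.+1 _); last by move=> i _ _; exact: u0.
    by rewrite big_nat_recr//= leeDr// sume_ge0.
  rewrite -(@fineK _ (G x)) ?ge0_fin_numE// lee_fin => uG.
  have key (a b : R) : redot (h k.+1 x - h k x) (h k.+1 x - h k x) = a ^+ 2 + b ^+ 2 ->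
      `|a| <= Num.sqrt (fine (G x)) * (2^-1) ^+ k.
    move=> E1; rewrite -sqrtr_sqr.
    rewrite (_ : (2^-1) ^+ k = Num.sqrt (((2^-1) ^+ k) ^+ 2)); last first.
      by rewrite sqrtr_sqr ger0_norm// exprn_ge0// invr_ge0.
    rewrite -sqrtrM; last exact: fine_ge0.
    rewrite ler_wsqrtr//.
    have p4 : (0 : R) < 4 ^+ k by rewrite exprn_gt0.
    rewrite -(ler_pM2l p4) [X in _ <= X]mulrCA.
    rewrite (_ : 4 ^+ k * ((2^-1) ^+ k) ^+ 2 = 1); last first.
      rewrite exprAC -exprMn (_ : 4 * _ = 1) ?expr1n//; by field.
    rewrite mulr1 (le_trans _ uG)// E1 ler_pM2l// lerDl sqr_ge0//.
  split.
    apply: (key _ (complex.Im (h k.+1 x) - complex.Im (h k x))).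
    by case: (h k.+1 x) (h k x) => [a b] [c e]; rewrite /redot /=; ring.
  apply: (key _ (complex.Re (h k.+1 x) - complex.Re (h k x))).
  by case: (h k.+1 x) (h k x) => [a b] [c e]; rewrite /redot /=; ring.
pose hr k x := \1_E x * complex.Re (h k x).
pose hi k x := \1_E x * complex.Im (h k x).
have cr x : E x -> cvgn (fun k => complex.Re (h k x)).
  move=> Ex; apply: (@cvg_geometric_increments _ _ (Num.sqrt (fine (G x)))).
    exact: sqrtr_ge0.
  by move=> k; have [] := incr x Ex k.
have ci x : E x -> cvgn (fun k => complex.Im (h k x)).
  move=> Ex; apply: (@cvg_geometric_increments _ _ (Num.sqrt (fine (G x)))).
    exact: sqrtr_ge0.
  by move=> k; have [] := incr x Ex k.
have chr x : D x -> cvgn (hr ^~ x).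
  move=> Dx; rewrite /hr indicE; have [Ex|Ex] := pselect (E x).
    rewrite mem_set//=; under eq_fun do rewrite mul1r; exact: cr.
  by rewrite memNset//=; under eq_fun do rewrite mul0r; exact: is_cvg_cst.
have chi x : D x -> cvgn (hi ^~ x).
  move=> Dx; rewrite /hi indicE; have [Ex|Ex] := pselect (E x).
    rewrite mem_set//=; under eq_fun do rewrite mul1r; exact: ci.
  by rewrite memNset//=; under eq_fun do rewrite mul0r; exact: is_cvg_cst.
pose f x : R[i] := limn (hr ^~ x) +i* limn (hi ^~ x).
have mh k : cmeasurable D (h k) by exact/L2_cmeasurable/Lf.
have mf : cmeasurable D f.
  split.
    apply: (measurable_fun_cvg (h := hr)) => [k|x Dx]; last exact: chr.
    by apply: measurable_funM; [exact: measurable_indic|exact: (mh k).1].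
  apply: (measurable_fun_cvg (h := hi)) => [k|x Dx]; last exact: chi.
  by apply: measurable_funM; [exact: measurable_indic|exact: (mh k).2].
have lim_le i (e : R) : (\forall k \near \oo, nsq (fun x => f_ i x - h k x) <= e) ->
    (L2normsq mu D (fun x => (f_ i x - f x)%R) <= e%:E)%E.
  move=> fe; apply: (@L2normsq_fatou (fun k x => f_ i x - h k x)).
  - by move=> k; apply: L2_cmeasurable; apply: L2B => //; exact: Lf.
  - apply: cmeasurableD; first exact: L2_cmeasurable.
    exact: cmeasurableN.
  - move: ae_E; apply: filterS => x /[swap] Dx /(_ Dx) Ex.
    have limr : limn (hr ^~ x) = limn (fun k => complex.Re (h k x)).
      by rewrite (_ : hr ^~ x = fun k => complex.Re (h k x))//; apply/funext => k; rewrite /hr indicE mem_set//= mul1r.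
    have limi : limn (hi ^~ x) = limn (fun k => complex.Im (h k x)).
      by rewrite (_ : hi ^~ x = fun k => complex.Im (h k x))//; apply/funext => k; rewrite /hi indicE mem_set//= mul1r.
    split.
      rewrite (_ : (fun k => _) =
          (fun k => complex.Re (f_ i x) - complex.Re (h k x))); last first.
        by apply/funext => k; case: (f_ i x) (h k x) => [a b] [c e'].
      rewrite (_ : complex.Re (f_ i x - f x) = complex.Re (f_ i x) - limn (hr ^~ x)); last first.
        by rewrite /f; case: (f_ i x).
      apply: cvgB; [exact: cvg_cst|rewrite limr; exact: (cr x Ex)].
    rewrite (_ : (fun k => _) =
        (fun k => complex.Im (f_ i x) - complex.Im (h k x))); last first.
      by apply/funext => k; case: (f_ i x) (h k x) => [a b] [c e'].
    rewrite (_ : complex.Im (f_ i x - f x) = complex.Im (f_ i x) - limn (hi ^~ x)); last first.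
      by rewrite /f; case: (f_ i x).
    by apply: cvgB; [exact: cvg_cst|rewrite limi; exact: (ci x Ex)].
  - move: fe; apply: filterS => k; rewrite L2normsqE// ?lee_fin//.
    by apply: L2B => //; exact: Lf.
have lim_ok (e : R) : 0 < e -> exists N, forall i, (N <= i)%N ->
    (L2normsq mu D (fun x => (f_ i x - f x)%R) <= e%:E)%E.
  move=> e0; have [M hM] := Cf e e0; exists M => i Mi; apply: lim_le.
  by exists M => // k /= Mk; apply: hM => //; exact: leq_trans (n_ge k).
have Lfm : L2 mu D f.
  have [K hK] := lim_ok 1 ltr01.
  have L1 : L2 mu D (fun x => f_ K x - f x).
    split.
      apply: cmeasurableD; first exact: L2_cmeasurable.
      exact: cmeasurableN.
    by rewrite (le_lt_trans (hK K (leqnn _)))// ltry.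
  have := L2B mD (Lf K) L1; apply: eq_L2 => x _.
  by rewrite opprB addrC subrK.
exists f; split => // e e0; have [K hK] := lim_ok e e0; exists K => i Ki.
have := hK i Ki; rewrite L2normsqE// ?lee_fin//.
exact: L2B.
Qed.

Lemma half_expn_small (e : R) : 0 < e ->
  exists N, forall k, (N <= k)%N -> (2^-1 : R) ^+ k <= e.
Proof.
move=> e0.
have c0 : (fun k => (2^-1 : R) ^+ k) @ \oo --> (0 : R).
  by apply: cvg_expr; rewrite ger0_norm ?invr_ge0// invf_lt1 ?ltr1n.
have /cvgrPdist_le/(_ _ e0)[K _ hK] := c0.
exists K => k Kk; have := hK k Kk; by rewrite sub0r normrN ger0_norm.
Qed.

Lemma nsqB_split f g h : L2 mu D f -> L2 mu D g -> L2 mu D h ->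
  nsq (fun x => f x - h x) <=
  2 * nsq (fun x => f x - g x) + 2 * nsq (fun x => g x - h x).
Proof.
move=> Lf Lg Lh.
apply: le_trans (nsqD_le mD (L2B mD Lf Lg) (L2B mD Lg Lh)).
by rewrite le_eqVlt; apply/orP; left; apply/eqP; apply: eq_nsq => x _;
  rewrite addrA subrK.
Qed.

Lemma nsq_near f g (r : R) : L2 mu D f -> L2 mu D g -> 0 <= r <= 1 ->
  nsq (fun x => f x - g x) <= r ^+ 2 ->
  `|nsq f - nsq g| <= r * (2 * nrm g + 1).
Proof.
move=> Lf Lg /andP[r0 r1] fg.
have : nrm (fun x => f x - g x) <= r.
  by rewrite -(@ler_pXn2r _ 2)// ?nnegrE ?nrm_ge0// nrm2.
move=> /(le_trans (nrmB_dist mD Lf Lg)); rewrite -!nrm2.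
have := nrm_ge0 mu D f; have := nrm_ge0 mu D g.
move: (nrm f) (nrm g) => a b b0 a0; rewrite subr_sqr normrM => h.
apply: ler_pM => //; rewrite ger0_norm ?addr_ge0//.
by move: h; rewrite ler_norml => /andP[]; lra.
Qed.

Section L2sum.
Context {I : choiceType}.
Implicit Types (z : I -> T -> R[i]) (Z : T -> R[i]).

Lemma L2sumP z Z : (forall i, L2 mu D (z i)) -> L2 mu D Z ->
  (L2sum mu D z Z <-> forall e : R, 0 < e -> exists J0 : {fset I},
     forall J : {fset I}, (J0 `<=` J)%fset ->
       nsq (fun x => \sum_(i <- J) z i x - Z x) < e).
Proof.
move=> Lz LZ; split=> h e /h[J0 hJ0]; exists J0 => J /hJ0;
  by rewrite L2normsqE// ?lte_fin//; apply: L2B => //; exact: L2_sum.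
Qed.

(** Completeness is applied along a sequence of finite sets J0 k with errors
    2 ^- k; the Cauchy condition then carries the limit over to the net of all
    finite sets. *)
Lemma L2sum_complete z : (forall i, L2 mu D (z i)) ->
  (forall e : R, 0 < e -> exists J0 : {fset I}, forall J : {fset I},
     (J0 `<=` J)%fset ->
     nsq (fun x => \sum_(i <- J) z i x - \sum_(i <- J0) z i x) <= e) ->
  exists Z, L2 mu D Z /\ L2sum mu D z Z.
Proof.
move=> Lz Cz.
have LS (J : {fset I}) : L2 mu D (fun x => \sum_(i <- J) z i x) by exact: L2_sum.
have /choice[J0 hJ0] k : exists J0 : {fset I}, forall J : {fset I},
    (J0 `<=` J)%fset ->
    nsq (fun x => \sum_(i <- J) z i x - \sum_(i <- J0) z i x) <= (2^-1) ^+ k.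
  by apply: Cz; rewrite exprn_gt0// invr_gt0.
have [Z [LZ hZ]] : exists f, L2 mu D f /\ forall e : R, 0 < e ->
    exists N, forall k, (N <= k)%N ->
      nsq (fun x => \sum_(i <- J0 k) z i x - f x) <= e.
  apply: (@L2_complete (fun k x => \sum_(i <- J0 k) z i x)) => // e e0.
  have [|N hN] := @half_expn_small (e / 4); first by rewrite divr_gt0.
  exists N => i j Ni Nj.
  have := nsqB_split (LS (J0 i)) (LS (J0 i `|` J0 j)%fset) (LS (J0 j)).
  have := hJ0 i _ (fsubsetUl (J0 i) (J0 j)).
  have := hJ0 j _ (fsubsetUr (J0 i) (J0 j)).
  rewrite [in X in _ -> X -> _]nsqBC.
  have := hN _ Ni; have := hN _ Nj; lra.
exists Z; split => //; apply/L2sumP => // e e0.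
have e8 : 0 < e / 8 by rewrite divr_gt0.
have [N hN] := half_expn_small e8; have [M hM] := hZ _ e8.
exists (J0 (maxn N M)) => J hJ.
have := nsqB_split (LS J) (LS (J0 (maxn N M))) LZ.
have := hJ0 _ _ hJ; have := hN _ (leq_maxl N M); have := hM _ (leq_maxr N M).
lra.
Qed.

Lemma L2sum_nsq z Z : (forall i, L2 mu D (z i)) -> L2 mu D Z ->
  L2sum mu D z Z -> forall e : R, 0 < e ->
  exists J0 : {fset I}, forall J : {fset I}, (J0 `<=` J)%fset ->
    `|nsq (fun x => \sum_(i <- J) z i x) - nsq Z| <= e.
Proof.
move=> Lz LZ /(L2sumP Lz LZ) h e e0.
have c0 : 0 < 2 * nrm Z + 1 by have := nrm_ge0 mu D Z; lra.
pose r := Num.min 1 (e / (2 * nrm Z + 1)).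
have r0 : 0 < r by rewrite lt_min ltr01 divr_gt0.
have [|J0 hJ0] := h (r ^+ 2); first by rewrite exprn_gt0.
exists J0 => J /hJ0/ltW hJ; apply: (@le_trans _ _ (r * (2 * nrm Z + 1))).
  apply: nsq_near => //; first exact: L2_sum.
  by rewrite (ltW r0) /r ge_min lexx.
by rewrite -ler_pdivlMr// /r ge_min lexx orbT.
Qed.

Lemma L2sum_inner z Z g : (forall i, L2 mu D (z i)) -> L2 mu D Z ->
  L2 mu D g -> L2sum mu D z Z -> forall e : R, 0 < e ->
  exists J0 : {fset I}, forall J : {fset I}, (J0 `<=` J)%fset ->
    Normc.normc (\sum_(i <- J) L2inner mu D (z i) g - L2inner mu D Z g) ^+ 2 <= e.
Proof.
move=> Lz LZ Lg /(L2sumP Lz LZ) h e e0.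
have c0 : 0 < nsq g + 1 by have := nsq_ge0 mu D g; lra.
have [|J0 hJ0] := h (e / (nsq g + 1)); first by rewrite divr_gt0.
exists J0 => J /hJ0/ltW hJ.
have LS : L2 mu D (fun x => \sum_(i <- J) z i x) by exact: L2_sum.
rewrite -L2inner_suml// -L2innerBl//.
apply: (le_trans (L2inner_CS mD (L2B mD LS LZ) Lg)).
apply: (@le_trans _ _ (e / (nsq g + 1) * (nsq g + 1))).
  by apply: ler_pM => //; [exact: nsq_ge0|exact: nsq_ge0|lra].
by rewrite divfK// gt_eqF.
Qed.

Section orthogonal.
Variable z : I -> T -> R[i].
Hypothesis Lz : forall i, L2 mu D (z i).
Hypothesis oz : forall i j, i != j -> rinner (z i) (z j) = 0.

Lemma nsq_orthogonal_sum (s : seq I) : uniq s ->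
  nsq (fun x => \sum_(i <- s) z i x) = \sum_(i <- s) nsq (z i).
Proof.
elim: s => [_|i s ih /= /andP[iS us]].
  rewrite big_nil /nsq /rinner /Rintegral integral0_eq// => x _.
  by rewrite big_nil /redot /= !mulr0 addr0.
have LS : L2 mu D (fun x => \sum_(i <- s) z i x) by exact: L2_sum.
rewrite big_cons -ih// (_ : nsq _ =
  nsq (fun x => z i x + \sum_(j <- s) z j x)); last first.
  by apply: eq_nsq => x _; rewrite big_cons.
rewrite nsqD// [X in _ + 2 * X](_ : _ = 0) ?mulr0 ?addr0//.
elim: s iS {us ih LS} => [_|j s ih].
  rewrite /rinner /Rintegral integral0_eq// => x _.
  by rewrite big_nil /redot /= !mulr0 addr0.
rewrite inE negb_or => /andP[ij iS].
have LS : L2 mu D (fun x => \sum_(i <- s) z i x) by exact: L2_sum.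
rewrite (_ : rinner _ _ =
  rinner (z i) (fun x => z j x + \sum_(k <- s) z k x)); last first.
  by apply: eq_rinner => // x _; rewrite big_cons.
by rewrite rinnerDr// oz// ih// addr0.
Qed.

(** By Pythagoras the differences of partial sums have the tails of the series
    of square norms as their square norms. *)
Lemma L2sum_orthogonal_exists :
  (\esum_(i in [set: I]) (nsq (z i))%:E < +oo)%E ->
  exists Z, L2 mu D Z /\ L2sum mu D z Z.
Proof.
move=> fin; apply: L2sum_complete => // e e0.
set S := (\esum_(i in _) _)%E in fin.
have S0 : (0 <= S)%E by apply: esum_ge0 => i _; rewrite lee_fin nsq_ge0.
have Sfin : S \is a fin_num by rewrite ge0_fin_numE.
have [J0] : exists J : {fset I}, (S - e%:E < \sum_(i <- J) (nsq (z i))%:E)%E.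
  by apply: lt_esum_fset; rewrite lteBlDr// lteDl.
move=> hJ0; exists J0 => J J0J.
rewrite (_ : nsq _ = nsq (fun x => \sum_(i <- (J `\` J0)%fset) z i x)); last first.
  by apply: eq_nsq => x _; rewrite (big_fset_split _ J0J) addrC addrA addNr add0r.
rewrite nsq_orthogonal_sum//.
have := @fset_le_esum R I (fun i => (nsq (z i))%:E) J.
move=> /(_ (fun i => nsq_ge0 mu D (z i))); rewrite -/S.
rewrite (big_fset_split _ J0J) !sumEFin in hJ0 *.
rewrite -(fineK Sfin) -EFinB -EFinD !lte_fin lee_fin in hJ0 *.
lra.
Qed.

Lemma L2sum_orthogonal_nsq Z : L2 mu D Z -> L2sum mu D z Z ->
  \esum_(i in [set: I]) (nsq (z i))%:E = (nsq Z)%:E.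
Proof.
move=> LZ sZ; have near := L2sum_nsq Lz LZ sZ.
apply/eqP; rewrite eq_le; apply/andP; split.
  apply: esum_le_fset => J; apply/lee_addgt0Pr => e e0.
  have [J0 hJ0] := near _ e0.
  have := hJ0 (J0 `|` J)%fset (fsubsetUl _ _).
  rewrite nsq_orthogonal_sum// (big_fset_split _ (fsubsetUr J0 J)).
  have : 0 <= \sum_(i <- ((J0 `|` J) `\` J)%fset) nsq (z i).
    by apply: sumr_ge0 => i _; exact: nsq_ge0.
  rewrite sumEFin -EFinD lee_fin => s0.
  by rewrite ler_norml => /andP[_]; lra.
apply/lee_addgt0Pr => e e0; have [J0 hJ0] := near _ e0.
have := hJ0 J0 (fsubset_refl _); rewrite nsq_orthogonal_sum// => h.
apply: (@le_trans _ _ (\sum_(i <- J0) (nsq (z i))%:E + e%:E)%E).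
  by rewrite sumEFin -EFinD lee_fin; move: h; rewrite ler_norml => /andP[]; lra.
rewrite leeD2r// fset_le_esum// => i.
by rewrite lee_fin nsq_ge0.
Qed.

End orthogonal.
End L2sum.
End complex_L2_limits.

(** * Density of trigonometric sums and Parseval's identity *)

Lemma bernoulli_le (R : realFieldType) (t : R) n :
  -1 <= t -> 1 + n%:R * t <= (1 + t) ^+ n.
Proof.
move=> t1; elim: n => [|n ih]; first by rewrite mul0r addr0 expr0.
rewrite exprS; have : 0 <= 1 + t by lra.
move=> /ler_wpM2l/(_ _ _ ih); apply: le_trans.
rewrite -natr1; have : 0 <= n%:R * t ^+ 2 by rewrite mulr_ge0 ?sqr_ge0.
lra.
Qed.

(** The two estimates behind the Brosowski-Deutsch polynomials
    (1 - x ^ m) ^ (2 ^ m): they tend to 1 for x < 1/2 and to 0 for x > 1/2. *)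
Lemma threshold_lower (R : realFieldType) (x : R) m : 0 <= x <= 1 ->
  1 - (2 * x) ^+ m <= (1 - x ^+ m) ^+ (2 ^ m).
Proof.
move=> /andP[x0 x1]; have : -1 <= - x ^+ m.
  by rewrite lerN2 exprn_ile1.
by move=> /(bernoulli_le (2 ^ m)); rewrite natrX mulrN -exprMn.
Qed.

Lemma threshold_upper (R : realFieldType) (x : R) m : 0 <= x <= 1 ->
  (2 * x) ^+ m * (1 - x ^+ m) ^+ (2 ^ m) <= 1.
Proof.
move=> /andP[x0 x1]; have xm0 : 0 <= x ^+ m by rewrite exprn_ge0.
have xm1 : x ^+ m <= 1 by rewrite exprn_ile1.
have h : (2 * x) ^+ m <= (1 + x ^+ m) ^+ (2 ^ m).
  have h1 : -1 <= x ^+ m by lra.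
  by have := bernoulli_le (2 ^ m) h1; rewrite natrX -exprMn; lra.
apply: (@le_trans _ _ ((1 + x ^+ m) ^+ (2 ^ m) * (1 - x ^+ m) ^+ (2 ^ m))).
  by apply: ler_wpM2r => //; rewrite exprn_ge0// subr_ge0.
rewrite -exprMn exprn_ile1//; first by rewrite mulr_ge0; lra.
by have := sqr_ge0 (x ^+ m); lra.
Qed.

Lemma cvg_expr0 (R : realType) (x : R) : 0 <= x < 1 ->
  (fun m => x ^+ m) @ \oo --> (0 : R).
Proof. by move=> /andP[x0 x1]; apply: cvg_expr; rewrite ger0_norm. Qed.

Lemma cvg_threshold_lt (R : realType) (x : R) : 0 <= x -> x < 2^-1 ->
  (fun m => (1 - x ^+ m) ^+ (2 ^ m)) @ \oo --> (1 : R).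
Proof.
move=> x0 x1; have x01 : 0 <= x <= 1 by lra.
apply: (@squeeze_cvgr _ _ _ _ (fun m => 1 - (2 * x) ^+ m) (fun=> 1)).
- apply: nearW => m; rewrite threshold_lower//= exprn_ile1//.
    by rewrite subr_ge0 exprn_ile1//; lra.
  by rewrite gerBl exprn_ge0.
- rewrite -[X in _ --> X]subr0; apply: cvgB; first exact: cvg_cst.
  by apply: cvg_expr0; lra.
- exact: cvg_cst.
Qed.

Lemma cvg_threshold_gt (R : realType) (x : R) : 2^-1 < x -> x <= 1 ->
  (fun m => (1 - x ^+ m) ^+ (2 ^ m)) @ \oo --> (0 : R).
Proof.
move=> x0 x1; have x01 : 0 <= x <= 1 by lra.
apply: (@squeeze_cvgr _ _ _ _ (fun=> 0) (fun m => ((2 * x)^-1) ^+ m)).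
- apply: nearW => m; rewrite exprn_ge0/=; last by rewrite subr_ge0 exprn_ile1//; lra.
  have xp : 0 < (2 * x) ^+ m by rewrite exprn_gt0//; lra.
  by rewrite exprVn -[X in _ <= X]mul1r ler_pdivlMr// mulrC threshold_upper.
- exact: cvg_cst.
- apply: cvg_expr0; rewrite invr_ge0 invf_lt1; last by lra.
  by apply/andP; split; lra.
Qed.

(** The family e is a group of unimodular functions.  The condition e_generate,
    that a sigma-algebra on D contains all measurable sets as soon as it makes
    the characters measurable, plays the part of the separation of points in the
    Stone-Weierstrass theorem. *)
Section characters.
Context d (T : measurableType d) (R : realType).
Variables (mu : {measure set T -> \bar R}) (D : set T).
Hypothesis mD : measurable D.
Variables (I : choiceType) (e : I -> T -> R[i]).
Hypothesis me : forall i, cmeasurable D (e i).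
Hypothesis e_unit : forall i x, redot (e i x) (e i x) = 1.
Hypothesis e_one : exists k, forall x, D x -> e k x = 1.
Hypothesis e_mul : forall i j, exists k, forall x, D x -> e k x = e i x * e j x.
Hypothesis e_conj : forall i, exists k, forall x, D x -> e k x = (e i x)^*.
Hypothesis e_generate : forall S : set (set T), sigma_algebra D S ->
  (forall i c, S (D `&` [set x | c < complex.Re (e i x)])) ->
  (forall i c, S (D `&` [set x | c < complex.Im (e i x)])) ->
  forall E, measurable E -> S (D `&` E).
Local Notation nsq := (nsq mu D).
Local Notation nrm := (nrm mu D).
Local Notation rinner := (rinner mu D).

Definition lincomb (s : seq (R[i] * I)) x : R[i] := \sum_(p <- s) p.1 * e p.2 x.

Lemma cmeasurable_lincomb s : cmeasurable D (lincomb s).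
Proof. by apply: cmeasurable_sum => p; exact: cmeasurableZ. Qed.

Lemma lincomb_bounded s : exists2 M, 0 <= M &
  forall x, redot (lincomb s x) (lincomb s x) <= M.
Proof.
elim: s => [|[c i] s [M M0 ih]].
  by exists 0 => // x; rewrite /lincomb big_nil /redot /= mulr0 addr0.
exists (2 * redot c c + 2 * M).
  by have := redot_ge0 c; lra.
move=> x; rewrite /lincomb big_cons; apply: le_trans (redotD_le _ _) _.
by rewrite redotMM e_unit mulr1 lerD// ler_wpM2l// ih.
Qed.

Lemma lincomb_cat s t x : lincomb (s ++ t) x = lincomb s x + lincomb t x.
Proof. by rewrite /lincomb big_cat. Qed.

Lemma lincomb_mul s t : exists u, forall x, D x ->
  lincomb u x = lincomb s x * lincomb t x.
Proof.
elim: s => [|[c i] s [u hu]].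
  by exists [::] => x _; rewrite /lincomb !big_nil mul0r.
have [v hv] : exists v, forall x, D x ->
    lincomb v x = (c * e i x) * lincomb t x.
  elim: t {hu} => [|[b j] t [v hv]].
    by exists [::] => x _; rewrite /lincomb !big_nil mulr0.
  have [k hk] := e_mul i j.
  exists ((c * b, k) :: v) => x Dx.
  rewrite /lincomb !big_cons /= mulrDr -/(lincomb _ _) -/(lincomb t x) hv//.
  by rewrite hk// mulrACA.
exists (v ++ u) => x Dx; rewrite lincomb_cat hv// hu//.
by rewrite /lincomb big_cons /= mulrDl.
Qed.

Section density.
(** Approximation takes place in L^2(|s|^2 mu): the frame argument below needs it
    for a weight which is not known to be bounded. *)
Variable s : T -> R[i].
Hypothesis Ls : L2 mu D s.

Let approximable (F : T -> R) := forall r : R, 0 < r ->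
  exists t, nsq (fun x => ((F x)%:C - lincomb t x) * s x) <= r.

Let apx (F : T -> R) := [/\ measurable_fun D F,
  exists M, forall x, D x -> `|F x| <= M & approximable F].

Let nsqM_le (g f : T -> R[i]) (M : R) : cmeasurable D g ->
  (forall x, D x -> redot (g x) (g x) <= M) -> L2 mu D f ->
  nsq (fun x => g x * f x) <= M * nsq f.
Proof.
move=> mg gM Lf; have Lgf := L2M mD mg gM Lf.
rewrite !nsqE -RintegralZl//; last exact: L2_redot.
apply: le_Rintegral => //.
- exact: L2_redot.
- exact/integrable_scale/L2_redot.
- by move=> x Dx; rewrite redotMM ler_wpM2r ?redot_ge0// gM.
Qed.

Let L2_real_mul (F : T -> R) : measurable_fun D F ->
  (exists M, forall x, D x -> `|F x| <= M) -> L2 mu D (fun x => (F x)%:C * s x).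
Proof.
move=> mF [M FM]; apply: (@L2M _ _ _ _ _ mD s (fun x => (F x)%:C) (M ^+ 2)) => //.
by move=> x Dx; rewrite redot_real -real_normK ?num_real// lerXn2r ?nnegrE//
  ?FM// (le_trans _ (FM x Dx)).
Qed.

Let L2_lincomb_mul t : L2 mu D (fun x => lincomb t x * s x).
Proof.
have [M _ tM] := lincomb_bounded t.
by apply: (@L2M _ _ _ _ _ mD s (lincomb t) M) => //; exact: cmeasurable_lincomb.
Qed.

Let eq_apx F G : (forall x, D x -> F x = G x) -> apx F -> apx G.
Proof.
move=> FG [mF [M FM] aF]; split.
- by apply: eq_measurable_fun mF => x; rewrite inE => Dx; rewrite FG.
- by exists M => x Dx; rewrite -FG// FM.
- move=> r /aF[t ht]; exists t; rewrite (_ : nsq _ =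
    nsq (fun x => ((F x)%:C - lincomb t x) * s x))//.
  by apply: eq_nsq => x Dx; rewrite FG.
Qed.

Let apx_lincomb s0 : (forall x, D x -> complex.Im (lincomb s0 x) = 0) ->
  apx (fun x => complex.Re (lincomb s0 x)).
Proof.
move=> im0; have [M M0 hM] := lincomb_bounded s0; split.
- exact: (cmeasurable_lincomb s0).1.
- exists (M + 1) => x _; have := hM x; case: (lincomb s0 x) => a b.
  rewrite /redot /= => h.
  rewrite -(@ler_pXn2r _ 2)// ?nnegrE//; last by lra.
  by rewrite real_normK ?num_real//; have := sqr_ge0 b; have := sqr_ge0 M; lra.
- move=> r r0; exists s0; rewrite nsqE /Rintegral integral0_eq// ?ltW//.
  move=> x Dx; have := im0 x Dx; case: (lincomb s0 x) => a b /= ->.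
  by rewrite subrr mul0r /redot /= mulr0 addr0.
Qed.

Let apx_cst c : apx (fun=> c).
Proof.
have [k hk] := e_one.
have E x : D x -> lincomb [:: (c%:C, k)] x = c%:C.
  by move=> Dx; rewrite /lincomb big_seq1 /= hk// mulr1.
apply: (@eq_apx (fun x => complex.Re (lincomb [:: (c%:C, k)] x))).
  by move=> x /E ->.
by apply: apx_lincomb => x /E ->.
Qed.

Let apxD F G : apx F -> apx G -> apx (fun x => F x + G x).
Proof.
move=> [mF [M FM] aF] [mG [N GN] aG]; split.
- exact: measurable_funD.
- exists (M + N) => x Dx; rewrite (le_trans (ler_normD _ _))//.
  by rewrite lerD ?FM ?GN.
- move=> r r0; have r4 : 0 < r / 4 by rewrite divr_gt0.
  have [t ht] := aF _ r4; have [u hu] := aG _ r4; exists (t ++ u).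
  have Lt : L2 mu D (fun x => ((F x)%:C - lincomb t x) * s x).
    have := L2B mD (L2_real_mul mF (ex_intro _ M FM)) (L2_lincomb_mul t).
    by apply: eq_L2 => x _; rewrite mulrBl.
  have Lu : L2 mu D (fun x => ((G x)%:C - lincomb u x) * s x).
    have := L2B mD (L2_real_mul mG (ex_intro _ N GN)) (L2_lincomb_mul u).
    by apply: eq_L2 => x _; rewrite mulrBl.
  rewrite (_ : nsq _ = nsq (fun x => ((F x)%:C - lincomb t x) * s x +
      ((G x)%:C - lincomb u x) * s x)); last first.
    by apply: eq_nsq => x _; rewrite lincomb_cat rmorphD /=; ring.
  by rewrite (le_trans (nsqD_le mD Lt Lu))//; lra.
Qed.

Let apxM F G : apx F -> apx G -> apx (fun x => F x * G x).
Proof.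
move=> [mF [M FM] aF] [mG [N GN] aG]; split.
- exact: measurable_funM.
- exists (M * N) => x Dx; rewrite normrM.
  by apply: ler_pM; rewrite ?normr_ge0 ?FM ?GN.
- move=> r r0.
  have rN : 0 < r / (4 * (N ^+ 2 + 1)).
    by rewrite divr_gt0// mulr_gt0//; have := sqr_ge0 N; lra.
  have [t ht] := aF _ rN; have [K K0 hK] := lincomb_bounded t.
  have rK : 0 < r / (4 * (K + 1)) by rewrite divr_gt0// mulr_gt0//; lra.
  have [u hu] := aG _ rK; have [v hv] := lincomb_mul t u; exists v.
  have Lt : L2 mu D (fun x => ((F x)%:C - lincomb t x) * s x).
    have := L2B mD (L2_real_mul mF (ex_intro _ M FM)) (L2_lincomb_mul t).
    by apply: eq_L2 => x _; rewrite mulrBl.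
  have Lu : L2 mu D (fun x => ((G x)%:C - lincomb u x) * s x).
    have := L2B mD (L2_real_mul mG (ex_intro _ N GN)) (L2_lincomb_mul u).
    by apply: eq_L2 => x _; rewrite mulrBl.
  have N2 x : D x -> redot (G x)%:C (G x)%:C <= N ^+ 2.
    by move=> Dx; rewrite redot_real -real_normK ?num_real// lerXn2r ?nnegrE//
      ?GN// (le_trans _ (GN x Dx)).
  have mGC : cmeasurable D (fun x => (G x)%:C) by exact: cmeasurable_real.
  have K2 x : D x -> redot (lincomb t x) (lincomb t x) <= K by [].
  have L1 := L2M mD mGC N2 Lt.
  have L2' := L2M mD (cmeasurable_lincomb t) K2 Lu.
  rewrite (_ : nsq _ = nsq (fun x =>
      (G x)%:C * (((F x)%:C - lincomb t x) * s x) +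
      lincomb t x * (((G x)%:C - lincomb u x) * s x))); last first.
    by apply: eq_nsq => x Dx; rewrite hv// rmorphM /=; ring.
  rewrite (le_trans (nsqD_le mD L1 L2'))//.
  have h1 := nsqM_le mGC N2 Lt; have h2 := nsqM_le (cmeasurable_lincomb t) K2 Lu.
  have h3 : N ^+ 2 * nsq (fun x => ((F x)%:C - lincomb t x) * s x) <= r / 4.
    apply: (@le_trans _ _ (N ^+ 2 * (r / (4 * (N ^+ 2 + 1))))).
      by rewrite ler_wpM2l ?sqr_ge0.
    rewrite mulrA ler_pdivrMr; last by have := sqr_ge0 N; lra.
    have := sqr_ge0 N; nra.
  have h4 : K * nsq (fun x => ((G x)%:C - lincomb u x) * s x) <= r / 4.
    apply: (@le_trans _ _ (K * (r / (4 * (K + 1))))); first by rewrite ler_wpM2l.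
    by rewrite mulrA ler_pdivrMr; [nra|lra].
  lra.
Qed.

Let apxZ c F : apx F -> apx (fun x => c * F x).
Proof. exact/apxM/apx_cst. Qed.

Let apxX F n : apx F -> apx (fun x => F x ^+ n).
Proof.
move=> aF; elim: n => [|n ih]; first exact: apx_cst.
by under eq_fun do rewrite exprS; exact: apxM.
Qed.

Let apx_lim (F_ : nat -> T -> R) F M : (forall k, apx (F_ k)) ->
  (forall k x, D x -> `|F_ k x| <= M) ->
  (forall x, D x -> F_ ^~ x @ \oo --> F x) -> apx F.
Proof.
move=> aF FM cF.
have mF : measurable_fun D F.
  by apply: (measurable_fun_cvg (h := F_)) => // k; have [] := aF k.
have bF x : D x -> `|F x| <= M.
  move=> Dx; have := cvg_norm (cF x Dx) => cn.
  have := @ler_cvg_to nat \oo _ R (fun k => `|F_ k x|) (fun=> M) `|F x| M.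
  apply; [exact: cn|exact: cvg_cst|].
  by apply: nearW => k; exact: FM.
split => //; first by exists M.
move=> r r0.
have Lk k : L2 mu D (fun x => ((F x)%:C - (F_ k x)%:C) * s x).
  have [mk bk _] := aF k.
  have := L2B mD (L2_real_mul mF (ex_intro _ M bF)) (L2_real_mul mk bk).
  by apply: eq_L2 => x _; rewrite mulrBl.
have key : (fun k => nsq (fun x => ((F x)%:C - (F_ k x)%:C) * s x)) @ \oo --> (0:R).
  pose G k x := (redot (((F x)%:C - (F_ k x)%:C) * s x)
     (((F x)%:C - (F_ k x)%:C) * s x))%:E.
  have GE k x : G k x = (((F x) - (F_ k x)) ^+ 2 * redot (s x) (s x))%:E.
    by rewrite /G redotMM -rmorphB /= redot_real.
  have := @dominated_convergence _ _ _ mu D mD G (cst 0%E)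
    (fun x => ((2 * M) ^+ 2 * redot (s x) (s x))%:E).
  case.
  - move=> k; apply/measurable_EFinP; apply: measurable_redot;
      exact: (L2_cmeasurable (Lk k)).
  - exact: measurable_cst.
  - apply: aeW => x Dx; under eq_fun do rewrite GE.
    apply: cvg_EFin; first exact: nearW.
    rewrite /comp /= -[X in _ --> X](mul0r (redot (s x) (s x))).
    apply: cvgM; last exact: cvg_cst.
    rewrite (_ : 0 = (F x - F x) * (F x - F x)); last by rewrite subrr mulr0.
    under eq_fun do rewrite expr2.
    by apply: cvgM; apply: cvgB; [exact: cvg_cst|exact: cF|exact: cvg_cst|exact: cF].
  - exact/integrable_scale/L2_redot_self.
  - apply: aeW => x k Dx; rewrite GE abse_EFin lee_fin ger0_norm.
      rewrite ler_wpM2r ?redot_ge0// -real_normK ?num_real//.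
      rewrite lerXn2r ?nnegrE//; first by have := le_trans (normr_ge0 _) (bF x Dx); lra.
      by rewrite (le_trans (ler_normB _ _))//; have := bF x Dx; have := FM k x Dx; lra.
    by rewrite mulr_ge0 ?sqr_ge0 ?redot_ge0.
  move=> _ + _; rewrite (_ : (fun k => _) = EFin \o
      (fun k => nsq (fun x => ((F x)%:C - (F_ k x)%:C) * s x))).
    by move=> /fine_cvg.
  apply/funext => k /=; rewrite -L2normsqE//; apply: eq_integral => x _.
  by rewrite subr0 normc_redot ger0_norm ?redot_ge0.
have r4 : 0 < r / 4 by rewrite divr_gt0.
have /cvgrPdist_le/(_ _ r4)[k _ /(_ k (leqnn _))] := key.
rewrite /= sub0r normrN ger0_norm ?nsq_ge0// => hk.
have [mk bk /(_ _ r4)[t ht]] := aF k; exists t.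
have Lt : L2 mu D (fun x => ((F_ k x)%:C - lincomb t x) * s x).
  have := L2B mD (L2_real_mul mk bk) (L2_lincomb_mul t).
  by apply: eq_L2 => x _; rewrite mulrBl.
rewrite (_ : nsq _ = nsq (fun x => ((F x)%:C - (F_ k x)%:C) * s x +
    ((F_ k x)%:C - lincomb t x) * s x)); last first.
  by apply: eq_nsq => x _; rewrite -mulrDl addrA subrK.
by rewrite (le_trans (nsqD_le mD (Lk k) Lt))//; lra.
Qed.

(** The threshold polynomials in (1 - F) / 2 separate F > 0 from F < 0 but not
    from F = 0, so the powers of 1 - F^2 are used first to remove the zeros. *)
Let apx_le_ind (F : T -> R) : apx F -> (forall x, D x -> `|F x| <= 1) ->
  apx (\1_[set x | 0 < F x]).
Proof.
move=> aF F1.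
have aN : apx (fun x => 1 - F x ^+ 2).
  by apply: apxD; [exact: apx_cst|under eq_fun do rewrite -mulN1r;
    apply: apxZ; exact: apxX].
have F2 x : D x -> 0 <= F x ^+ 2 <= 1.
  move=> Dx; rewrite sqr_ge0 -real_normK ?num_real//= exprn_ile1//.
  exact: F1.
have aZ : apx (fun x => (F x == 0)%:R).
  apply: (@apx_lim (fun m x => (1 - F x ^+ 2) ^+ m) _ 1).
  - by move=> m; exact: apxX.
  - move=> m x Dx; have /andP[f0 f1] := F2 x Dx.
    by rewrite ger0_norm ?exprn_ge0// ?exprn_ile1//; lra.
  - move=> x Dx; have /andP[f0 f1] := F2 x Dx.
    have [->|Fx0] := eqVneq (F x) 0.
      rewrite expr0n /= subr0; under eq_fun do rewrite expr1n; exact: cvg_cst.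
    apply: cvg_expr0; have : F x ^+ 2 != 0 by rewrite sqrf_eq0.
    move=> h; have : 0 < F x ^+ 2 by rewrite lt_def h f0.
    by move=> h'; apply/andP; split; lra.
pose X x := 2^-1 * (1 - F x).
have aX : apx X.
  apply: apxZ; apply: apxD; first exact: apx_cst.
  by under eq_fun do rewrite -mulN1r; exact: apxZ.
have X01 x : D x -> 0 <= X x <= 1.
  by move=> Dx; have := F1 x Dx; rewrite ler_norml /X => /andP[? ?];
    apply/andP; split; lra.
apply: (@apx_lim (fun m x => (1 - X x ^+ m) ^+ (2 ^ m) * (1 - (F x == 0)%:R)) _ 1).
- move=> m; apply: apxM.
    apply: apxX; apply: apxD; first exact: apx_cst.
    by under eq_fun do rewrite -mulN1r; apply: apxZ; exact: apxX.
  apply: apxD; first exact: apx_cst.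
  by under eq_fun do rewrite -mulN1r; exact: apxZ.
- move=> m x Dx; have /andP[x0 x1] := X01 x Dx.
  have : 0 <= X x ^+ m <= 1 by rewrite exprn_ge0//= exprn_ile1.
  move=> /andP[y0 y1]; rewrite normrM -[leRHS]mulr1; apply: ler_pM => //.
    by rewrite ger0_norm ?exprn_ge0// ?exprn_ile1//; lra.
  by case: eqP => _ /=; rewrite ?subrr ?subr0 ?normr0 ?normr1.
- move=> x Dx; have /andP[x0 x1] := X01 x Dx.
  have [F0|F0|F0] := ltrgt0P (F x).
  + rewrite indicE mem_set//= subr0.
    under eq_fun do rewrite mulr1; apply: cvg_threshold_lt => //.
    rewrite /X; lra.
  + rewrite indicE memNset/= ?subr0; last by rewrite lt_gtF.
    under eq_fun do rewrite mulr1; apply: cvg_threshold_gt => //.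
    rewrite /X; lra.
  + rewrite indicE memNset/=; last by rewrite F0 ltxx.
    under eq_fun do rewrite subrr mulr0.
    exact: cvg_cst.
Qed.

Let apx_level F c : apx F -> apx (\1_[set x | c < F x]).
Proof.
move=> aF; have [_ [M FM] _] := aF.
pose K := `|M| + `|c| + 1.
have K0 : 0 < K by rewrite /K ltr_wpDl// addr_ge0.
have aG : apx (fun x => K^-1 * (F x + - c)).
  by apply: apxZ; apply: apxD => //; exact: apx_cst.
apply: (@eq_apx (\1_[set x | 0 < K^-1 * (F x + - c)])).
  move=> x _; rewrite !indicE; congr (_%:R); congr nat_of_bool.
  by apply/idP/idP; rewrite !inE /=; rewrite pmulr_rgt0 ?invr_gt0// subr_gt0.
apply: apx_le_ind => // x Dx; rewrite normrM gtr0_norm ?invr_gt0//.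
rewrite ler_pdivrMl// mulr1 (le_trans (ler_normB _ _))// /K.
have := FM x Dx; have := ler_norm M; lra.
Qed.

Let apx_sets : sigma_algebra D [set E | apx (\1_E)].
Proof.
split => /=.
- by apply: eq_apx (apx_cst 0) => x _; rewrite indic0.
- move=> E aE; apply: (@eq_apx (fun x => 1 + (-1) * \1_E x)).
    move=> x Dx; rewrite !indicE; case: (boolP (x \in E)) => xE.
      rewrite memNset ?mulr1 ?subrr//= => -[_]; apply; exact: set_mem.
    rewrite mem_set ?mulr0 ?addr0//=; split => //.
    by move=> Ex; move: xE; rewrite mem_set.
  by apply: apxD; [exact: apx_cst|exact: apxZ].
- move=> E aE.
  have aU n : apx (\1_(\big[setU/set0]_(k < n) E k)).
    elim: n => [|n ih].
      by rewrite big_ord0; apply: eq_apx (apx_cst 0) => x _; rewrite indic0.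
    rewrite big_ord_recr /=; set A := \big[_/_]_(_ < _) _ in ih *.
    apply: (@eq_apx (fun x => 1 + (-1) * ((1 + (-1) * \1_A x) *
        (1 + (-1) * \1_(E n) x)))).
      move=> x _; rewrite !indicE in_setU.
      by case: (x \in A); case: (x \in E n) => /=; lra.
    apply: apxD; first exact: apx_cst.
    by apply: apxZ; apply: apxM; (apply: apxD; [exact: apx_cst|exact: apxZ]).
  apply: (@apx_lim (fun n => \1_(\big[setU/set0]_(k < n) E k)) _ 1 aU).
    move=> k x _; rewrite indicE.
    by case: (_ \in _); rewrite ?normr1 ?normr0.
  move=> x Dx; have [[n _ Enx]|nE] := pselect ((\bigcup_k E k) x).
    rewrite indicE mem_set; last by exists n.
    apply: cvg_near_cst; exists n.+1 => // m /= nm.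
    rewrite indicE mem_set// -bigcup_mkord.
    by exists n.
  rewrite indicE memNset//; apply: cvg_near_cst; apply: nearW => m.
  rewrite indicE memNset// => Um; apply: nE.
  by move: Um; rewrite -bigcup_mkord => -[k _ Ekx]; exists k.
Qed.

(** The functions approximable in L^2(|s|^2 dmu) by trigonometric sums form
    an algebra closed under bounded pointwise limits, so the sets whose
    indicator is approximable form a sigma-algebra; it contains the level sets
    of the characters because of the threshold polynomials. *)
Lemma lincomb_dense (E : set T) : measurable E -> forall r : R, 0 < r ->
  exists t, nsq (fun x => ((\1_E x)%:C - lincomb t x) * s x) <= r.
Proof.
move=> mE.
have half i (c c' : R[i]) : exists t, forall x, D x ->
    lincomb t x = c * e i x + c' * (e i x)^*.
  have [k hk] := e_conj i; exists [:: (c, i); (c', k)] => x Dx.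
  by rewrite /lincomb !big_cons big_nil /= hk// addr0.
have real_part i : exists t, forall x, D x ->
    lincomb t x = (complex.Re (e i x))%:C.
  have [t ht] := half i (2^-1)%:C (2^-1)%:C; exists t => x /ht ->.
  rewrite conjCE; case: (e i x) => a b; apply/eqP; rewrite eq_complex /=.
  by apply/andP; split; apply/eqP; field.
have imag_part i : exists t, forall x, D x ->
    lincomb t x = (complex.Im (e i x))%:C.
  have [t ht] := half i (0 +i* (- 2^-1)) (0 +i* 2^-1); exists t => x /ht ->.
  rewrite conjCE; case: (e i x) => a b; apply/eqP; rewrite eq_complex /=.
  by apply/andP; split; apply/eqP; field.
have [mF bF aF] : apx (\1_(D `&` E)).
  apply: (e_generate apx_sets) => //.
  - move=> i c /=; have [t ht] := real_part i.
    apply: (@eq_apx (\1_[set x | c < complex.Re (lincomb t x)])).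
      move=> x Dx; rewrite !indicE; congr (_%:R); congr nat_of_bool.
      apply/idP/idP; rewrite !inE /= ht//=; last by case.
    by apply: apx_level; apply: apx_lincomb => x Dx; rewrite ht.
  - move=> i c /=; have [t ht] := imag_part i.
    apply: (@eq_apx (\1_[set x | c < complex.Re (lincomb t x)])).
      move=> x Dx; rewrite !indicE; congr (_%:R); congr nat_of_bool.
      apply/idP/idP; rewrite !inE /= ht//=; last by case.
    by apply: apx_level; apply: apx_lincomb => x Dx; rewrite ht.
move=> r /aF[t ht]; exists t; apply: le_trans ht.
rewrite le_eqVlt; apply/orP; left; apply/eqP; apply: eq_nsq => x Dx.
by rewrite !indicE in_setI (mem_set Dx).
Qed.

End density.

Section parseval.
Hypothesis muD : (mu D < +oo)%E.
Hypothesis e_orthonormal : forall i j, L2inner mu D (e i) (e j) = (i == j)%:R.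

Lemma L2_bounded (f : T -> R[i]) (M : R) : cmeasurable D f ->
  (forall x, D x -> redot (f x) (f x) <= M) -> L2 mu D f.
Proof.
move=> mf fM; apply: (@L2_dominated _ _ _ _ _ mD _ (fun=> M)) => //.
apply/integrableP; split; first exact: measurable_cst.
rewrite (eq_integral (cst `|M|%:E))// integral_cst//.
by rewrite lte_mul_pinfty// lee_fin.
Qed.

Lemma L2_character i : L2 mu D (e i).
Proof. by apply: (@L2_bounded _ 1) => // x _; rewrite e_unit. Qed.

Lemma L2_lincomb_character s : L2 mu D (lincomb s).
Proof.
have [M _ hM] := lincomb_bounded s.
by apply: (@L2_bounded _ M) => //; exact: cmeasurable_lincomb.
Qed.

Lemma L2inner_lincomb s f : L2 mu D f ->
  L2inner mu D (lincomb s) f = \sum_(p <- s) p.1 * L2inner mu D (e p.2) f.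
Proof.
move=> Lf; rewrite L2inner_suml//; last by move=> p; exact/L2Z/L2_character.
by apply: eq_bigr => p _; rewrite L2innerZl//; exact: L2_character.
Qed.

(** By density u is orthogonal to every multiple of an indicator, so its real and
    imaginary parts have zero integral over every measurable set. *)
Lemma orthogonal_to_characters u : L2 mu D u ->
  (forall i, L2inner mu D u (e i) = 0) -> nsq u = 0.
Proof.
move=> Lu ue.
have ut s (c : R[i]) : rinner u (fun x => c * lincomb s x) = 0.
  have Lt := L2Z mD c (L2_lincomb_character s).
  have : L2inner mu D (fun x => c * lincomb s x) u = 0.
    rewrite L2innerZl//; last exact: L2_lincomb_character.
    rewrite L2inner_lincomb// big1 ?mulr0// => p _.
    by rewrite L2inner_conj// ?ue ?conjC0 ?mulr0//; exact: L2_character.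
  by rewrite L2innerE => /(congr1 (@complex.Re R)) /=; rewrite rinnerC.
have uE E (c : R[i]) : measurable E -> rinner u (fun x => c * (\1_E x)%:C) = 0.
  move=> mE.
  have L1 : L2 mu D (fun=> 1).
    by apply: (@L2_bounded _ 1); [exact: cmeasurable_cst|move=> x _;
      rewrite /redot /= mulr1 mulr0 addr0].
  have LE : L2 mu D (fun x => (\1_E x)%:C).
    apply: (@L2_bounded _ 1).
      by apply: cmeasurable_real; exact: measurable_indic.
    move=> x _; rewrite /redot /= mulr0 addr0 indicE.
    by case: (_ \in _); rewrite ?mulr1 ?mulr0.
  apply/eqP; rewrite -normr_eq0 eq_le normr_ge0 andbT.
  apply/ler_addgt0Pr => r r0; rewrite add0r.
  pose K := nsq u * redot c c + 1.
  have K0 : 0 < K.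
    by rewrite /K ltr_wpDl// mulr_ge0 ?nsq_ge0 ?redot_ge0.
  have [|t ht] := lincomb_dense L1 mE (r := r ^+ 2 / K).
    by rewrite divr_gt0// exprn_gt0.
  have Lt := L2_lincomb_character t.
  have ht' : nsq (fun x => (\1_E x)%:C - lincomb t x) <= r ^+ 2 / K.
    apply: le_trans ht; rewrite le_eqVlt; apply/orP; left; apply/eqP.
    by apply: eq_nsq => x _; rewrite mulr1.
  have Ld := L2B mD LE Lt.
  rewrite (_ : rinner _ _ = rinner u (fun x => c * ((\1_E x)%:C - lincomb t x))).
    have := rinner_CS mD Lu (L2Z mD c Ld); rewrite nsqZ// => h.
    rewrite -(@ler_pXn2r _ 2)// ?nnegrE ?(ltW r0)// real_normK ?num_real//.
    apply: (le_trans h); rewrite mulrA.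
    apply: (@le_trans _ _ (K * (r ^+ 2 / K))); last by rewrite mulrC divfK ?gt_eqF.
    by apply: ler_pM => //; rewrite ?mulr_ge0 ?nsq_ge0 ?redot_ge0// /K; lra.
  rewrite [in RHS](_ : (fun x => c * _) =
      (fun x => c * (\1_E x)%:C + - (c * lincomb t x))); last first.
    by apply/funext => x; rewrite mulrBr.
  rewrite rinnerDr//; last 2 first.
  - exact: L2Z.
  - exact/L2N/L2Z.
  by rewrite rinnerNr ?ut ?oppr0 ?addr0//; exact: L2Z.
have [mr mi] := L2_cmeasurable Lu.
have iu (F : R[i] -> R) (c : R[i]) : (forall z, F z = redot z c) ->
    mu.-integrable D (EFin \o (F \o u)) /\
    ae_eq mu D (EFin \o (F \o u)) (cst 0%E).
  move=> Fc.
  have Lc : L2 mu D (fun=> c).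
    by apply: (@L2_bounded _ (redot c c)) => //; exact: cmeasurable_cst.
  have iF : mu.-integrable D (EFin \o (F \o u)).
    have := L2_redot mD Lu Lc; apply: eq_integrable => // x _ /=.
    by rewrite Fc.
  split => //; apply: integral_ae_eq => //.
  move=> E ED mE; rewrite integral_cst// mul0e.
  have iE := integrableS mD mE ED iF.
  rewrite -(fineK (integrable_fin_num mE iE)).
  rewrite -/(Rintegral mu E (F \o u)) -[RHS]/(0%:E) -(uE E c mE); congr (_%:E).
  have -> : E = D `&` E by rewrite setIidr.
  rewrite Rintegral_mkcondr; apply: eq_Rintegral => x xD.
  rewrite patchE Fc indicE setIidr//.
  case: ifPn => _ /=; first by rewrite rmorph1 mulr1.
  by rewrite rmorph0 mulr0 /redot /= !mulr0 addr0.
have ReE (z : R[i]) : complex.Re z = redot z 1.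
  by rewrite /redot /= mulr1 mulr0 addr0.
have ImE (z : R[i]) : complex.Im z = redot z 'i.
  by rewrite /redot /= mulr1 mulr0 add0r.
have [_ aer] := iu (@complex.Re R) 1 ReE.
have [_ aei] := iu (@complex.Im R) 'i ImE.
rewrite nsqE /Rintegral (ae_eq_integral (cst 0%E))//.
- by rewrite integral0.
- exact/measurable_EFinP/measurable_redot.
- move: aer aei; apply: filterS2 => x /= hr hi Dx.
  by rewrite /redot (EFin_inj (hr Dx)) (EFin_inj (hi Dx)) mulr0 addr0.
Qed.

(** Parseval's identity.  The orthogonal series with the Fourier coefficients
    of g converges by completeness; its difference with g is orthogonal to all
    characters. *)
Lemma parseval g : L2 mu D g ->
  \esum_(i in [set: I]) ((Normc.normc (L2inner mu D g (e i))) ^+ 2)%:E =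
  (nsq g)%:E.
Proof.
move=> Lg; pose c i := L2inner mu D g (e i).
pose z i x := c i * e i x.
have Lz i : L2 mu D (z i) by exact/L2Z/L2_character.
have nz i : nsq (z i) = Normc.normc (c i) ^+ 2.
  rewrite nsqZ//; last exact: L2_character.
  have : nsq (e i) = 1.
    have := L2inner_self (L2_character i); rewrite e_orthonormal eqxx.
    by move=> /(congr1 (@complex.Re R)) /= <-.
  by move=> ->; rewrite mulr1 normc_redot.
have oz i j : i != j -> rinner (z i) (z j) = 0.
  move=> ij; have Le k := L2_character k.
  have : L2inner mu D (z i) (z j) = 0.
    rewrite L2innerZl// L2inner_conj// L2innerZl// e_orthonormal.
    by rewrite eq_sym (negbTE ij) mulr0 conjC0 mulr0.
  by rewrite L2innerE => /(congr1 (@complex.Re R)).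
have gz i : rinner g (z i) = Normc.normc (c i) ^+ 2.
  have Le := L2_character i.
  have -> : rinner g (z i) = complex.Re (L2inner mu D g (z i)).
    by rewrite L2innerE.
  rewrite (L2inner_conj mD (Lz i) Lg) L2innerZl// (L2inner_conj mD Lg Le).
  rewrite -/(c i) normc_redot !conjCE.
  by case: (c i) => p q; rewrite /redot /=; ring.
have bessel (J : {fset I}) : \sum_(i <- J) Normc.normc (c i) ^+ 2 <= nsq g.
  have LS : L2 mu D (fun x => \sum_(i <- J) z i x) by exact: L2_sum.
  have := nsq_ge0 mu D (fun x => g x - \sum_(i <- J) z i x).
  rewrite nsqB// nsq_orthogonal_sum//.
  under eq_bigr do rewrite nz.
  suff -> : rinner g (fun x => \sum_(i <- J) z i x) =
    \sum_(i <- J) Normc.normc (c i) ^+ 2 by lra.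
  elim: (J : seq I) {LS} => [|i s ih].
    rewrite big_nil /rinner /Rintegral integral0_eq// => x _.
    by rewrite big_nil /redot /= !mulr0 addr0.
  have LS : L2 mu D (fun x => \sum_(i <- s) z i x) by exact: L2_sum.
  rewrite big_cons -ih -gz -rinnerDr//.
  by apply: eq_rinner => // x _; rewrite big_cons.
have fin : (\esum_(i in [set: I]) (nsq (z i))%:E < +oo)%E.
  apply: (@le_lt_trans _ _ (nsq g)%:E); last exact: ltry.
  apply: esum_le_fset => J; rewrite sumEFin lee_fin.
  by under eq_bigr do rewrite nz.
have [h [Lh sh]] := L2sum_orthogonal_exists mD Lz oz fin.
have Ec : (fun i => ((Normc.normc (L2inner mu D g (e i))) ^+ 2)%:E) =
  (fun i => (nsq (z i))%:E) by apply/funext => i; rewrite nz.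
rewrite Ec (L2sum_orthogonal_nsq mD Lz oz Lh sh); congr (_%:E).
have Lu := L2B mD Lg Lh.
have u0 : nsq (fun x => g x - h x) = 0.
  apply: orthogonal_to_characters => // j.
  have Le := L2_character j.
  rewrite L2innerBl//; apply/eqP; rewrite subr_eq0 -/(c j); apply/eqP.
  apply/eqP; rewrite -subr_eq0; apply/eqP/Normc.eq0_normc/eqP.
  rewrite -sqrf_eq0 eq_le sqr_ge0 andbT; apply/ler_addgt0Pr => r r0.
  have [J0 hJ0] := L2sum_inner mD Lz Lh Le sh r0.
  rewrite add0r; apply: le_trans (hJ0 (J0 `|` [fset j])%fset (fsubsetUl _ _)).
  rewrite (big_fsetD1 j)/=; last by rewrite inE inE eqxx orbT.
  rewrite big_seq big1 => [|i]; last first.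
    rewrite !inE => /andP[ij _].
    by rewrite L2innerZl ?e_orthonormal ?(negbTE ij) ?mulr0//; exact: L2_character.
  by rewrite addr0 L2innerZl// e_orthonormal eqxx mulr1.
have := nrmB_dist mD Lg Lh; rewrite /nrm u0 sqrtr0 normr_le0 subr_eq0 => /eqP.
by move=> /(congr1 (fun r => r ^+ 2)); rewrite !sqr_sqrtr ?nsq_ge0// => ->.
Qed.

End parseval.
End characters.

(** * Countable sums, vectors and exponentials *)

Section countable_sums.
Context {R : realType} {I : countType}.
Local Open Scope ereal_scope.

(** Enumerating I turns an unordered sum into a series, to which monotone
    convergence applies. *)
Lemma esum_nneseries (a : I -> \bar R) : (forall i, 0 <= a i) ->
  \esum_(i in [set: I]) a i = \sum_(n <oo) oapp a 0 (pickle_inv n).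
Proof.
move=> a0; have b0 n : 0 <= oapp a 0 (pickle_inv n) by case: (pickle_inv n) => /=.
rewrite nneseries_esumT//.
rewrite [LHS](_ : _ = \esum_(n in range (@choice.pickle I)) oapp a 0 (pickle_inv n)); last first.
  rewrite (reindex_esum [set: I] _ choice.pickle).
    by apply: eq_esum => i _; rewrite pickleK_inv.
  by split.
rewrite [RHS](_ : _ = \esum_(n in setT) (if n \in range (@choice.pickle I)
    then oapp a 0 (pickle_inv n) else 0)).
  by rewrite -esum_mkcond.
apply: eq_esum => n _; case: ifPn => // nI.
case E : (pickle_inv n) => [i|//] /=.
have := @pickle_invK I n; rewrite E /= => in_.
by move: nI; rewrite mem_set//; exists i.
Qed.

Lemma esum_single (a : I -> \bar R) i : (forall j, 0 <= a j) ->
  (forall j, j <> i -> a j = 0) -> \esum_(j in [set: I]) a j = a i.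
Proof.
move=> a0 ai.
rewrite -(esum_set1 (a0 i)) [RHS]esum_mkcond.
apply: eq_esum => j _; case: ifPn => // ji; rewrite ai// => jE.
by move: ji; rewrite jE mem_set.
Qed.

Context d (T : measurableType d) (mu : {measure set T -> \bar R}).

Lemma integral_esum (D : set T) (f : I -> T -> \bar R) : measurable D ->
  (forall i, measurable_fun D (f i)) -> (forall i x, 0 <= f i x) ->
  \int[mu]_(x in D) (\esum_(i in [set: I]) f i x) =
  \esum_(i in [set: I]) \int[mu]_(x in D) f i x.
Proof.
move=> mD mf f0; rewrite esum_nneseries; last by move=> i; exact: integral_ge0.
under eq_integral do rewrite esum_nneseries//.
rewrite integral_nneseries//.
- apply: eq_eseriesr => n _.
  by case: (pickle_inv n) => [i|] //=; rewrite integral0.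
- by move=> n; case: (pickle_inv n) => [i|] /=.
- by move=> n x _; case: (pickle_inv n) => [i|] /=.
Qed.

Lemma integral_partition (F : I -> set T) (f : T -> \bar R) :
  (forall i, measurable (F i)) -> (forall x, exists i, F i x) ->
  (forall i j x, F i x -> F j x -> i = j) ->
  measurable_fun setT f -> (forall x, 0 <= f x) ->
  \int[mu]_x f x = \esum_(i in [set: I]) \int[mu]_(x in F i) f x.
Proof.
move=> mF covF disF mf f0.
under [RHS]eq_esum do rewrite integral_mkcond.
rewrite -integral_esum//; last 2 first.
- by move=> i; apply/(measurable_restrictT _ (mF i)); exact: measurable_funTS.
- by move=> i x; rewrite patchE; case: ifPn.
apply: eq_integral => x _; have [i Fix] := covF x.
rewrite (@esum_single _ i) ?patchE ?mem_set//.
  by move=> j; rewrite patchE; case: ifPn.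
by move=> j ji; rewrite patchE memNset// => Fjx; apply: ji; exact: disF Fix.
Qed.

End countable_sums.

Section euclidean_maps.
Context {R : realType}.

Lemma measurable_RnP d (T : measurableType d) n (f : T -> Rn R n) :
  (forall i, measurable_fun setT (fun x => tnth (f x) i : R)) ->
  measurable_fun setT f.
Proof. by move=> mf; apply/measurable_fun_tnthP => i; exact: mf. Qed.

Lemma measurable_coord d (T : measurableType d) n (f : T -> Rn R n) i :
  measurable_fun setT f -> measurable_fun setT (fun x => tnth (f x) i : R).
Proof. by move=> mf; exact: (measurableT_comp (measurable_tnth i) mf). Qed.

Lemma measurable_addRn d (T : measurableType d) n (f g : T -> Rn R n) :
  measurable_fun setT f -> measurable_fun setT g ->
  measurable_fun setT (fun x => addRn (f x) (g x)).
Proof.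
move=> mf mg; apply: measurable_RnP => i.
under eq_fun do rewrite tnth_mktuple.
by apply: measurable_funD; exact: measurable_coord.
Qed.

Lemma measurable_subRn d (T : measurableType d) n (f g : T -> Rn R n) :
  measurable_fun setT f -> measurable_fun setT g ->
  measurable_fun setT (fun x => subRn (f x) (g x)).
Proof.
move=> mf mg; apply: measurable_RnP => i.
under eq_fun do rewrite tnth_mktuple.
by apply: measurable_funB; exact: measurable_coord.
Qed.

Lemma measurable_dotRn d (T : measurableType d) n (f g : T -> Rn R n) :
  measurable_fun setT f -> measurable_fun setT g ->
  measurable_fun setT (fun x => dotRn (f x) (g x)).
Proof.
move=> mf mg; apply: measurable_sum => i.
by apply: measurable_funM; exact: measurable_coord.
Qed.

Lemma cmeasurable_cexpi d (T : measurableType d) (D : set T) (f : T -> R) :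
  measurable_fun D f -> cmeasurable D (fun x => cexpi (f x)).
Proof.
move=> mf; split => /=.
  by apply: (measurableT_comp _ mf); apply: continuous_measurable_fun;
    exact: continuous_cos.
by apply: (measurableT_comp _ mf); apply: continuous_measurable_fun;
  exact: continuous_sin.
Qed.

Lemma cmeasurable_comp d1 d2 (T1 : measurableType d1) (T2 : measurableType d2)
    (f : T2 -> R[i]) (g : T1 -> T2) : cmeasurable setT f ->
  measurable_fun setT g -> cmeasurable setT (fun x => f (g x)).
Proof. by move=> [f1 f2] mg; split; [exact: measurableT_comp f1 mg|exact: measurableT_comp f2 mg]. Qed.

Lemma redot_cexpi (t : R) : redot (cexpi t) (cexpi t) = 1.
Proof. by rewrite /redot /= -!expr2 cos2Dsin2. Qed.

Lemma cexpi0 : cexpi (0 : R) = 1.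
Proof. by rewrite /cexpi cos0 sin0. Qed.

Lemma cexpiD (s t : R) : cexpi (s + t) = cexpi s * cexpi t.
Proof.
by apply/eqP; rewrite eq_complex /= cosD sinD; apply/andP; split; apply/eqP; ring.
Qed.

Lemma cexpiN (t : R) : cexpi (- t) = (cexpi t)^*.
Proof. by rewrite conjCE /= /cexpi cosN sinN. Qed.

Lemma cexpi_int (k : int) : cexpi (2 * pi * k%:~R : R) = 1.
Proof.
have nat_case (m : nat) : cexpi (2 * pi * m%:R : R) = 1.
  elim: m => [|m ih]; first by rewrite mulr0 cexpi0.
  rewrite -(natr1 m) mulrDr mulr1 cexpiD ih mul1r /cexpi.
  by rewrite mulr_natl cos2pi sin2pi.
case: k => m; first exact: nat_case.
rewrite NegzE mulrNz mulrN cexpiN nat_case.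
by rewrite conjCE /= oppr0.
Qed.

Variable n : nat.
Implicit Types (x y z a : Rn R n) (k l m : Zn n).

Lemma tnth_addRn x y i : tnth (addRn x y) i = tnth x i + tnth y i :> R.
Proof. by rewrite tnth_mktuple. Qed.

Lemma tnth_subRn x y i : tnth (subRn x y) i = tnth x i - tnth y i :> R.
Proof. by rewrite tnth_mktuple. Qed.

Lemma tnth_ZnR k i : tnth (ZnR R k) i = (tnth k i)%:~R :> R.
Proof. by rewrite tnth_mktuple. Qed.

Lemma eq_Rn x y : (forall i, tnth x i = tnth y i :> R) -> x = y.
Proof. by move=> h; apply: eq_from_tnth. Qed.

Lemma addRnA x y z : addRn x (addRn y z) = addRn (addRn x y) z.
Proof. by apply: eq_Rn => i; rewrite !tnth_addRn addrA. Qed.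

Lemma addRnK a x : subRn (addRn a x) a = x.
Proof. by apply: eq_Rn => i; rewrite tnth_subRn tnth_addRn addrC addKr. Qed.

Lemma dotRnC x y : dotRn x y = dotRn y x.
Proof. by apply: eq_bigr => i _; rewrite mulrC. Qed.

Lemma dotRnDl x y z : dotRn (addRn x y) z = dotRn x z + dotRn y z.
Proof.
by rewrite -big_split; apply: eq_bigr => i _; rewrite tnth_addRn mulrDl.
Qed.

Lemma dotRnBl x y z : dotRn (subRn x y) z = dotRn x z - dotRn y z.
Proof.
by rewrite -sumrB; apply: eq_bigr => i _; rewrite tnth_subRn mulrBl.
Qed.

Lemma dotRnDr x y z : dotRn x (addRn y z) = dotRn x y + dotRn x z.
Proof. by rewrite dotRnC dotRnDl !(dotRnC x). Qed.

Lemma dotRnBr x y z : dotRn x (subRn y z) = dotRn x y - dotRn x z.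
Proof. by rewrite dotRnC dotRnBl !(dotRnC x). Qed.

Definition addZn k l : Zn n := [tuple tnth k i + tnth l i | i < n].
Definition oppZn k : Zn n := [tuple - tnth k i | i < n].
Definition zeroZn : Zn n := [tuple 0 | i < n].

Lemma ZnR_add k l : ZnR R (addZn k l) = addRn (ZnR R k) (ZnR R l).
Proof.
by apply: eq_Rn => i; rewrite tnth_addRn !tnth_ZnR tnth_mktuple intrD.
Qed.

Lemma dotZnN k x : dotRn (ZnR R (oppZn k)) x = - dotRn (ZnR R k) x.
Proof.
rewrite /dotRn -sumrN; apply: eq_bigr => i _.
by rewrite !tnth_ZnR tnth_mktuple mulrNz mulNr.
Qed.

Lemma dotZn0 x : dotRn (ZnR R zeroZn) x = 0.
Proof. by rewrite /dotRn big1// => i _; rewrite tnth_ZnR tnth_mktuple mul0r. Qed.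

Lemma dotZn_int k l : exists m : int, dotRn (ZnR R k) (ZnR R l) = m%:~R.
Proof.
exists (\sum_(i < n) tnth k i * tnth l i).
by rewrite rmorph_sum; apply: eq_bigr => i _; rewrite !tnth_ZnR -intrM.
Qed.

(** The character of the torus with frequency k. *)
Definition echar k x : R[i] := cexpi (2 * pi * dotRn (ZnR R k) x).

Lemma echar_add k l x : echar (addZn k l) x = echar k x * echar l x.
Proof. by rewrite /echar ZnR_add dotRnDl mulrDr cexpiD. Qed.

Lemma echar_opp k x : echar (oppZn k) x = (echar k x)^*.
Proof. by rewrite /echar dotZnN mulrN cexpiN. Qed.

Lemma echar0 x : echar zeroZn x = 1.
Proof. by rewrite /echar dotZn0 mulr0 cexpi0. Qed.

Lemma echar_period k m x : echar k (addRn (ZnR R m) x) = echar k x.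
Proof.
rewrite /echar dotRnDr mulrDr cexpiD; have [j ->] := dotZn_int k m.
by rewrite cexpi_int mul1r.
Qed.

Lemma redot_echar k x : redot (echar k x) (echar k x) = 1.
Proof. exact: redot_cexpi. Qed.

Lemma cmeasurable_echar k : cmeasurable setT (echar k).
Proof.
by apply: cmeasurable_cexpi; apply: measurable_funM => //; exact: measurable_dotRn.
Qed.

End euclidean_maps.

(** * Translation invariance and the tiling of R^n by unit cubes *)

Section lebesgue_translation.
Context {R : realType}.
Local Notation leb := (@lebesgue_measure R).

Lemma lebesgue_translation (a : R) (A : set (measurableTypeR R)) :
  measurable A -> leb [set x | A (a + x)] = leb A.
Proof.
move=> mA.
have mf : measurable_fun setT (fun x : measurableTypeR R => a + x : measurableTypeR R).
  by apply: measurable_funD => //; exact: measurable_cst.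
have := @lebesgue_measure_unique R
  (measure_function_pushforward__canonical__measure_function_Measure
     lebesgue_measure mf).
move=> /(_ _ A mA) -> // X [[u v]] _ <- /=.
rewrite /pushforward (_ : _ @^-1` _ = `]u - a, v - a]%classic); last first.
  by apply/seteqP; split => x /=; rewrite !in_itv /= => /andP[? ?];
    apply/andP; split; lra.
rewrite !lebesgue_measure_itv /= !lte_fin ltrD2r.
by case: ifP => // _; rewrite -!EFinD; congr (_%:E); ring.
Qed.

Lemma integral_lebesgue_translation (a : R) (f : R -> \bar R) :
  measurable_fun setT f -> (forall x, 0 <= f x)%E ->
  (\int[leb]_x f (a + x)%R = \int[leb]_x f x)%E.
Proof.
move=> mf f0.
have mg : measurable_fun setT (fun x : measurableTypeR R => a + x : measurableTypeR R).
  by apply: measurable_funD => //; exact: measurable_cst.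
have := @ge0_integral_pushforward _ _ _ _ R _ mg leb setT f measurableT mf
  (fun x _ => f0 x).
rewrite preimage_setT => <-.
apply: (@eq_measure_integral _ _ _ _ leb
  (measure_function_pushforward__canonical__measure_function_Measure leb mg)) =>
  A mA _.
exact: lebesgue_translation.
Qed.

Lemma integral_consRn n (f : Rn R n.+1 -> \bar R) :
  measurable_fun setT f -> (forall x, 0 <= f x)%E ->
  (\int[lebesgue_Rn]_x f x =
   \int[leb]_t \int[lebesgue_Rn]_x f (consRn (t, x)))%E.
Proof.
move=> mf f0.
have := @ge0_integral_pushforward _ _ _ _ R _ (@measurable_consRn R n)
  [the {measure set _ -> \bar R} of (leb \x (@lebesgue_Rn R n))%E]
  setT f measurableT mf (fun x _ => f0 x).
rewrite preimage_setT => ->.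
rewrite (@fubini_tonelli1 _ _ _ _ R leb (@lebesgue_Rn R n))//.
  by apply: measurableT_comp => //; exact: measurable_consRn.
by move=> x; exact: f0.
Qed.

Lemma addRn_cons n (a t : R) (b x : Rn R n) :
  addRn (consRn (a, b)) (consRn (t, x)) = consRn (a + t, addRn b x).
Proof.
apply: eq_Rn => i; rewrite tnth_addRn.
by case: (unliftP ord0 i) => [j|] ->; rewrite ?tnthS ?tnth_addRn.
Qed.

(** One coordinate at a time, by Tonelli. *)
Lemma integral_translation n (a : Rn R n) (f : Rn R n -> \bar R) :
  measurable_fun setT f -> (forall x, 0 <= f x)%E ->
  (\int[lebesgue_Rn]_x f (addRn a x) = \int[lebesgue_Rn]_x f x)%E.
Proof.
elim: n a f => [|n ih] a f mf f0.
  by apply: eq_integral => x _; rewrite (tuple0 x) (tuple0 (addRn _ _)).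
rewrite !integral_consRn//; last first.
  by apply: (measurableT_comp mf); exact: measurable_addRn.
have -> : a = consRn (thead a, [tuple of behead a]).
  by rewrite {1}(tuple_eta a); apply/val_inj.
under eq_integral => t _.
  under eq_integral do rewrite addRn_cons.
  rewrite (ih _ (fun x => f (consRn (thead a + t, x))))//; last first.
    apply: (measurableT_comp mf).
    exact: (measurableT_comp (@measurable_consRn R n) (measurable_pair1 _)).
  over.
apply: (@integral_lebesgue_translation (thead a)
  (fun t => \int[lebesgue_Rn]_x f (consRn (t, x)))%E).
- apply: (@measurable_fun_fubini_tonelli_F _ _ _ _ R (@lebesgue_Rn R n)
    (fun p => f (consRn p))) => //.
  by apply: (measurableT_comp mf); exact: measurable_consRn.
- by move=> t; exact: integral_ge0.
Qed.

Lemma Rintegral_translation n (a : Rn R n) (f : Rn R n -> R) :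
  measurable_fun setT f ->
  \int[lebesgue_Rn]_x f (addRn a x) = \int[lebesgue_Rn]_x f x.
Proof.
move=> mf; rewrite /Rintegral; congr fine.
rewrite integralE [RHS]integralE; congr (_ - _)%E.
  rewrite -(@integral_translation n a ((EFin \o f)^\+)%E)//.
    by apply: eq_integral => x _; rewrite !funeposE.
  by apply: measurable_funepos; exact/measurable_EFinP.
rewrite -(@integral_translation n a ((EFin \o f)^\-)%E)//.
  by apply: eq_integral => x _; rewrite !funenegE.
by apply: measurable_funeneg; exact/measurable_EFinP.
Qed.

Lemma cintegral_translation n (a : Rn R n) (f : Rn R n -> R[i]) :
  cmeasurable setT f ->
  cintegral lebesgue_Rn setT (fun x => f (addRn a x)) =
  cintegral lebesgue_Rn setT f.
Proof.
move=> [f1 f2]; rewrite /cintegral.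
by rewrite (Rintegral_translation a f1) (Rintegral_translation a f2).
Qed.

End lebesgue_translation.

Section torus_tiling.
Context {R : realType} {n : nat}.
Local Notation torus := (@torus R n).

Lemma measurable_torus : measurable torus.
Proof.
rewrite (_ : torus = \bigcap_(i in [set: 'I_n])
    ((fun x : Rn R n => tnth x i : R) @^-1` `[0, 1[)).
  apply: fin_bigcap_measurable => // i _; rewrite -[X in measurable X]setTI.
  by apply: measurable_coord => //; exact: measurable_itv.
apply/seteqP; split => x /= h i.
  by move=> _; rewrite /= in_itv /=; exact: h.
by have := h i I; rewrite /= in_itv.
Qed.

Lemma torus_measure : lebesgue_Rn torus = 1%E.
Proof.
rewrite (_ : torus = [set x | forall i, `[0, 1[%classic (tnth x i : R)]).
  rewrite (@lebesgue_Rn_box R n (fun=> `[0, 1[%classic)) ?big1//.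
  by move=> i _; rewrite lebesgue_measure_itv /= lte01 oppr0 adde0.
by apply/seteqP; split => x h i; have := h i; rewrite /= in_itv.
Qed.

Lemma torus_finite : (@lebesgue_Rn R n torus < +oo)%E.
Proof. by rewrite torus_measure ltry. Qed.

Definition floorZn (x : Rn R n) : Zn n := [tuple Num.floor (tnth x i : R) | i < n].

Definition cell (m : Zn n) : set (Rn R n) := [set x | torus (subRn x (ZnR R m))].

Lemma cell_floor x m : cell m x <-> m = floorZn x.
Proof.
split=> [h|->] /=.
  apply: eq_from_tnth => i; rewrite tnth_mktuple; apply/esym/floor_def.
  have := h i; rewrite tnth_subRn tnth_ZnR => /andP[h0 h1].
  by apply/andP; split; [lra|rewrite intrD; lra].
move=> i; rewrite tnth_subRn tnth_ZnR tnth_mktuple.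
have := floor_itv (tnth x i : R); rewrite intrD => /andP[h0 h1].
by apply/andP; split; lra.
Qed.

Lemma measurable_cell m : measurable (cell m).
Proof.
rewrite -[X in measurable X]setTI.
have := @measurable_subRn R _ _ n id (cst (ZnR R m)).
by apply => //; [exact: measurable_torus].
Qed.

Lemma integral_cell m (f : Rn R n -> \bar R) :
  measurable_fun setT f -> (forall x, 0 <= f x)%E ->
  (\int[lebesgue_Rn]_(x in cell m) f x =
   \int[lebesgue_Rn]_(x in torus) f (addRn (ZnR R m) x))%E.
Proof.
move=> mf f0; rewrite [LHS]integral_mkcond [RHS]integral_mkcond.
rewrite -(integral_translation (ZnR R m))//.
- apply: eq_integral => x _; rewrite !patchE.
  rewrite (_ : (addRn (ZnR R m) x \in cell m) = (x \in torus))//.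
  by apply/idP/idP; rewrite !inE /cell /= addRnK.
- by apply/(measurable_restrictT _ (measurable_cell m)); exact: measurable_funTS.
- by move=> x; rewrite patchE; case: ifP.
Qed.

(** The integer translates of the unit cube are the fibres of the coordinatewise
    floor, hence a countable partition. *)
Lemma integral_tiling (f : Rn R n -> \bar R) :
  measurable_fun setT f -> (forall x, 0 <= f x)%E ->
  (\int[lebesgue_Rn]_x f x = \esum_(m in [set: Zn n])
    \int[lebesgue_Rn]_(x in torus) f (addRn (ZnR R m) x))%E.
Proof.
move=> mf f0; rewrite (@integral_partition R _ _ _ lebesgue_Rn cell)//.
- by apply: eq_esum => m _; exact: integral_cell.
- exact: measurable_cell.
- by move=> x; exists (floorZn x); apply/cell_floor.
- by move=> k m x /cell_floor -> /cell_floor ->.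
Qed.

End torus_tiling.

(** * Integrals of exponentials and of products *)

Section exponential_integral.
Context {R : realType}.
Local Notation leb := (@lebesgue_measure R).

Let continuous_scaled (a : R) (f : R -> R) : continuous f ->
  continuous (fun t => f (a * t)).
Proof.
move=> cf t; apply: (@continuous_comp _ _ _ (fun t => a * t) f); last exact: cf.
exact: mulrl_continuous.
Qed.

Let integral_unit_interval (f F : R -> R) : continuous f ->
  (forall t : R, is_derive t (1 : R) F (f t)) ->
  \int[leb]_(t in `[0, 1[) f t = F 1 - F 0.
Proof.
move=> cf dF.
have cF : continuous F.
  move=> t; apply/differentiable_continuous/derivable1_diffP.
  exact: (@ex_derive _ _ _ _ _ _ _ (dF t)).
rewrite /Rintegral integral_itv_bndo_bndc; last first.
  apply/measurable_EFinP; apply: measurable_funTS.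
  exact: continuous_measurable_fun.
rewrite (@continuous_FTC2 _ f F)//.
- exact: continuous_subspaceT.
- split.
  + by move=> t _; exact: (@ex_derive _ _ _ _ _ _ _ (dF t)).
  + exact/cvg_at_right_filter/cF.
  + exact/cvg_at_left_filter/cF.
- by move=> t _; rewrite derive1E; exact: (@derive_val _ _ _ _ _ _ _ (dF t)).
Qed.

(** For k <> 0 both parts have primitives of period 1. *)
Lemma cintegral_exponential (k : int) :
  cintegral leb `[0, 1[%classic (fun t => cexpi (2 * pi * (k%:~R * t))) =
  (k == 0)%:R.
Proof.
have [->|k0] := eqVneq k 0.
  rewrite (_ : (fun t => _) = cst 1); last first.
    by apply/funext => t; rewrite mulr0z mul0r mulr0 cexpi0.
  rewrite /cintegral !Rintegral_cst//= lebesgue_measure_itv /= lte01 oppr0 adde0.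
  by rewrite /= mul1r mul0r.
pose a : R := 2 * pi * k%:~R.
have a0 : a != 0 by rewrite /a mulf_neq0 ?intr_eq0// mulf_neq0 ?pnatr_eq0// gt_eqF ?pi_gt0.
have aE t : 2 * pi * (k%:~R * t) = a * t by rewrite mulrA.
have [cosa sina] : cos a = 1 /\ sin a = 0.
  by have := cexpi_int (R := R) k; rewrite -/a /cexpi => -[-> ->].
rewrite (_ : (fun t => _) = (fun t => cexpi (a * t))); last first.
  by apply/funext => t; rewrite aE.
rewrite /cintegral /=.
have d1 (t : R) : is_derive t (1 : R) (fun t : R => a^-1 * sin (a * t)) (cos (a * t)).
  by apply: is_derive_eq; rewrite /GRing.scale /=; field.
have d2 (t : R) : is_derive t (1 : R) (fun t : R => - (a^-1 * cos (a * t))) (sin (a * t)).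
  by apply: is_derive_eq; rewrite /GRing.scale /=; field.
rewrite (integral_unit_interval _ d1); last exact/continuous_scaled/continuous_cos.
rewrite (integral_unit_interval _ d2); last exact/continuous_scaled/continuous_sin.
by rewrite !mulr1 !mulr0 cosa sina cos0 sin0 !mulr0 mulr1 !subrr.
Qed.

End exponential_integral.

Section product_integral.
Context d1 d2 (T1 : measurableType d1) (T2 : measurableType d2) (R : realType).
Variable m1 : {sigma_finite_measure set T1 -> \bar R}.
Variable m2 : {sigma_finite_measure set T2 -> \bar R}.

Let Rintegral_tensor (F : T1 -> R) (G : T2 -> R) :
  m1.-integrable setT (EFin \o F) -> m2.-integrable setT (EFin \o G) ->
  (m1 \x m2)%E.-integrable setT (EFin \o (fun p => F p.1 * G p.2)) /\
  \int[(m1 \x m2)%E]_p (F p.1 * G p.2) = \int[m1]_x F x * \int[m2]_y G y.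
Proof.
move=> iF iG.
have mF : measurable_fun setT F by exact/measurable_EFinP/(measurable_int m1).
have mG : measurable_fun setT G by exact/measurable_EFinP/(measurable_int m2).
have mH : measurable_fun setT (EFin \o (fun p : T1 * T2 => F p.1 * G p.2)).
  by apply/measurable_EFinP; apply: measurable_funM; exact: measurableT_comp.
have iH : (m1 \x m2)%E.-integrable setT (EFin \o (fun p => F p.1 * G p.2)).
  apply/integrable12ltyP => //=.
  have nG : (\int[m2]_y `|(G y)%:E| < +oo)%E by case/integrableP : iG.
  have nF : (\int[m1]_x `|(F x)%:E| < +oo)%E by case/integrableP : iF.
  rewrite (eq_integral (fun x => `|(F x)%:E| * \int[m2]_y `|(G y)%:E|)%E).
    rewrite ge0_integralZr//; last 2 first.
    - by apply: measurableT_comp => //; exact/measurable_EFinP.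
    - exact: integral_ge0.
    by rewrite lte_mul_pinfty ?integral_ge0// ge0_fin_numE// integral_ge0.
  move=> x _; rewrite -ge0_integralZl//.
    by apply: eq_integral => y _; rewrite /= normrM.
  by apply: measurableT_comp => //; exact/measurable_EFinP.
split => //; rewrite /Rintegral -(integral12_prod_meas1 iH) /fubini_F /=.
rewrite (eq_integral (fun x => ((F x)%:E * \int[m2]_y (G y)%:E)%E)).
  have /fineK <- : (\int[m2]_y (G y)%:E)%E \is a fin_num.
    exact: integrable_fin_num.
  by rewrite integralZr// fineM//; exact: integrable_fin_num.
move=> x _; rewrite -integralZl//.
Qed.

Lemma cintegral_tensor (D1 : set T1) (D2 : set T2)
    (f : T1 -> R[i]) (g : T2 -> R[i]) (M : R) :
  measurable D1 -> measurable D2 -> (m1 D1 < +oo)%E -> (m2 D2 < +oo)%E ->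
  cmeasurable setT f -> cmeasurable setT g ->
  (forall x, redot (f x) (f x) <= M) -> (forall y, redot (g y) (g y) <= M) ->
  cintegral (m1 \x m2)%E (D1 `*` D2) (fun p => f p.1 * g p.2) =
  cintegral m1 D1 f * cintegral m2 D2 g.
Proof.
move=> mD1 mD2 fin1 fin2 [fr fi] [gr gi] fM gM.
have ib d (T : measurableType d) (m : {measure set T -> \bar R}) (D : set T)
    (F : T -> R) : measurable D -> (m D < +oo)%E -> measurable_fun setT F ->
    (forall x, F x ^+ 2 <= M) -> m.-integrable setT (EFin \o (F \_ D)).
  move=> mD fD mF FM.
  have -> : EFin \o (F \_ D) = (EFin \o F) \_ D.
    by apply/funext => x; rewrite /= !patchE; case: ifP.
  apply/(integrable_mkcond _ mD).
  apply: (@le_integrable _ _ _ _ _ mD _ (cst (Num.sqrt M)%:E)).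
  - exact/measurable_EFinP/measurable_funTS.
  - move=> x _; rewrite /= lee_fin [leRHS]ger0_norm ?sqrtr_ge0//.
    by rewrite -sqrtr_sqr ler_wsqrtr.
  - apply/integrableP; split; first exact: measurable_cst.
    rewrite (eq_integral (cst (Num.sqrt M)%:E)) => [|x _]; last first.
      by rewrite /= ger0_norm ?sqrtr_ge0.
    by rewrite integral_cst// lte_mul_pinfty// lee_fin sqrtr_ge0.
have sqr_le (z : R[i]) : redot z z <= M ->
    complex.Re z ^+ 2 <= M /\ complex.Im z ^+ 2 <= M.
  case: z => a b; rewrite /redot /=.
  by have := sqr_ge0 a; have := sqr_ge0 b; split; lra.
pose Fr := (fun x => complex.Re (f x)) \_ D1.
pose Fi := (fun x => complex.Im (f x)) \_ D1.
pose Gr := (fun x => complex.Re (g x)) \_ D2.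
pose Gi := (fun x => complex.Im (g x)) \_ D2.
have iFr : m1.-integrable setT (EFin \o Fr) by apply: ib => // x; case: (sqr_le _ (fM x)).
have iFi : m1.-integrable setT (EFin \o Fi) by apply: ib => // x; case: (sqr_le _ (fM x)).
have iGr : m2.-integrable setT (EFin \o Gr) by apply: ib => // x; case: (sqr_le _ (gM x)).
have iGi : m2.-integrable setT (EFin \o Gi) by apply: ib => // x; case: (sqr_le _ (gM x)).
have patchM (F : T1 -> R) (G : T2 -> R) p :
    (F \_ D1) p.1 * (G \_ D2) p.2 = ((fun p => F p.1 * G p.2) \_ (D1 `*` D2)) p.
  rewrite !patchE in_setX.
  by case: (p.1 \in D1); case: (p.2 \in D2) => //=; rewrite ?mul0r ?mulr0.
have [i1 e1] := Rintegral_tensor iFr iGr.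
have [i2 e2] := Rintegral_tensor iFi iGi.
have [i3 e3] := Rintegral_tensor iFr iGi.
have [i4 e4] := Rintegral_tensor iFi iGr.
rewrite /cintegral.
have -> : forall a b c e : R, (a +i* b) * (c +i* e) = (a * c - b * e) +i* (a * e + b * c) by [].
rewrite !(Rintegral_mkcond _ D1) !(Rintegral_mkcond _ D2).
rewrite !(Rintegral_mkcond _ (D1 `*` D2)) -/Fr -/Fi -/Gr -/Gi -e1 -e2 -e3 -e4.
rewrite -RintegralB// -RintegralD//; congr (_ +i* _); apply: eq_Rintegral => p _.
  rewrite !patchM !patchE; case: ifP => _; last by rewrite subr0.
  by case: (f p.1) (g p.2) => [a b] [c e].
rewrite !patchM !patchE; case: ifP => _; last by rewrite addr0.
by case: (f p.1) (g p.2) => [a b] [c e].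
Qed.

End product_integral.

(** * The characters of the torus *)

Section torus_characters.
Context {R : realType}.

Lemma cintegral_pushforward d1 d2 (T1 : measurableType d1)
    (T2 : measurableType d2) (m : {measure set T1 -> \bar R})
    (m' : {measure set T2 -> \bar R}) (h : T1 -> T2)
    (A : set T2) (f : T2 -> R[i]) : measurable_fun setT h -> measurable A ->
  (m' : set T2 -> \bar R) = pushforward m h -> cmeasurable setT f ->
  cintegral m' A f = cintegral m (h @^-1` A) (fun x => f (h x)).
Proof.
move=> mh mA mE [mr mi].
have key (F : T2 -> R) : measurable_fun setT F ->
    \int[m']_(y in A) F y = \int[m]_(x in h @^-1` A) F (h x).
  move=> mF; rewrite /Rintegral; congr fine.
  have mFA : measurable_fun A (EFin \o F).
    exact/measurable_EFinP/measurable_funTS.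
  rewrite integralE [RHS]integralE mE; congr (_ - _)%E.
    rewrite (ge0_integral_pushforward mh)//; last exact: measurable_funepos.
    by apply: eq_integral => x _; rewrite /= !funeposE.
  rewrite (ge0_integral_pushforward mh)//; last exact: measurable_funeneg.
  by apply: eq_integral => x _; rewrite /= !funenegE.
by rewrite /cintegral (key _ mr) (key _ mi).
Qed.

Lemma cintegral_one d (T : measurableType d) (m : {measure set T -> \bar R})
    (A : set T) : measurable A -> cintegral m A (cst 1) = (fine (m A))%:C.
Proof. by move=> mA; rewrite /cintegral !Rintegral_cst//= mul1r mul0r. Qed.

(** A character is the product of exponentials in the single coordinates; the
    first one is split off by Fubini. *)
Lemma cintegral_echar n (k : Zn n) :
  cintegral lebesgue_Rn (@torus R n) (echar k) = (k == zeroZn n)%:R.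
Proof.
elim: n k => [|n ih] k.
  rewrite (_ : k = zeroZn 0); last by rewrite (tuple0 k) (tuple0 (zeroZn 0)).
  rewrite eqxx (_ : echar _ = cst 1); last by apply/funext => x; rewrite echar0.
  rewrite cintegral_one; last exact: measurable_torus.
  by rewrite (_ : fine _ = 1)//; exact: (congr1 fine (@torus_measure R 0)).
pose k' : Zn n := [tuple of behead k].
have -> : cintegral lebesgue_Rn (@torus R n.+1) (echar k) =
    cintegral (lebesgue_measure \x (@lebesgue_Rn R n))%E
      (`[0, 1[%classic `*` @torus R n)
      (fun p => cexpi (2 * pi * ((thead k)%:~R * p.1)) * echar k' p.2).
  have pre : @consRn R n @^-1` (@torus R n.+1) = `[0, 1[%classic `*` @torus R n.
    apply/seteqP; split => -[t x] /=; rewrite in_itv /=.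
      move=> h; split; first exact: (h ord0).
      by move=> i; have := h (lift ord0 i); rewrite tnthS.
    by move=> [h0 hS] i; case: (unliftP ord0 i) => [j|] -> //; rewrite tnthS.
  have := @cintegral_pushforward _ _ _ _
    [the {measure set _ -> \bar R} of (lebesgue_measure \x (@lebesgue_Rn R n))%E]
    [the {measure set _ -> \bar R} of @lebesgue_Rn R n.+1]
    _ (@torus R n.+1) (echar k) (@measurable_consRn R n) measurable_torus
    erefl (cmeasurable_echar k).
  rewrite pre => h; rewrite [LHS]h; congr cintegral; apply/funext => -[t x].
  rewrite /echar /dotRn big_ord_recl mulrDr cexpiD; congr (cexpi (_ * _) * cexpi (_ * _)).
    by rewrite tnth_ZnR.
  apply: eq_bigr => i _; rewrite !tnth_ZnR tnthS; congr (_%:~R * _).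
  by rewrite [in LHS](tuple_eta k) tnthS; congr tnth; exact/val_inj.
rewrite (@cintegral_tensor _ _ _ _ _ _ _ _ _
  (fun t : measurableTypeR R => cexpi (2 * pi * ((thead k)%:~R * t))) (echar k') 1)//.
- rewrite cintegral_exponential ih -natrM mulnb; congr ((nat_of_bool _)%:R).
  rewrite {2}(tuple_eta k).
  have -> : zeroZn n.+1 = cons_tuple 0 (zeroZn n).
    apply: eq_from_tnth => i; rewrite tnth_mktuple.
    by case: (unliftP ord0 i) => [j|] ->; rewrite ?tnthS ?tnth_mktuple.
  apply/idP/idP => [/andP[/eqP -> /eqP e]|/eqP e].
    by apply/eqP/val_inj => /=; congr cons; move/(congr1 val) : e.
  move: (congr1 val e) => /= -[-> e']; rewrite eqxx /=.
  by apply/eqP/val_inj.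
- exact: measurable_torus.
- by rewrite /= lebesgue_measure_itv /= lte01 oppr0 adde0 ltry.
- exact: torus_finite.
- apply: cmeasurable_cexpi; apply: measurable_funM; first exact: measurable_cst.
  by apply: measurable_funM; [exact: measurable_cst|exact: measurable_id].
- exact: cmeasurable_echar.
- by move=> t; rewrite redot_cexpi.
- by move=> x; rewrite redot_echar.
Qed.

Lemma cos_2pi_lt (s t : R) : 0 <= s <= 2^-1 -> 0 <= t <= 2^-1 ->
  (cos (2 * pi * s) < cos (2 * pi * t)) = (t < s).
Proof.
move=> /andP[s0 s1] /andP[t0 t1].
have pi0 := pi_gt0 R.
rewrite ltr_cos ?ltr_pM2l ?mulr_gt0// in_itv /= !mulr_ge0 ?(ltW pi0)//=.
  rewrite -mulrA mulrCA -[leRHS]mulr1 ler_pM2l//; lra.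
rewrite -mulrA mulrCA -[leRHS]mulr1 ler_pM2l//; lra.
Qed.

Lemma sin_2pi_ge0 (t : R) : 0 <= t < 1 -> (0 <= sin (2 * pi * t)) = (t <= 2^-1).
Proof.
move=> /andP[t0 t1]; have pi0 := pi_gt0 R.
have [th|th] := leP t 2^-1.
  rewrite sin_ge0_pi// !mulr_ge0 ?(ltW pi0)//=.
  rewrite -mulrA mulrCA -[leRHS]mulr1 ler_pM2l//; lra.
apply/negbTE; rewrite -ltNge.
have -> : 2 * pi * t = pi * (2 * t - 1) + pi by ring.
rewrite sinDpi oppr_lt0 sin_gt0_pi// mulr_gt0//=; last by lra.
rewrite -[ltRHS]mulr1 ltr_pM2l//; lra.
Qed.

Lemma cos_2pi_sym (t : R) : cos (2 * pi * t) = cos (2 * pi * (1 - t)).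
Proof.
have -> : 2 * pi * (1 - t) = - (2 * pi * t) + pi *+ 2 by rewrite -mulr_natr; ring.
by rewrite cosD2pi cosN.
Qed.

(** A point of the circle [0, 1) is below a if and only if it lies on the arc
    from 0 to a, which the signs of sin and cos - cos (2 pi a) describe. *)
Lemma arc_description (a t : R) : 0 <= t < 1 -> 0 < a < 1 ->
  (t < a) = if a <= 2^-1
    then (0 <= sin (2 * pi * t)) && (cos (2 * pi * a) < cos (2 * pi * t))
    else (0 <= sin (2 * pi * t)) || (cos (2 * pi * t) < cos (2 * pi * a)).
Proof.
move=> /andP[t0 t1] /andP[a0 a1]; rewrite sin_2pi_ge0 ?t0//.
have [ah|ah] := leP a 2^-1.
  have [th|th] := leP t 2^-1 => /=; last by apply/negbTE; rewrite -leNgt; lra.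
  by rewrite cos_2pi_lt//; apply/andP; split; lra.
have [th|th] := leP t 2^-1 => /=; first by apply/idP; lra.
rewrite (cos_2pi_sym t) (cos_2pi_sym a) cos_2pi_lt.
- by apply/idP/idP => ?; lra.
- by apply/andP; split; lra.
- by apply/andP; split; lra.
Qed.

Section generation.
Context d (T : measurableType d).
Variables (D : set T) (S : set (set T)).
Hypothesis sS : sigma_algebra D S.

(** A sigma-algebra on D becomes a sigma-algebra on the whole type in this way,
    for which one can speak of measurable functions. *)
Definition traced : set (set T) := [set E | S (D `&` E)].

Lemma sigma_algebra_traced : sigma_algebra setT traced.
Proof.
have [S0 SD SU] := sS; split; rewrite /traced /=.
- by rewrite setI0.
- move=> E SE; rewrite setTD (_ : _ `&` _ = D `\` (D `&` E)); first exact: SD.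
  by apply/seteqP; split => x /= -[Dx h]; split => //; tauto.
- by move=> E SE; rewrite setI_bigcupr; exact: SU.
Qed.

Lemma measurable_tracedE (E : set (g_sigma_algebraType traced)) :
  measurable E = traced E.
Proof. by rewrite /measurable /= sigma_algebra_id//; exact: sigma_algebra_traced. Qed.

Lemma measurable_fun_traced (f : T -> R) :
  (forall c, S (D `&` [set x | c < f x])) ->
  measurable_fun [set: g_sigma_algebraType traced] (f : _ -> R).
Proof.
move=> fS; apply: (measurability _ (RGenOInfty.measurableE R)).
move=> _ [_ [c ->] <-]; rewrite setTI measurable_tracedE.
rewrite (_ : _ @^-1` _ = [set x | c < f x]); first exact: fS.
by apply/seteqP; split => x /=; rewrite in_itv /= andbT.
Qed.

(** The rays of f are pulled back by arcs of the circle, hence Boolean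
    combinations of rays of its cosine and of its sine. *)
Lemma measurable_circle_traced (f : T -> R) :
  (forall x, D x -> 0 <= f x < 1) ->
  (forall c, S (D `&` [set x | c < cos (2 * pi * f x)])) ->
  (forall c, S (D `&` [set x | c < sin (2 * pi * f x)])) ->
  measurable_fun [set: g_sigma_algebraType traced] (f : _ -> R).
Proof.
move=> f01 /measurable_fun_traced mc /measurable_fun_traced ms.
pose X := g_sigma_algebraType traced.
have trace_eq (E F : set X) : (forall x, D x -> E x <-> F x) ->
    measurable E -> measurable F.
  rewrite !measurable_tracedE /traced /= => EF; rewrite (_ : D `&` F = D `&` E)//.
  by apply/seteqP; split => x [Dx h]; split => //; apply/(EF x Dx).
have mC (A : set R) : measurable A -> measurable ((fun x : X => cos (2 * pi * f x)) @^-1` A).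
  by move=> mA; rewrite -[X in measurable X]setTI; exact: mc.
have mS (A : set R) : measurable A -> measurable ((fun x : X => sin (2 * pi * f x)) @^-1` A).
  by move=> mA; rewrite -[X in measurable X]setTI; exact: ms.
apply: (measurability _ (RGenInftyO.measurableE R)).
move=> _ [_ [a ->] <-]; rewrite setTI.
have [a0|a0] := leP a 0.
  apply: (trace_eq set0) => // x /f01/andP[fx0 _]; split => //=.
  by rewrite in_itv /= => fa; lra.
have [a1|a1] := leP 1 a.
  apply: (trace_eq setT) => // x /f01/andP[_ fx1]; split => //= _.
  by rewrite in_itv /=; lra.
have a01 : 0 < a < 1 by rewrite a0.
have [ah|ah] := boolP (a <= 2^-1).
  apply: (trace_eq ((fun x : X => sin (2 * pi * f x)) @^-1` `[0, +oo[ `&`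
     (fun x : X => cos (2 * pi * f x)) @^-1` `]cos (2 * pi * a), +oo[)).
    move=> x Dx /=; rewrite !in_itv /= !andbT.
    rewrite (arc_description (f01 x Dx) a01) ah.
    by split => [[-> ->]|/andP[]].
  by apply: measurableI; [exact: mS|exact: mC].
apply: (trace_eq ((fun x : X => sin (2 * pi * f x)) @^-1` `[0, +oo[ `|`
   (fun x : X => cos (2 * pi * f x)) @^-1` `]-oo, cos (2 * pi * a)[)).
  move=> x Dx /=; rewrite !in_itv /= !andbT.
  rewrite (arc_description (f01 x Dx) a01) (negbTE ah).
  by split => [[->|->]|/orP[]]; rewrite ?orbT; [| |left|right].
by apply: measurableU; [exact: mS|exact: mC].
Qed.

End generation.

Definition basisZn n (i : 'I_n) : Zn n := [tuple ((j == i)%:Z) | j < n].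

Lemma dotRn_basis n (i : 'I_n) (x : Rn R n) : dotRn (ZnR R (basisZn i)) x = tnth x i.
Proof.
rewrite /dotRn (bigD1 i)//= tnth_ZnR tnth_mktuple eqxx mul1r big1 ?addr0// => j ji.
by rewrite tnth_ZnR tnth_mktuple (negbTE ji) mul0r.
Qed.

Section one_torus.
Variable n : nat.
Local Notation torus := (@torus R n).

Lemma echar_orthonormal (k l : Zn n) :
  L2inner lebesgue_Rn torus (echar k) (echar l) = (k == l)%:R.
Proof.
rewrite /L2inner (_ : (fun x => _) = echar (addZn k (oppZn l))); last first.
  by apply/funext => x; rewrite echar_add echar_opp.
rewrite cintegral_echar; congr (nat_of_bool _)%:R; apply/eqP/eqP => [h|->].
  apply: eq_from_tnth => i; have := congr1 (fun t => tnth t i) h.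
  by rewrite !tnth_mktuple => /eqP; rewrite subr_eq0 => /eqP.
by apply: eq_from_tnth => i; rewrite !tnth_mktuple subrr.
Qed.

(** The basis frequencies recover the coordinates from the characters. *)
Lemma echar_generate (S : set (set (Rn R n))) : sigma_algebra torus S ->
  (forall k c, S (torus `&` [set x | c < complex.Re (echar k x)])) ->
  (forall k c, S (torus `&` [set x | c < complex.Im (echar k x)])) ->
  forall E, measurable E -> S (torus `&` E).
Proof.
move=> sS SR SI E mE.
have mid : measurable_fun [set: g_sigma_algebraType (traced torus S)]
    (id : _ -> Rn R n).
  apply: measurable_RnP => i; apply: (measurable_circle_traced sS).
  - by move=> x; apply.
  - move=> c; rewrite (_ : [set x | _] = [set x | c < complex.Re (echar (basisZn i) x)]).
      exact: SR.
    by apply/seteqP; split => x /=; rewrite dotRn_basis.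
  - move=> c; rewrite (_ : [set x | _] = [set x | c < complex.Im (echar (basisZn i) x)]).
      exact: SI.
    by apply/seteqP; split => x /=; rewrite dotRn_basis.
by have := mid measurableT _ mE; rewrite setTI measurable_tracedE.
Qed.

Lemma torus_parseval (g : Rn R n -> R[i]) : L2 lebesgue_Rn torus g ->
  \esum_(k in [set: Zn n])
    ((Normc.normc (L2inner lebesgue_Rn torus g (echar k))) ^+ 2)%:E =
  (nsq lebesgue_Rn torus g)%:E.
Proof.
apply: (@parseval _ _ R lebesgue_Rn torus measurable_torus _ (@echar R n)).
- by move=> k; split; apply: measurable_funTS; have [] := cmeasurable_echar (R := R) k.
- exact: redot_echar.
- by exists (zeroZn n) => x _; exact: echar0.
- by move=> k l; exists (addZn k l) => x _; exact: echar_add.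
- by move=> k; exists (oppZn k) => x _; exact: echar_opp.
- exact: echar_generate.
- exact: torus_finite.
- exact: echar_orthonormal.
Qed.

End one_torus.

Section two_tori.
Variable n : nat.
Local Notation torus := (@torus R n).
Local Notation torus2 := (torus `*` torus).

Definition echar2 (j : Zn n * Zn n) (p : Rn R n * Rn R n) : R[i] :=
  echar j.1 p.1 * echar j.2 p.2.

Lemma redot_echar2 j p : redot (echar2 j p) (echar2 j p) = 1.
Proof. by rewrite redotMM !redot_echar mulr1. Qed.

Lemma cmeasurable_echar2 j : cmeasurable setT (echar2 j).
Proof.
by apply: cmeasurableM; apply: cmeasurable_comp => //; exact: cmeasurable_echar.
Qed.

Lemma measurable_torus2 : measurable torus2.
Proof. by apply: measurableX; exact: measurable_torus. Qed.

Lemma torus2_measure : lebesgue_R2n torus2 = 1%E.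
Proof.
rewrite /lebesgue_R2n product_measure1E; last 2 first.
- exact: measurable_torus.
- exact: measurable_torus.
by transitivity (1 * 1 : \bar R)%E; [congr (_ * _)%E; exact: torus_measure|rewrite mule1].
Qed.

Lemma echar2_orthonormal j l :
  L2inner lebesgue_R2n torus2 (echar2 j) (echar2 l) = (j == l)%:R.
Proof.
rewrite /L2inner (_ : (fun x => _) = fun p =>
    (echar j.1 p.1 * (echar l.1 p.1)^*) * (echar j.2 p.2 * (echar l.2 p.2)^*));
    last first.
  by apply/funext => p; rewrite /echar2 rmorphM mulrACA.
have mu (k m : Zn n) : cmeasurable setT (fun x : Rn R n => echar k x * (echar m x)^*).
  by apply: cmeasurableM; [|apply: cmeasurable_conj]; exact: cmeasurable_echar.
have un (k m : Zn n) (x : Rn R n) :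
    redot (echar k x * (echar m x)^*) (echar k x * (echar m x)^*) <= 1.
  by rewrite -echar_opp redotMM !redot_echar mulr1.
rewrite (@cintegral_tensor _ _ _ _ R lebesgue_Rn lebesgue_Rn torus torus
  (fun x => echar j.1 x * (echar l.1 x)^*)
  (fun x => echar j.2 x * (echar l.2 x)^*) 1)//.
- have := echar_orthonormal j.1 l.1; rewrite /L2inner => ->.
  have := echar_orthonormal j.2 l.2; rewrite /L2inner => ->.
  by rewrite -natrM mulnb; case: j l => [? ?] [? ?].
- exact: measurable_torus.
- exact: measurable_torus.
- exact: torus_finite.
- exact: torus_finite.
Qed.

Let echar2_fst i x :
  echar2 (basisZn i, zeroZn n) x = cexpi (2 * pi * tnth x.1 i).
Proof. by rewrite /echar2 (echar0 x.2) mulr1 /echar dotRn_basis. Qed.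

Let echar2_snd i x :
  echar2 (zeroZn n, basisZn i) x = cexpi (2 * pi * tnth x.2 i).
Proof. by rewrite /echar2 (echar0 x.1) mul1r /echar dotRn_basis. Qed.

Lemma echar2_generate (S : set (set (Rn R n * Rn R n))) : sigma_algebra torus2 S ->
  (forall k c, S (torus2 `&` [set x | c < complex.Re (echar2 k x)])) ->
  (forall k c, S (torus2 `&` [set x | c < complex.Im (echar2 k x)])) ->
  forall E, measurable E -> S (torus2 `&` E).
Proof.
move=> sS SR SI E mE.
have m1 : measurable_fun [set: g_sigma_algebraType (traced torus2 S)]
    (fst : _ -> Rn R n).
  apply: measurable_RnP => i; apply: (measurable_circle_traced sS).
  - by move=> x [+ _]; apply.
  - move=> c; rewrite (_ : [set x | _] =
        [set x | c < complex.Re (echar2 (basisZn i, zeroZn n) x)]).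
      exact: SR.
    by apply/funext => x; rewrite /mkset echar2_fst.
  - move=> c; rewrite (_ : [set x | _] =
        [set x | c < complex.Im (echar2 (basisZn i, zeroZn n) x)]).
      exact: SI.
    by apply/funext => x; rewrite /mkset echar2_fst.
have m2 : measurable_fun [set: g_sigma_algebraType (traced torus2 S)]
    (snd : _ -> Rn R n).
  apply: measurable_RnP => i; apply: (measurable_circle_traced sS).
  - by move=> x [_ +]; apply.
  - move=> c; rewrite (_ : [set x | _] =
        [set x | c < complex.Re (echar2 (zeroZn n, basisZn i) x)]).
      exact: SR.
    by apply/funext => x; rewrite /mkset echar2_snd.
  - move=> c; rewrite (_ : [set x | _] =
        [set x | c < complex.Im (echar2 (zeroZn n, basisZn i) x)]).
      exact: SI.
    by apply/funext => x; rewrite /mkset echar2_snd.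
have mid : measurable_fun [set: g_sigma_algebraType (traced torus2 S)]
    (id : _ -> Rn R n * Rn R n).
  by apply/measurable_fun_pairP; split.
by have := mid measurableT _ mE; rewrite setTI measurable_tracedE.
Qed.

End two_tori.
End torus_characters.

(** * Integrable complex functions and limits of norms *)

Section L1_functions.
Context d (T : measurableType d) (R : realType).
Variables (mu : {measure set T -> \bar R}) (D : set T).
Hypothesis mD : measurable D.
Implicit Types f g h : T -> R[i].

Lemma normc_sqrt (z : R[i]) : Normc.normc z = Num.sqrt (redot z z).
Proof. by case: z => a b; rewrite /redot /= !expr2. Qed.

Lemma measurable_normc f : cmeasurable D f ->
  measurable_fun D (fun x => Normc.normc (f x)).
Proof.
move=> mf; under eq_fun do rewrite normc_sqrt.
have mr := measurable_redot mf mf.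
by apply: (@measurableT_comp _ _ _ _ _ _ (@Num.sqrt R)) => //;
  apply: continuous_measurable_fun; exact: sqrt_continuous.
Qed.

Lemma Re_le_normc (z : R[i]) : `|complex.Re z| <= Normc.normc z.
Proof.
by case: z => a b; rewrite -sqrtr_sqr ler_wsqrtr// lerDl sqr_ge0.
Qed.

Lemma Im_le_normc (z : R[i]) : `|complex.Im z| <= Normc.normc z.
Proof.
by case: z => a b; rewrite -sqrtr_sqr ler_wsqrtr// lerDr sqr_ge0.
Qed.

Lemma L1_normc f : L1 mu D f ->
  mu.-integrable D (EFin \o (fun x => Normc.normc (f x))).
Proof.
move=> [mf ff]; apply/integrableP; split.
  exact/measurable_EFinP/measurable_normc.
by under eq_integral do rewrite /= ger0_norm ?normc_ge0//.
Qed.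

Lemma L1_dominated f (g : T -> R) : cmeasurable D f ->
  mu.-integrable D (EFin \o g) ->
  (forall x, D x -> Normc.normc (f x) <= g x) -> L1 mu D f.
Proof.
move=> mf ig fg; split => //.
have : mu.-integrable D (EFin \o (fun x => Normc.normc (f x))).
  apply: le_integrable ig => //.
    exact/measurable_EFinP/measurable_normc.
  move=> x Dx; rewrite /= lee_fin ger0_norm ?normc_ge0//.
  by rewrite (le_trans (fg x Dx))// ler_norm.
move=> /integrableP[_]; rewrite (eq_integral (fun x => (Normc.normc (f x))%:E))//.
by move=> x _; rewrite /= ger0_norm ?normc_ge0.
Qed.

Lemma L1_Re f : L1 mu D f ->
  mu.-integrable D (EFin \o (fun x => complex.Re (f x))).
Proof.
move=> Lf; apply: le_integrable (L1_normc Lf) => //.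
  by apply/measurable_EFinP; case: Lf => -[].
move=> x _; rewrite /= lee_fin [leRHS]ger0_norm ?normc_ge0//.
exact: Re_le_normc.
Qed.

Lemma L1_Im f : L1 mu D f ->
  mu.-integrable D (EFin \o (fun x => complex.Im (f x))).
Proof.
move=> Lf; apply: le_integrable (L1_normc Lf) => //.
  by apply/measurable_EFinP; case: Lf => -[].
move=> x _; rewrite /= lee_fin [leRHS]ger0_norm ?normc_ge0//.
exact: Im_le_normc.
Qed.

Lemma L1D f g : L1 mu D f -> L1 mu D g -> L1 mu D (fun x => f x + g x).
Proof.
move=> Lf Lg; apply: (L1_dominated
    (g := (fun x => Normc.normc (f x) + Normc.normc (g x)))).
- by apply: cmeasurableD; [case: Lf|case: Lg].
- apply: (@integrableD _ _ _ mu D mD (fun x => (Normc.normc (f x))%:E)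
    (fun x => (Normc.normc (g x))%:E)); exact: L1_normc.
- by move=> x _; exact: le_normcD.
Qed.

Lemma L1M f g (M : R) : cmeasurable D g ->
  (forall x, D x -> Normc.normc (g x) <= M) -> L1 mu D f ->
  L1 mu D (fun x => g x * f x).
Proof.
move=> mg gM Lf; apply: (L1_dominated (g := (fun x => M * Normc.normc (f x)))).
- by apply: cmeasurableM => //; case: Lf.
- exact/integrable_scale/L1_normc.
- by move=> x Dx; rewrite Normc.normcM ler_wpM2r ?normc_ge0// gM.
Qed.

Lemma L1Z c f : L1 mu D f -> L1 mu D (fun x => c * f x).
Proof.
by apply: (@L1M f (fun=> c) (Normc.normc c)).
Qed.

Lemma L1_0 : L1 mu D (fun=> 0).
Proof.
apply: (L1_dominated (g := cst 0)) => //.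
  exact: integrable0.
by move=> x _; rewrite Normc.normc0.
Qed.

Lemma L1_sum (I : Type) (s : seq I) (F : I -> T -> R[i]) :
  (forall i, L1 mu D (F i)) -> L1 mu D (fun x => \sum_(i <- s) F i x).
Proof.
move=> mF; elim: s => [|i s ih].
  by under eq_fun do rewrite big_nil; exact: L1_0.
by under eq_fun do rewrite big_cons; exact: L1D.
Qed.

Lemma L1N f : L1 mu D f -> L1 mu D (fun x => - f x).
Proof.
move=> Lf; rewrite (_ : (fun x => _) = (fun x => -1 * f x)); first exact: L1Z.
by apply/funext => x; rewrite mulN1r.
Qed.

Lemma L1B f g : L1 mu D f -> L1 mu D g -> L1 mu D (fun x => f x - g x).
Proof. by move=> Lf Lg; apply: L1D => //; exact: L1N. Qed.

Lemma eq_cintegral f g : (forall x, D x -> f x = g x) ->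
  cintegral mu D f = cintegral mu D g.
Proof.
by move=> fg; rewrite /cintegral; congr (_ +i* _); apply: eq_Rintegral => x;
  rewrite inE => Dx; rewrite fg.
Qed.

Lemma cintegral0 : cintegral mu D (fun=> 0) = 0.
Proof. by rewrite /cintegral /Rintegral !integral0. Qed.

Lemma cintegralD f g : L1 mu D f -> L1 mu D g ->
  cintegral mu D (fun x => f x + g x) = cintegral mu D f + cintegral mu D g.
Proof.
move=> Lf Lg; rewrite /cintegral.
have -> : forall a b c e : R, (a +i* b) + (c +i* e) = (a + c) +i* (b + e) by [].
rewrite -!RintegralD//; last 4 first.
- exact: L1_Im.
- exact: L1_Im.
- exact: L1_Re.
- exact: L1_Re.
by congr (_ +i* _); apply: eq_Rintegral => x _; case: (f x) (g x) => [? ?] [? ?].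
Qed.

Lemma cintegralZ c f : L1 mu D f ->
  cintegral mu D (fun x => c * f x) = c * cintegral mu D f.
Proof.
move=> Lf; have iR := L1_Re Lf; have iI := L1_Im Lf.
rewrite /cintegral; case: c => p q.
have -> : forall a b c e : R, (a +i* b) * (c +i* e) = (a * c - b * e) +i* (a * e + b * c) by [].
have iS r (F : T -> R) : mu.-integrable D (EFin \o F) ->
    mu.-integrable D (EFin \o (fun x => r * F x)) by exact: integrable_scale.
rewrite -!RintegralZl// -RintegralB//; last 2 first.
- exact: iS.
- exact: iS.
rewrite -RintegralD//; last 2 first.
- exact: iS.
- exact: iS.
by congr (_ +i* _); apply: eq_Rintegral => x _; case: (f x) => [? ?].
Qed.

Lemma cintegral_sum (I : Type) (s : seq I) (F : I -> T -> R[i]) :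
  (forall i, L1 mu D (F i)) ->
  cintegral mu D (fun x => \sum_(i <- s) F i x) =
  \sum_(i <- s) cintegral mu D (F i).
Proof.
move=> LF; elim: s => [|i s ih].
  by under eq_fun do rewrite big_nil; rewrite big_nil cintegral0.
under eq_fun do rewrite big_cons.
by rewrite big_cons cintegralD ?ih//; exact: L1_sum.
Qed.

Lemma cintegralB f g : L1 mu D f -> L1 mu D g ->
  cintegral mu D (fun x => f x - g x) = cintegral mu D f - cintegral mu D g.
Proof.
move=> Lf Lg; rewrite cintegralD//; last exact: L1N.
congr (_ + _); rewrite -mulN1r -cintegralZ//.
by apply: eq_cintegral => x _; rewrite mulN1r.
Qed.

Lemma cintegral_dominated (h_ : nat -> T -> R[i]) h (g : T -> R) :
  (forall k, cmeasurable D (h_ k)) -> cmeasurable D h ->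
  (forall x, D x -> \forall k \near \oo, h_ k x = h x) ->
  mu.-integrable D (EFin \o g) ->
  (forall k x, D x -> Normc.normc (h_ k x) <= g x) ->
  (fun k => complex.Re (cintegral mu D (h_ k))) @ \oo -->
    complex.Re (cintegral mu D h) /\
  (fun k => complex.Im (cintegral mu D (h_ k))) @ \oo -->
    complex.Im (cintegral mu D h).
Proof.
move=> mh_ mh ch ig hg.
have key (P : R[i] -> R) : (forall z, `|P z| <= Normc.normc z) ->
    (forall k, measurable_fun D (P \o h_ k)) -> measurable_fun D (P \o h) ->
    (fun k => \int[mu]_(x in D) P (h_ k x)) @ \oo --> \int[mu]_(x in D) P (h x).
  move=> Pn mP_ mP.
  have [|||//||iP _ c] := @dominated_convergence _ _ _ mu D mD
    (fun k x => (P (h_ k x))%:E) (fun x => (P (h x))%:E) (EFin \o g).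
  - by move=> k; apply/measurable_EFinP; exact: mP_.
  - by apply/measurable_EFinP.
  - apply: aeW => x Dx; apply: cvg_near_cst.
    by have := ch x Dx; apply: filterS => k ->.
  - apply: aeW => x k Dx; rewrite abse_EFin lee_fin.
    exact: le_trans (Pn _) (hg k x Dx).
  have fin : (\int[mu]_(x in D) (P (h x))%:E)%E \is a fin_num.
    exact: integrable_fin_num.
  rewrite /Rintegral; apply: fine_cvg; rewrite fineK//.
split; apply: key.
- exact: Re_le_normc.
- by move=> k; case: (mh_ k).
- by case: mh.
- exact: Im_le_normc.
- by move=> k; case: (mh_ k).
- by case: mh.
Qed.

Lemma nsq_cvg (a_ : nat -> T -> R[i]) a : (forall k, L2 mu D (a_ k)) ->
  L2 mu D a -> (fun k => nsq mu D (fun x => a_ k x - a x)) @ \oo --> (0 : R) ->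
  (fun k => nsq mu D (a_ k)) @ \oo --> nsq mu D a.
Proof.
move=> La_ La ca; apply/cvgrPdist_le => e e0.
have c0 : 0 < 2 * nrm mu D a + 1 by have := nrm_ge0 mu D a; lra.
pose r := Num.min 1 (e / (2 * nrm mu D a + 1)).
have r0 : 0 < r by rewrite lt_min ltr01 divr_gt0.
have r2 : 0 < r ^+ 2 by rewrite exprn_gt0.
have /cvgrPdist_le/(_ _ r2) := ca; apply: filterS => k.
rewrite sub0r normrN ger0_norm ?nsq_ge0// => hk.
rewrite distrC; apply: (@le_trans _ _ (r * (2 * nrm mu D a + 1))).
  by apply: nsq_near => //; rewrite (ltW r0) /r ge_min lexx.
by rewrite -ler_pdivlMr// /r ge_min lexx orbT.
Qed.

End L1_functions.

Lemma isometry_limit d1 d2 (T1 : measurableType d1) (T2 : measurableType d2)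
    (R : realType) (m1 : {measure set T1 -> \bar R})
    (m2 : {measure set T2 -> \bar R}) (D1 : set T1) (D2 : set T2)
    (a_ : nat -> T1 -> R[i]) (b_ : nat -> T2 -> R[i]) a b :
  measurable D1 -> measurable D2 ->
  (forall k, L2 m1 D1 (a_ k)) -> (forall k, L2 m2 D2 (b_ k)) ->
  L2 m1 D1 a -> L2 m2 D2 b ->
  (forall k, nsq m1 D1 (a_ k) = nsq m2 D2 (b_ k)) ->
  (fun k => nsq m1 D1 (fun x => a_ k x - a x)) @ \oo --> (0 : R) ->
  (fun k => nsq m2 D2 (fun x => b_ k x - b x)) @ \oo --> (0 : R) ->
  nsq m1 D1 a = nsq m2 D2 b.
Proof.
move=> mD1 mD2 La_ Lb_ La Lb ab ca cb.
have h1 := nsq_cvg mD1 La_ La ca; have h2 := nsq_cvg mD2 Lb_ Lb cb.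
have E : (fun k => nsq m1 D1 (a_ k)) = (fun k => nsq m2 D2 (b_ k)).
  by apply/funext => k; exact: ab.
by apply: (cvg_unique (@norm_hausdorff _ R^o) h1); rewrite E.
Qed.

Section parametric_integral.
Context d1 d2 (T1 : measurableType d1) (T2 : measurableType d2) (R : realType).
Variable m2 : {sigma_finite_measure set T2 -> \bar R}.

Lemma measurable_parametric_Rintegral (f : T1 * T2 -> R) :
  measurable_fun setT f ->
  measurable_fun setT (fun x => \int[m2]_y f (x, y)).
Proof.
move=> mf; have mEf : measurable_fun setT (EFin \o f) by exact/measurable_EFinP.
apply: (@measurableT_comp _ _ _ _ _ _ (@fine R)) => //.
under eq_fun do rewrite integralE.
apply: emeasurable_funB.
  rewrite (_ : (fun x => _) = fubini_F m2 (EFin \o f)^\+%E); last first.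
    by apply/funext => x; apply: eq_integral => y _; rewrite !funeposE.
  apply: measurable_fun_fubini_tonelli_F => //.
  exact: measurable_funepos.
rewrite (_ : (fun x => _) = fubini_F m2 (EFin \o f)^\-%E); last first.
  by apply/funext => x; apply: eq_integral => y _; rewrite !funenegE.
apply: measurable_fun_fubini_tonelli_F => //.
exact: measurable_funeneg.
Qed.

Lemma cmeasurable_parametric (f : T1 * T2 -> R[i]) : cmeasurable setT f ->
  cmeasurable setT (fun x => cintegral m2 setT (fun y => f (x, y))).
Proof.
by move=> [fr fi]; split;
  [exact: (measurable_parametric_Rintegral fr)
  |exact: (measurable_parametric_Rintegral fi)].
Qed.

End parametric_integral.

Lemma integral2_swap d1 d2 (T1 : measurableType d1) (T2 : measurableType d2)
    (R : realType) (m1 : {sigma_finite_measure set T1 -> \bar R})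
    (m2 : {sigma_finite_measure set T2 -> \bar R}) (D1 : set T1) (D2 : set T2)
    (f : T1 * T2 -> \bar R) : measurable D1 -> measurable D2 ->
  measurable_fun setT f -> (forall p, 0 <= f p)%E ->
  (\int[m1]_(x in D1) \int[m2]_(y in D2) f (x, y) =
   \int[m2]_(y in D2) \int[m1]_(x in D1) f (x, y))%E.
Proof.
move=> mD1 mD2 mf f0.
pose g := f \_ (D1 `*` D2).
have mg : measurable_fun setT g.
  apply/(measurable_restrictT _ (measurableX mD1 mD2)).
  exact: measurable_funTS.
have g0 p : (0 <= g p)%E by rewrite /g patchE; case: ifP.
have := @fubini_tonelli _ _ _ _ R m1 m2 g mg g0.
rewrite /fubini_F /fubini_G => h.
rewrite [LHS]integral_mkcond [RHS]integral_mkcond.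
rewrite (_ : (\int[m1]_x _)%E = (\int[m1]_x \int[m2]_y g (x, y))%E); last first.
  apply: eq_integral => x _; rewrite patchE; case: ifPn => xD.
    rewrite integral_mkcond; apply: eq_integral => y _.
    by rewrite /g !patchE in_setX xD.
  rewrite integral0_eq// => y _; rewrite /g patchE in_setX /=.
  by rewrite (negbTE xD).
rewrite h; apply: eq_integral => y _; rewrite [RHS]patchE; case: ifPn => yD.
  rewrite [RHS]integral_mkcond; apply: eq_integral => x _.
  by rewrite /g !patchE in_setX yD andbT.
rewrite integral0_eq// => x _; rewrite /g patchE in_setX /=.
by rewrite (negbTE yD) andbF.
Qed.

(** * Plancherel's theorem *)

Lemma L2_exhaust d (T : measurableType d) (R : realType)
    (mu : {measure set T -> \bar R}) (U : nat -> set T) (f : T -> R[i]) :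
  (forall N, measurable (U N)) ->
  (forall x, \forall N \near \oo, \1_(U N) x = 1 :> R) -> L2 mu setT f ->
  (forall N, L2 mu setT (fun x => (\1_(U N) x : R)%:C * f x)) /\
  (fun N => nsq mu setT (fun x => (\1_(U N) x : R)%:C * f x - f x)) @ \oo -->
    (0 : R).
Proof.
move=> mU U1 Lf.
have LU N : L2 mu setT (fun x => (\1_(U N) x : R)%:C * f x).
  apply: (@L2M _ _ _ _ _ measurableT f (fun x => (\1_(U N) x : R)%:C) 1) => //.
    exact/cmeasurable_real/measurable_indic.
  move=> x _; rewrite /redot /= mulr0 addr0 indicE.
  by case: (_ \in _); rewrite ?mulr1 ?mulr0.
split => //.
have Ld N := L2B measurableT (LU N) Lf.
pose G N x := (redot ((\1_(U N) x : R)%:C * f x - f x)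
  ((\1_(U N) x : R)%:C * f x - f x))%:E.
have [|||//||_ + _] := @dominated_convergence _ _ _ mu setT measurableT G
    (cst 0%E) (fun x => (redot (f x) (f x))%:E).
- by move=> N; apply/measurable_EFinP; apply: measurable_redot;
    exact: L2_cmeasurable (Ld N).
- exact: measurable_cst.
- apply: aeW => x _; apply: cvg_near_cst; have := U1 x; apply: filterS => N h.
  by rewrite /G h mul1r subrr /redot /= mulr0 addr0.
- exact: L2_redot_self.
- apply: aeW => x N _; rewrite /G abse_EFin lee_fin ger0_norm ?redot_ge0// indicE.
  case: (_ \in _); rewrite ?mul1r ?mul0r ?subrr ?sub0r.
    by rewrite [X in X <= _](_ : _ = 0) ?redot_ge0// /redot /= mulr0 addr0.
  by rewrite redotNl redotNr opprK.
rewrite (_ : (fun k => _) = EFin \o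
    (fun N => nsq mu setT (fun x => (\1_(U N) x : R)%:C * f x - f x))).
  by move=> /fine_cvg.
apply/funext => N /=; rewrite -L2normsqE//; apply: eq_integral => x _.
by rewrite subr0 normc_redot ger0_norm ?redot_ge0.
Qed.

(** Because |f| <= |f|^2 + 1. *)
Lemma L1_of_L2_finite d (T : measurableType d) (R : realType)
    (mu : {measure set T -> \bar R}) (U : set T) (f : T -> R[i]) :
  measurable U -> (mu U < +oo)%E -> L2 mu setT f ->
  (forall x, ~ U x -> f x = 0) -> L1 mu setT f.
Proof.
move=> mU fU Lf f0; apply: (@L1_dominated _ _ _ _ _ measurableT f
  (fun x => redot (f x) (f x) + \1_U x)).
- by case: Lf.
- apply: (@integrableD _ _ _ mu setT measurableT (fun x => (redot (f x) (f x))%:E)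
    (fun x => (\1_U x)%:E)); first exact: L2_redot.
  apply/integrableP; split.
    by apply/measurable_EFinP; exact: measurable_indic.
  rewrite (eq_integral (fun x => (\1_U x : R)%:E)) => [|x _]; last first.
    by rewrite /= ger0_norm.
  by rewrite integral_indic// setIT.
- move=> x _; have [xU|/f0 ->] := pselect (U x); last first.
    by rewrite Normc.normc0 addr_ge0 ?redot_ge0// indicE.
  rewrite indicE mem_set// -normc_redot mulr1n.
  have := sqr_ge0 (Normc.normc (f x) - 1); have := normc_ge0 (f x).
  by move: (Normc.normc (f x)) => r; rewrite sqrrB; nra.
Qed.

Section cells.
Context {R : realType} {n : nat}.
Local Notation torus := (@torus R n).
Implicit Types (J : seq (Zn n)) (f : Rn R n -> R[i]).

Definition cells J : set (Rn R n) := [set x | floorZn x \in J].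

Lemma cellsE J : cells J = \big[setU/set0]_(m <- J) cell m.
Proof.
elim: J => [|m J ih].
  by rewrite big_nil; apply/seteqP; split => x //=.
rewrite big_cons -ih; apply/seteqP; split => x /=; rewrite /cells /= inE.
  move=> /orP[/eqP h|h]; [left; exact/cell_floor|by right].
by move=> [/cell_floor ->|->]; rewrite ?eqxx ?orbT.
Qed.

Lemma measurable_cells J : measurable (cells J).
Proof. by rewrite cellsE; apply: bigsetU_measurable => m _; exact: measurable_cell. Qed.

Lemma cell_finite m : (lebesgue_Rn (@cell R n m) < +oo)%E.
Proof.
rewrite -[X in (X < _)%E]mul1e -integral_cst; last exact: measurable_cell.
rewrite (integral_cell m (f := cst 1%E))//.
by rewrite integral_cst ?mul1e ?torus_finite//; exact: measurable_torus.
Qed.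

Lemma cells_finite J : (lebesgue_Rn (cells J) < +oo)%E.
Proof.
rewrite cellsE; elim: J => [|m J ih]; first by rewrite big_nil measure0.
rewrite big_cons; apply: le_lt_trans (lte_add_pinfty (cell_finite m) ih).
apply: measureU2; first exact: measurable_cell.
by apply: bigsetU_measurable => k _; exact: measurable_cell.
Qed.

Lemma floor_translate (m : Zn n) x : torus x -> floorZn (addRn (ZnR R m) x) = m.
Proof. by move=> Tx; apply/esym/cell_floor; rewrite /cell /= addRnK. Qed.

Definition truncate J f x : R[i] := (\1_(cells J) x : R)%:C * f x.

Lemma cmeasurable_indic_cells J : cmeasurable setT (fun x => (\1_(cells J) x : R)%:C).
Proof. by apply: cmeasurable_real; apply: measurable_indic; exact: measurable_cells. Qed.

Definition first_cells (N : nat) : seq (Zn n) :=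
  undup (pmap pickle_inv (iota 0 N)).

Lemma mem_first_cells (m : Zn n) N : (choice.pickle m < N)%N -> m \in first_cells N.
Proof.
move=> mN; rewrite mem_undup mem_pmap; apply/mapP; exists (choice.pickle m).
  by rewrite mem_iota.
by rewrite pickleK_inv.
Qed.

Lemma indic_first_cells x : \forall N \near \oo, \1_(cells (first_cells N)) x = 1 :> R.
Proof.
exists (choice.pickle (floorZn x)).+1 => // N /= hN.
by rewrite indicE mem_set//; exact: mem_first_cells.
Qed.

Lemma Rintegral_cell m (F : Rn R n -> R) : measurable_fun setT F ->
  \int[lebesgue_Rn]_(x in cell m) F x =
  \int[lebesgue_Rn]_(x in torus) F (addRn (ZnR R m) x).
Proof.
move=> mF; rewrite [LHS]Rintegral_mkcond [RHS]Rintegral_mkcond.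
rewrite -(Rintegral_translation (ZnR R m)).
  apply: eq_Rintegral => x _; rewrite !patchE.
  rewrite (_ : (addRn (ZnR R m) x \in cell m) = (x \in torus))//.
  by apply/idP/idP; rewrite !inE /cell /= addRnK.
by apply/(measurable_restrictT _ (measurable_cell m)); exact: measurable_funTS.
Qed.

Lemma cintegral_cells J f : uniq J -> L1 lebesgue_Rn setT f ->
  (forall x, floorZn x \notin J -> f x = 0) ->
  cintegral lebesgue_Rn setT f =
  \sum_(m <- J) cintegral lebesgue_Rn torus (fun x => f (addRn (ZnR R m) x)).
Proof.
move=> uJ Lf f0; have [mr mi] := Lf.1.
have L1m m : L1 lebesgue_Rn setT (fun x => (\1_(cell m) x)%:C * f x).
  apply: (@L1M _ _ _ _ _ measurableT f (fun x => (\1_(cell m) x)%:C) 1) => //.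
    by apply: cmeasurable_real; apply: measurable_indic; exact: measurable_cell.
  move=> x _; rewrite normc_sqrt /redot /= mulr0 addr0 -expr2 sqrtr_sqr indicE.
  by case: (_ \in _); rewrite ?normr1 ?normr0.
rewrite (@eq_cintegral _ _ _ _ _ _ (fun x => \sum_(m <- J) (\1_(cell m) x)%:C * f x)).
  rewrite cintegral_sum//; apply: eq_bigr => m _.
  rewrite /cintegral -(Rintegral_cell m mr) -(Rintegral_cell m mi).
  rewrite !(Rintegral_mkcond _ (cell m)).
  by congr (_ +i* _); apply: eq_Rintegral => x _; rewrite patchE indicE;
    case: (x \in cell m); case: (f x) => a b /=;
    rewrite ?mul1r ?mul0r ?subr0 ?addr0.
move=> x _; have [xJ|xJ] := boolP (floorZn x \in J).
  rewrite (bigD1_seq _ xJ uJ)/= indicE mem_set ?mul1r; last exact/cell_floor.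
  rewrite big1 ?addr0// => m mx; rewrite indicE memNset ?mul0r//.
  by move=> /cell_floor xm; rewrite xm eqxx in mx.
rewrite f0// big_seq big1// => m mJ; rewrite indicE memNset ?mul0r// => /cell_floor xm.
by rewrite -xm mJ in xJ.
Qed.

End cells.

Section plancherel.
Context {R : realType} {n : nat}.
Local Notation torus := (@torus R n).
Local Notation mu := (@lebesgue_Rn R n).
Implicit Types (J : seq (Zn n)) (f : Rn R n -> R[i]) (s x y : Rn R n).

(** The sign of the exponent is the one that occurs in the Weyl kernel. *)
Definition fourier f s : R[i] :=
  cintegral mu setT (fun x => f x * cexpi (2 * pi * dotRn x s)).

Lemma cmeasurable_phase s : cmeasurable setT (fun x : Rn R n => cexpi (2 * pi * dotRn x s)).
Proof.
apply: cmeasurable_cexpi; apply: measurable_funM; first exact: measurable_cst.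
by apply: measurable_dotRn; [exact: measurable_id|exact: measurable_cst].
Qed.

Lemma cmeasurable_fourier f : cmeasurable setT f -> cmeasurable setT (fourier f).
Proof.
move=> mf.
apply: (@cmeasurable_parametric _ _ _ _ R mu
  (fun p : Rn R n * Rn R n => f p.2 * cexpi (2 * pi * dotRn p.2 p.1))).
apply: cmeasurableM; first exact: cmeasurable_comp.
apply: cmeasurable_cexpi; apply: measurable_funM; first exact: measurable_cst.
exact: measurable_dotRn.
Qed.

Lemma normc_cexpi (t : R) : Normc.normc (cexpi t) = 1.
Proof. by rewrite normc_sqrt redot_cexpi sqrtr1. Qed.

Lemma L1_modulated f (u : Rn R n -> R) : measurable_fun setT u ->
  L1 mu setT f -> L1 mu setT (fun x => f x * cexpi (u x)).
Proof.
move=> mu_ Lf; under eq_fun do rewrite mulrC.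
apply: (@L1M _ _ _ _ _ measurableT f (fun x => cexpi (u x)) 1) => //.
  exact: cmeasurable_cexpi.
by move=> x _; rewrite normc_cexpi.
Qed.

Lemma measurable_phase s : measurable_fun setT (fun x : Rn R n => 2 * pi * dotRn x s).
Proof.
apply: measurable_funM; first exact: measurable_cst.
by apply: measurable_dotRn; [exact: measurable_id|exact: measurable_cst].
Qed.

Lemma L1_fourier_integrand f s : L1 mu setT f ->
  L1 mu setT (fun x => f x * cexpi (2 * pi * dotRn x s)).
Proof. by apply: L1_modulated; exact: measurable_phase. Qed.

Lemma fourierB f g : L1 mu setT f -> L1 mu setT g ->
  forall s, fourier (fun x => f x - g x) s = fourier f s - fourier g s.
Proof.
move=> Lf Lg s; rewrite /fourier -cintegralB//; last 2 first.
- exact: L1_fourier_integrand.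
- exact: L1_fourier_integrand.
by apply: eq_cintegral => x _; rewrite mulrBl.
Qed.

Lemma L1_of_L2_cells J f : L2 mu setT f ->
  (forall x, floorZn x \notin J -> f x = 0) -> L1 mu setT f.
Proof.
move=> Lf f0; apply: (L1_of_L2_finite (measurable_cells J) (cells_finite J)) => //.
by move=> x xJ; apply: f0; apply/negP.
Qed.

Lemma L2_translate_torus m f : L2 mu setT f ->
  L2 mu torus (fun x => f (addRn (ZnR R m) x)).
Proof.
move=> [mf ff]; split.
  have [m1 m2] : cmeasurable setT (fun x => f (addRn (ZnR R m) x)).
    by apply: cmeasurable_comp => //; apply: measurable_addRn => //; exact: measurable_cst.
  by split; exact: measurable_funTS.
apply: le_lt_trans ff; rewrite /L2normsq.
have mg := measurable_normc2 mf.
rewrite -(@integral_cell R n m (fun x => ((Normc.normc (f x)) ^+ 2)%:E)) => //.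
  apply: ge0_subset_integral => //; first exact: measurable_cell.
  by move=> x _; rewrite lee_fin sqr_ge0.
by move=> x; rewrite lee_fin sqr_ge0.
Qed.

Lemma oppZnK : involutive (@oppZn n).
Proof. by move=> k; apply: eq_from_tnth => i; rewrite !tnth_mktuple opprK. Qed.

Definition periodized J f s x : R[i] :=
  \sum_(j <- J) f (addRn (ZnR R j) x) *
    cexpi (2 * pi * dotRn (addRn (ZnR R j) x) s).

Let L2_periodized_term f s j : L2 mu setT f ->
  L2 mu torus (fun x => f (addRn (ZnR R j) x) *
    cexpi (2 * pi * dotRn (addRn (ZnR R j) x) s)).
Proof.
move=> Lf; under eq_fun do rewrite mulrC.
apply: (@L2M _ _ _ _ _ measurable_torus _
  (fun x => cexpi (2 * pi * dotRn (addRn (ZnR R j) x) s)) 1).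
- have [m1 m2] := cmeasurable_phase s.
  by split; apply: measurable_funTS; [apply: (measurableT_comp m1)|
    apply: (measurableT_comp m2)]; apply: measurable_addRn => //;
    exact: measurable_cst.
- by move=> x _; rewrite redot_cexpi.
- exact: L2_translate_torus.
Qed.

(** Once the integral is folded onto the torus, the exponential of frequency m is
    invariant under the integer translations, while the one of frequency s is
    part of the periodization. *)
Lemma fourier_samples J f s m : uniq J -> L2 mu setT f ->
  (forall x, floorZn x \notin J -> f x = 0) ->
  fourier f (addRn (ZnR R m) s) =
  L2inner mu torus (periodized J f s) (echar (oppZn m)).
Proof.
move=> uJ Lf f0; have Lf1 := L1_of_L2_cells Lf f0.
have Le : L2 mu torus (echar (oppZn m)).
  apply: (@L2_bounded _ _ _ _ _ measurable_torus _ _ 1).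
  - exact: torus_finite.
  - by have [? ?] := cmeasurable_echar (R := R) (oppZn m);
      split; exact: measurable_funTS.
  - by move=> x _; rewrite redot_echar.
rewrite /fourier (cintegral_cells uJ); last 2 first.
- exact: L1_fourier_integrand.
- by move=> x /f0 ->; rewrite mul0r.
rewrite /periodized L2inner_suml//; last first.
- by move=> j; exact: L2_periodized_term.
- exact: measurable_torus.
apply: eq_bigr => j _; rewrite /L2inner; congr cintegral; apply/funext => x.
rewrite echar_opp Num.Theory.conjCK -[RHS]mulrA -(echar_period m j) /echar -cexpiD.
by congr (_ * cexpi _); rewrite dotRnDr mulrDr addrC (dotRnC (ZnR R m)).
Qed.

Lemma nsq_echar_sum J (c : Zn n -> R[i]) : uniq J ->
  nsq mu torus (fun s => \sum_(j <- J) c j * echar j s) =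
  \sum_(j <- J) redot (c j) (c j).
Proof.
move=> uJ.
have Le j : L2 mu torus (echar j).
  apply: (@L2_bounded _ _ _ _ _ measurable_torus _ _ 1).
  - exact: torus_finite.
  - by have [? ?] := cmeasurable_echar (R := R) j; split; exact: measurable_funTS.
  - by move=> x _; rewrite redot_echar.
have Lc j := L2Z measurable_torus (c j) (Le j).
rewrite nsq_orthogonal_sum//.
- apply: eq_bigr => j _; rewrite nsqZ//; last exact: measurable_torus.
  have := L2inner_self (Le j); rewrite echar_orthonormal eqxx.
  by move=> /(congr1 (@complex.Re R)) /= <-; rewrite mulr1.
- exact: measurable_torus.
- move=> i j ij; have : L2inner mu torus (fun s => c i * echar i s) (fun s => c j * echar j s) = 0.
    rewrite L2innerZl//; last exact: measurable_torus.
    rewrite L2inner_conj//; last exact: measurable_torus.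
    rewrite L2innerZl//; last exact: measurable_torus.
    by rewrite echar_orthonormal eq_sym (negbTE ij) mulr0 conjC0 mulr0.
  by rewrite L2innerE => /(congr1 (@complex.Re R)).
Qed.

(** Plancherel for functions carried by finitely many cells: Parseval in x
    for each s turns the square norm of the Fourier transform into the double
    integral of |periodized|^2 over the torus, and orthonormality of the
    characters in s evaluates it. *)
Lemma plancherel_cells J f : uniq J -> L2 mu setT f ->
  (forall x, floorZn x \notin J -> f x = 0) ->
  L2normsq mu setT (fourier f) = L2normsq mu setT f.
Proof.
move=> uJ Lf f0; have mf := Lf.1.
have mtorus := @measurable_torus R n.
have mF := cmeasurable_fourier mf.
have sq0 (g : Rn R n -> R[i]) x : (0 <= ((Normc.normc (g x)) ^+ 2)%:E)%E.
  by rewrite lee_fin sqr_ge0.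
have mtr (m : Zn n) : measurable_fun setT (fun x : Rn R n => addRn (ZnR R m) x).
  by apply: measurable_addRn => //; exact: measurable_cst.
rewrite /L2normsq integral_tiling//; last exact: measurable_normc2.
rewrite -integral_esum//; last first.
  move=> m; apply: measurable_funTS.
  by apply: (measurableT_comp (measurable_normc2 mF)); exact: mtr.
have Lp s : L2 mu torus (periodized J f s).
  by apply: L2_sum => // j; exact: L2_periodized_term.
transitivity (\int[mu]_(s in torus) \int[mu]_(x in torus)
    ((Normc.normc (periodized J f s x)) ^+ 2)%:E)%E.
  apply: eq_integral => s _.
  rewrite -[RHS]/(L2normsq mu torus (periodized J f s)) (L2normsqE measurable_torus (Lp s)).
  rewrite -torus_parseval//.
  rewrite [RHS](reindex_esum [set: Zn n] [set: Zn n] (@oppZn n)).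
    by apply: eq_esum => m _; rewrite (fourier_samples s m uJ Lf f0).
  split => // [k l _ _ /(congr1 (@oppZn n))|k _]; first by rewrite !oppZnK.
  by exists (oppZn k) => //; exact: oppZnK.
rewrite (@integral2_swap _ _ _ _ R mu mu torus torus (fun p => ((Normc.normc (periodized J f p.1 p.2)) ^+ 2)%:E))//;
  last first.
- apply: measurable_normc2; apply: cmeasurable_sum => j; apply: cmeasurableM.
    apply: (cmeasurable_comp mf).
    by apply: measurable_addRn => //; exact: measurable_cst.
  apply: cmeasurable_cexpi; apply: measurable_funM; first exact: measurable_cst.
  apply: measurable_dotRn => //.
  by apply: measurable_addRn => //; exact: measurable_cst.
rewrite [RHS]integral_tiling//; last exact: measurable_normc2.
rewrite -integral_esum//; last first.
  move=> m; apply: measurable_funTS.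
  by apply: (measurableT_comp (measurable_normc2 mf)); exact: mtr.
apply: eq_integral => x /set_mem Tx /=.
pose c j := f (addRn (ZnR R j) x).
have cE : L2 mu torus (fun s => \sum_(j <- J) c j * echar j s).
  apply: L2_sum => // j; apply: L2Z => //.
  apply: (@L2_bounded _ _ _ _ _ measurable_torus _ _ 1).
  - exact: torus_finite.
  - by have [? ?] := cmeasurable_echar (R := R) j; split; exact: measurable_funTS.
  - by move=> y _; rewrite redot_echar.
transitivity (L2normsq mu torus (fun s => \sum_(j <- J) c j * echar j s)).
  apply: eq_integral => s _; congr (_%:E); rewrite !normc_redot.
  rewrite (_ : periodized J f s x =
      cexpi (2 * pi * dotRn x s) * \sum_(j <- J) c j * echar j s).
    by rewrite redotMM redot_cexpi mul1r.
  rewrite mulr_sumr; apply: eq_bigr => j _; rewrite /echar dotRnDl mulrDr cexpiD.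
  by rewrite [RHS]mulrCA; congr (_ * _); exact: mulrC.
rewrite L2normsqE// nsq_echar_sum//.
rewrite (_ : (\esum_(i in _) _)%E = \esum_(m in [set: Zn n])
   (if m \in J then (redot (c m) (c m))%:E else 0%E)); last first.
  apply: eq_esum => m _; case: ifPn => mJ; first by rewrite normc_redot.
  by rewrite f0 ?floor_translate// Normc.normc0 expr0n.
rewrite (_ : \esum_(m in _) _ = \esum_(m in [set` J]) (redot (c m) (c m))%:E)%E.
  rewrite esum_fset; first by rewrite -fsbig_seq// sumEFin.
    exact: finite_seq.
  by move=> m _; rewrite lee_fin redot_ge0.
rewrite [RHS]esum_mkcond; apply: eq_esum => m _.
by rewrite (_ : (m \in [set` J]) = (m \in J))//; apply/idP/idP; rewrite inE.
Qed.

Lemma truncate_zero J f x : floorZn x \notin J -> truncate J f x = 0.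
Proof.
by move=> xJ; rewrite /truncate indicE memNset ?mul0r// /cells /= (negbTE xJ).
Qed.

Lemma L1_truncate J f : L1 mu setT f -> L1 mu setT (truncate J f).
Proof.
apply: (@L1M _ _ _ _ _ measurableT f (fun x => (\1_(cells J) x : R)%:C) 1) => //.
  exact: cmeasurable_indic_cells.
move=> x _; rewrite normc_sqrt /redot /= mulr0 addr0 -expr2 sqrtr_sqr indicE.
by case: (_ \in _); rewrite ?normr1 ?normr0.
Qed.

(** Plancherel for integrable square integrable functions, by truncation: the
    transforms of the truncations converge pointwise and are Cauchy in L^2,
    so that Fatou's lemma identifies their limit. *)
Lemma plancherel f : L1 mu setT f -> L2 mu setT f ->
  L2normsq mu setT (fourier f) = L2normsq mu setT f.
Proof.
move=> Lf1 Lf.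
pose f_ N := truncate (first_cells N) f.
have [Lf_ cf_] : (forall N, L2 mu setT (f_ N)) /\
    (fun N => nsq mu setT (fun x => f_ N x - f x)) @ \oo --> (0 : R).
  apply: (@L2_exhaust _ _ R mu (fun N => cells (first_cells N)) f) => //.
    by move=> N; exact: measurable_cells.
  exact: indic_first_cells.
have L1f_ N : L1 mu setT (f_ N) by exact: L1_truncate.
have F_iso N : L2normsq mu setT (fourier (f_ N)) = L2normsq mu setT (f_ N).
  by apply: (@plancherel_cells (first_cells N)) => //;
    [exact: undup_uniq|exact: truncate_zero].
have LF_ N : L2 mu setT (fourier (f_ N)).
  split; first by apply: cmeasurable_fourier; case: (L1f_ N).
  by rewrite F_iso; case: (Lf_ N).
have mF : cmeasurable setT (fourier f) by apply: cmeasurable_fourier; case: Lf.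
have FB N M : nsq mu setT (fun s => fourier (f_ M) s - fourier (f_ N) s) =
    nsq mu setT (fun x => f_ M x - f_ N x).
  apply: EFin_inj; rewrite -!L2normsqE//; last 2 first.
  - exact: L2B.
  - exact: L2B.
  rewrite -(@plancherel_cells (undup (first_cells M ++ first_cells N))
    (fun x => f_ M x - f_ N x)).
  - by apply: eq_L2normsq => s _; rewrite fourierB.
  - exact: undup_uniq.
  - exact: L2B.
  - move=> x; rewrite mem_undup mem_cat negb_or => /andP[xM xN].
    by rewrite /f_ !truncate_zero ?subrr.
have tail (e : R) : 0 < e -> \forall N \near \oo,
    (L2normsq mu setT (fun s => (fourier (f_ N) s - fourier f s)%R) <= e%:E)%E.
  move=> e0; have e4 : 0 < e / 4 by rewrite divr_gt0.
  have /cvgrPdist_le/(_ _ e4)[N0 _ hN0] := cf_.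
  have hN N : (N0 <= N)%N -> nsq mu setT (fun x => f_ N x - f x) <= e / 4.
    by move=> /hN0; rewrite sub0r normrN ger0_norm ?nsq_ge0.
  exists N0 => // N /= N0N.
  apply: (@L2normsq_fatou _ _ _ mu setT measurableT
    (fun M s => fourier (f_ N) s - fourier (f_ M) s)).
  - by move=> M; apply: L2_cmeasurable; apply: L2B.
  - apply: cmeasurableD; first exact: L2_cmeasurable (LF_ N).
    exact: cmeasurableN.
  - apply: aeW => s _.
    have [] := @cintegral_dominated _ _ R mu setT measurableT
      (fun M x => f_ M x * cexpi (2 * pi * dotRn x s))
      (fun x => f x * cexpi (2 * pi * dotRn x s))
      (fun x => Normc.normc (f x)).
    + by move=> M; case: (L1_fourier_integrand s (L1f_ M)).
    + by case: (L1_fourier_integrand s Lf1).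
    + move=> x _; have := indic_first_cells x; apply: filterS => M h.
      by rewrite /f_ /truncate h mul1r.
    + exact: L1_normc.
    + move=> M x _; rewrite Normc.normcM normc_cexpi mulr1 /f_ /truncate indicE.
      case: (_ \in _); rewrite ?mul1r// mul0r Normc.normc0; exact: normc_ge0.
    move=> cr ci; split.
      rewrite (_ : (fun k => _) = (fun M => complex.Re (fourier (f_ N) s) -
          complex.Re (fourier (f_ M) s))).
        rewrite (_ : complex.Re (fourier (f_ N) s - fourier f s) =
          complex.Re (fourier (f_ N) s) - complex.Re (fourier f s))//.
        by apply: cvgB; [exact: cvg_cst|exact: cr].
      by apply/funext.
    rewrite (_ : (fun k => _) = (fun M => complex.Im (fourier (f_ N) s) -
        complex.Im (fourier (f_ M) s))).
      rewrite (_ : complex.Im (fourier (f_ N) s - fourier f s) =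
        complex.Im (fourier (f_ N) s) - complex.Im (fourier f s))//.
      by apply: cvgB; [exact: cvg_cst|exact: ci].
    by apply/funext.
  - exists N0 => // M /= N0M; rewrite L2normsqE ?lee_fin//; last exact: L2B.
    rewrite FB (le_trans (nsqB_split measurableT (Lf_ N) Lf (Lf_ M)))//.
    by rewrite (nsqBC mu setT f (f_ M)); have := hN _ N0M; have := hN _ N0N; lra.
have LFf : L2 mu setT (fourier f).
  have [N _ /(_ N (leqnn _)) h] := tail 1 ltr01.
  have L := L2B measurableT (LF_ N) (conj (cmeasurableD (L2_cmeasurable (LF_ N))
    (cmeasurableN mF)) (le_lt_trans h (ltry _))).
  by apply: eq_L2 L => s _; rewrite opprB addrC subrK.
rewrite !L2normsqE//; congr (_%:E); apply/esym.
apply: (isometry_limit (a_ := f_) (b_ := fun N => fourier (f_ N))) => //.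
- move=> N; apply: EFin_inj.
  by rewrite -(L2normsqE measurableT (Lf_ N)) -(L2normsqE measurableT (LF_ N)).
- apply/cvgrPdist_le => e /tail; apply: filterS => N.
  rewrite (L2normsqE measurableT (L2B measurableT (LF_ N) LFf)).
  by rewrite lee_fin sub0r normrN ger0_norm ?nsq_ge0.
Qed.

End plancherel.

(** * The Weyl kernel of an integrable function *)

Section integrals_R2n.
Context {R : realType} {n : nat}.
Local Notation mu := (@lebesgue_Rn R n).
Local Notation mu2 := (@lebesgue_R2n R n).
Local Open Scope ereal_scope.

Lemma integral_R2n (f : Rn R n * Rn R n -> \bar R) :
  measurable_fun setT f -> (forall p, 0 <= f p) ->
  \int[mu2]_p f p = \int[mu]_x \int[mu]_y f (x, y).
Proof. by move=> mf f0; exact: (@fubini_tonelli1 _ _ _ _ R mu mu f mf f0). Qed.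

Lemma integral_R2n_swap (f : Rn R n * Rn R n -> \bar R) :
  measurable_fun setT f -> (forall p, 0 <= f p) ->
  \int[mu2]_p f p = \int[mu]_y \int[mu]_x f (x, y).
Proof. by move=> mf f0; exact: (@fubini_tonelli2 _ _ _ _ R mu mu f mf f0). Qed.

Lemma integral_R2n_translation (a b : Rn R n) (f : Rn R n * Rn R n -> \bar R) :
  measurable_fun setT f -> (forall p, 0 <= f p) ->
  \int[mu2]_p f (addRn a p.1, addRn b p.2) = \int[mu2]_p f p.
Proof.
move=> mf f0; rewrite !integral_R2n//; last first.
  apply: (measurableT_comp mf); apply/measurable_fun_pairP; split.
    by apply: measurable_addRn => //; exact: measurable_cst.
  by apply: measurable_addRn => //; exact: measurable_cst.
rewrite -(integral_translation a (f := fun x => \int[mu]_y f (x, y))).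
- apply: eq_integral => x _ /=.
  apply: (@integral_translation R n b (fun y => f (addRn a x, y))) => //.
  by apply: (measurableT_comp mf); exact: measurable_pair1.
- exact: (@measurable_fun_fubini_tonelli_F _ _ _ _ R mu f mf f0).
- by move=> x; exact: integral_ge0.
Qed.

(** For fixed x the map y |-> y - x preserves null sets. *)
Lemma ae_difference (P : Rn R n -> Prop) : {ae mu, forall y, P y} ->
  {ae mu2, forall p : Rn R n * Rn R n, P (subRn p.2 p.1)}.
Proof.
move=> [A [mA A0 PA]].
have mB : measurable [set p : Rn R n * Rn R n | A (subRn p.2 p.1)].
  rewrite -[X in measurable X]setTI.
  by apply: (@measurable_subRn R _ _ n snd fst).
exists [set p | A (subRn p.2 p.1)]; split => //; last by move=> p /= h; exact: PA.
transitivity (\int[mu2]_p (\1_[set p | A (subRn p.2 p.1)] p : R)%:E).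
  by rewrite integral_indic// setIT.
rewrite integral_R2n//.
- apply: integral0_eq => x _.
  rewrite -(integral_translation x).
  + rewrite (eq_integral (fun y => (\1_A y)%:E)) => [|y _].
      by rewrite integral_indic// setIT.
    rewrite !indicE; congr (_%:R%:E); congr nat_of_bool.
    by apply/idP/idP; rewrite !inE /= addRnK.
  + apply/measurable_EFinP.
    have mi : measurable_fun setT (\1_[set p | A (subRn p.2 p.1)] : _ -> R).
      exact: measurable_indic.
    by apply: (measurableT_comp mi); exact: measurable_pair1.
  + by move=> y; rewrite lee_fin.
by apply/measurable_EFinP; exact: measurable_indic.
Qed.

Lemma ae_translate (a : Rn R n) (P : Rn R n -> Prop) : {ae mu, forall y, P y} ->
  {ae mu, forall y : Rn R n, P (subRn y a)}.
Proof.
move=> [A [mA A0 PA]].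
have mB : measurable [set y : Rn R n | A (subRn y a)].
  rewrite -[X in measurable X]setTI.
  by apply: (@measurable_subRn R _ _ n id (cst a)) => //; exact: measurable_cst.
exists [set y | A (subRn y a)]; split => //; last by move=> y /= h; exact: PA.
transitivity (\int[mu]_y (\1_[set y | A (subRn y a)] y : R)%:E).
  by rewrite integral_indic// setIT.
rewrite -(integral_translation a).
- rewrite (eq_integral (fun y => (\1_A y)%:E)) => [|y _].
    by rewrite integral_indic// setIT.
  rewrite !indicE; congr (_%:R%:E); congr nat_of_bool.
  by apply/idP/idP; rewrite !inE /= addRnK.
- by apply/measurable_EFinP; exact: measurable_indic.
- by move=> y; rewrite lee_fin.
Qed.

End integrals_R2n.

Lemma ae_eq_L2normsq d (T : measurableType d) (R : realType)
    (mu : {measure set T -> \bar R}) (D : set T) (f g : T -> R[i]) :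
  measurable D -> cmeasurable D f -> cmeasurable D g ->
  {ae mu, forall x, D x -> f x = g x} -> L2normsq mu D f = L2normsq mu D g.
Proof.
move=> mD mf mg fg; apply: ge0_ae_eq_integral => //.
- exact: measurable_normc2.
- exact: measurable_normc2.
- by move=> x _; rewrite lee_fin sqr_ge0.
- by move=> x _; rewrite lee_fin sqr_ge0.
- by move: fg; apply: filterS => x /= h Dx; rewrite h.
Qed.

Section weyl_isometry.
Context {R : realType} {n : nat}.
Local Notation mu := (@lebesgue_Rn R n).
Local Notation mu2 := (@lebesgue_R2n R n).
Implicit Types (phi psi : Rn R n * Rn R n -> R[i]) (k l : Zn n).

Lemma cmeasurable_weyl phi : cmeasurable setT phi ->
  cmeasurable setT (weyl_integral phi).
Proof.
move=> mphi; apply: (@cmeasurable_parametric _ _ _ _ R mu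
  (fun q : (Rn R n * Rn R n) * Rn R n => phi (q.2, subRn q.1.2 q.1.1) *
     cexpi (pi * dotRn q.2 (addRn q.1.1 q.1.2)))).
have m11 : measurable_fun setT (fun q : (Rn R n * Rn R n) * Rn R n => q.1.1).
  exact: measurableT_comp.
have m12 : measurable_fun setT (fun q : (Rn R n * Rn R n) * Rn R n => q.1.2).
  exact: measurableT_comp.
apply: cmeasurableM.
  apply: (cmeasurable_comp mphi); apply/measurable_fun_pairP; split.
    exact: (@measurable_snd _ _ (Rn R n * Rn R n)%type (Rn R n)).
  by apply: (@measurable_subRn R _ _ n (fun q => q.1.2) (fun q => q.1.1));
    exact: measurableT_comp.
apply: cmeasurable_cexpi; apply: measurable_funM; first exact: measurable_cst.
by apply: measurable_dotRn => //; exact: measurable_addRn.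
Qed.

Definition slice phi (y x : Rn R n) : R[i] := phi (x, y).

Lemma cmeasurable_slice phi y : cmeasurable setT phi -> cmeasurable setT (slice phi y).
Proof. by move=> mphi; apply: (cmeasurable_comp mphi); exact: measurable_pair2. Qed.

Lemma ae_L1_slice phi : L1 mu2 setT phi -> {ae mu, forall y, L1 mu setT (slice phi y)}.
Proof.
move=> Lphi; have i1 := L1_normc Lphi.
have := @ae_integrable2 _ _ _ _ R mu mu _ i1; apply: filterS => y iy.
apply: (@L1_dominated _ _ _ _ _ measurableT _ (fun x => Normc.normc (phi (x, y)))) => //.
by apply: cmeasurable_slice; case: Lphi.
Qed.

Lemma ae_L2_slice phi : L2 mu2 setT phi -> {ae mu, forall y, L2 mu setT (slice phi y)}.
Proof.
move=> Lphi; have i1 := L2_redot_self Lphi.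
have := @ae_integrable2 _ _ _ _ R mu mu _ i1; apply: filterS => y iy.
by apply: L2_intro => //; apply: cmeasurable_slice; case: Lphi.
Qed.

(** For eta = xi + y the exponent pi x.(xi + eta) equals 2 pi x.xi + pi x.y. *)
Lemma weyl_shear phi (xi y : Rn R n) : weyl_integral phi (xi, addRn xi y) =
  fourier (fun x => slice phi y x * cexpi (pi * dotRn x y)) xi.
Proof.
rewrite /weyl_integral /fourier; apply: eq_cintegral => x _ /=.
rewrite addRnK -mulrA -cexpiD; congr (_ * cexpi _).
by rewrite !dotRnDr; ring.
Qed.

(** The shear (xi, y) |-> (xi, xi + y) preserves the measure and turns the kernel
    into Fourier transforms of modulated slices of phi, whose norms Plancherel's
    theorem gives for almost every y. *)
Lemma weyl_isometry phi : L1 mu2 setT phi -> L2 mu2 setT phi ->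
  L2normsq mu2 setT (weyl_integral phi) = L2normsq mu2 setT phi.
Proof.
move=> L1phi Lphi; have mphi := Lphi.1; have mW := cmeasurable_weyl mphi.
have mW2 := measurable_normc2 mW.
have mphi2 := measurable_normc2 mphi.
have ge0 psi p : (0 <= ((Normc.normc (psi p)) ^+ 2)%:E)%E by rewrite lee_fin sqr_ge0.
rewrite /L2normsq integral_R2n//.
have msh : measurable_fun setT (fun p : Rn R n * Rn R n => (p.1, addRn p.1 p.2)).
  apply/measurable_fun_pairP; split; first exact: measurable_fst.
  by apply: (@measurable_addRn R _ _ n fst snd); [exact: measurable_fst|exact: measurable_snd].
transitivity (\int[mu]_xi \int[mu]_y
    ((Normc.normc (weyl_integral phi (xi, addRn xi y))) ^+ 2)%:E)%E.
  apply: eq_integral => xi _; apply/esym.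
  apply: (@integral_translation R n xi
    (fun eta => ((Normc.normc (weyl_integral phi (xi, eta))) ^+ 2)%:E)) => //.
  by apply: (measurableT_comp mW2); exact: measurable_pair1.
have mV : cmeasurable setT (fun p : Rn R n * Rn R n => weyl_integral phi (p.1, addRn p.1 p.2)).
  exact: (cmeasurable_comp mW msh).
have mV2 := measurable_normc2 mV.
rewrite (@integral2_swap _ _ _ _ R mu mu setT setT (fun p =>
  ((Normc.normc (weyl_integral phi (p.1, addRn p.1 p.2))) ^+ 2)%:E))//.
rewrite (integral_R2n_swap mphi2 (ge0 phi)).
apply: ge0_ae_eq_integral => //.
- exact: (measurable_fun_fubini_tonelli_G (m1 := mu) _ mV2 (ge0 _)).
- exact: (measurable_fun_fubini_tonelli_G (m1 := mu) _ mphi2 (ge0 _)).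
- by move=> y _; exact: integral_ge0.
- by move=> y _; exact: integral_ge0.
have := ae_L1_slice L1phi; have := ae_L2_slice Lphi; apply: filterS2 => y L2y L1y _.
have mu_y : measurable_fun setT (fun x : Rn R n => pi * dotRn x y).
  apply: measurable_funM; first exact: measurable_cst.
  by apply: measurable_dotRn; [exact: measurable_id|exact: measurable_cst].
have L2m : L2 mu setT (fun x => slice phi y x * cexpi (pi * dotRn x y)).
  under eq_fun do rewrite mulrC.
  apply: (@L2M _ _ _ _ _ measurableT _ (fun x => cexpi (pi * dotRn x y)) 1) => //.
    exact: cmeasurable_cexpi.
  by move=> x _; rewrite redot_cexpi.
under eq_integral do rewrite weyl_shear.
have := plancherel (L1_modulated mu_y L1y) L2m; rewrite /L2normsq => ->.
apply: eq_integral => x _; congr (_%:E).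
by rewrite !normc_redot mulrC redotMM redot_cexpi mul1r.
Qed.

(** The unimodular constant in the covariance formula below. *)
Definition twist k l : R[i] := cexpi (pi * dotRn (ZnR R k) (ZnR R l)).

Lemma redot_twist k l : redot (twist k l) (twist k l) = 1.
Proof. exact: redot_cexpi. Qed.

Lemma L1_weyl_integrand (f : Rn R n -> R[i]) (z : Rn R n) : L1 mu setT f ->
  L1 mu setT (fun x => f x * cexpi (pi * dotRn x z)).
Proof.
apply: L1_modulated; apply: measurable_funM; first exact: measurable_cst.
by apply: measurable_dotRn; [exact: measurable_id|exact: measurable_cst].
Qed.

(** Covariance.  After the substitution of x + k for x, the phase of the twisted
    translation and the exponential of the Weyl kernel combine into a character
    of frequency k and the exponential at xi + l. *)
Lemma weyl_twisted_translation k l phi xi eta : cmeasurable setT phi ->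
  L1 mu setT (slice phi (subRn eta (addRn (ZnR R l) xi))) ->
  weyl_integral (twisted_translation k l phi) (xi, eta) =
  twist k l * echar k xi * weyl_integral phi (addRn (ZnR R l) xi, eta).
Proof.
move=> mphi Ls; rewrite /weyl_integral /=.
rewrite -[LHS](cintegral_translation (ZnR R k)).
  rewrite -cintegralZ//; last exact: L1_weyl_integrand.
  apply: eq_cintegral => x _; rewrite /twisted_translation /=.
  rewrite (_ : subRn (subRn eta xi) (ZnR R l) = subRn eta (addRn (ZnR R l) xi)).
    rewrite addRnK /twist /echar -!cexpiD.
    rewrite [LHS]mulrAC -cexpiD [RHS]mulrCA mulrC; congr (_ * _).
    rewrite -cexpiD; congr cexpi.
    rewrite !(dotRnDl, dotRnDr, dotRnBl, dotRnBr).
    rewrite (dotRnC eta (ZnR R k)) (dotRnC xi (ZnR R k)).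
    by ring.
  by apply: eq_Rn => i; rewrite !tnth_subRn tnth_addRn; ring.
apply: cmeasurableM.
  apply: cmeasurableM.
    apply: cmeasurable_cexpi; apply: measurable_funM; first exact: measurable_cst.
    apply: measurable_funB; apply: measurable_dotRn; try exact: measurable_id;
      exact: measurable_cst.
  apply: (cmeasurable_comp mphi); apply/measurable_fun_pairP; split.
    by apply: measurable_subRn; [exact: measurable_id|exact: measurable_cst].
  by rewrite /comp /=; exact: measurable_cst.
apply: cmeasurable_cexpi; apply: measurable_funM; first exact: measurable_cst.
by apply: measurable_dotRn; [exact: measurable_id|exact: measurable_cst].
Qed.

End weyl_isometry.

(** * The Weyl kernel on L^2 *)

Section isometry_combinations.
Context d (T : measurableType d) (R : realType).
Variables (mu : {measure set T -> \bar R}) (D : set T).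
Hypothesis mD : measurable D.
Variables (I : Type) (op : I -> (T -> R[i]) -> T -> R[i]).
Hypothesis op_L2 : forall i f, L2 mu D f -> L2 mu D (op i f).
Hypothesis op_nsq : forall i f, L2 mu D f -> nsq mu D (op i f) = nsq mu D f.
Hypothesis op_sub : forall i f g x,
  op i (fun x => f x - g x) x = op i f x - op i g x.

(** The operators op i stand for the twisted translations and for the operators
    on Weyl kernels that correspond to them; both are additive isometries. *)
Definition combination (s : seq (R[i] * I)) (f : T -> R[i]) x : R[i] :=
  \sum_(c <- s) c.1 * op c.2 f x.

Lemma L2_combination s f : L2 mu D f -> L2 mu D (combination s f).
Proof. by move=> Lf; apply: L2_sum => // c; apply: L2Z => //; exact: op_L2. Qed.

Lemma combination_bounded s : exists2 C : R, 0 <= C & forall f, L2 mu D f ->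
  nsq mu D (combination s f) <= C * nsq mu D f.
Proof.
elim: s => [|[c i] s [C C0 ih]].
  exists 0 => // f _; rewrite mul0r nsqE /Rintegral integral0_eq// => x _.
  by rewrite /combination big_nil /redot /= mulr0 addr0.
exists (2 * redot c c + 2 * C).
  by have := redot_ge0 c; lra.
move=> f Lf; rewrite (@eq_nsq _ _ _ _ _ _
  (fun x => c * op i f x + combination s f x)) => [|x _]; last first.
  by rewrite /combination big_cons.
apply: (le_trans (nsqD_le mD (L2Z mD c (op_L2 i Lf)) (L2_combination s Lf))).
rewrite nsqZ//; last exact: op_L2.
by rewrite op_nsq//; have := ih f Lf; lra.
Qed.

Lemma combination_sub s f g x :
  combination s (fun x => f x - g x) x = combination s f x - combination s g x.
Proof.
rewrite /combination -sumrB; apply: eq_bigr => c _.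
by rewrite op_sub mulrBr.
Qed.

Lemma combination_cvg s (f_ : nat -> T -> R[i]) f :
  (forall k, L2 mu D (f_ k)) -> L2 mu D f ->
  (fun k => nsq mu D (fun x => f_ k x - f x)) @ \oo --> (0 : R) ->
  (fun k => nsq mu D (fun x => combination s (f_ k) x - combination s f x)) @ \oo
    --> (0 : R).
Proof.
move=> Lf_ Lf cf; have [C C0 hC] := combination_bounded s.
apply: (@squeeze_cvgr _ _ _ _ (fun=> 0)
  (fun k => C * nsq mu D (fun x => f_ k x - f x))).
- apply: nearW => k; rewrite nsq_ge0 /=.
  apply: le_trans (hC _ (L2B mD (Lf_ k) Lf)).
  by rewrite le_eqVlt; apply/orP; left; apply/eqP; apply: eq_nsq => x _;
    rewrite combination_sub.
- exact: cvg_cst.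
- by rewrite -[X in _ --> X](mulr0 C); apply: cvgM => //; exact: cvg_cst.
Qed.

End isometry_combinations.

Lemma L2cvg_nsq d (T : measurableType d) (R : realType)
    (mu : {measure set T -> \bar R}) (D : set T) (f_ : nat -> T -> R[i]) f :
  measurable D -> (forall k, L2 mu D (f_ k)) -> L2 mu D f ->
  L2cvg mu D f_ f <->
  (fun k => nsq mu D (fun x => f_ k x - f x)) @ \oo --> (0 : R).
Proof.
move=> mD Lf_ Lf; rewrite /L2cvg (_ : (fun j => _) =
    EFin \o (fun k => nsq mu D (fun x => f_ k x - f x))).
  split; first by move=> /fine_cvg.
  by move=> h; apply: cvg_EFin => //; exact: nearW.
by apply/funext => k /=; rewrite L2normsqE//; exact: L2B.
Qed.

Section weyl_kernel_theory.
Context {R : realType} {n : nat}.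
Local Notation mu := (@lebesgue_Rn R n).
Local Notation mu2 := (@lebesgue_R2n R n).
Local Notation index := (Zn n * Zn n)%type.
Implicit Types (phi psi K : Rn R n * Rn R n -> R[i]) (j : index).

Definition shift2 (a b : Rn R n) (p : Rn R n * Rn R n) := (addRn a p.1, addRn b p.2).

Lemma measurable_shift2 a b : measurable_fun setT (shift2 a b).
Proof.
apply/measurable_fun_pairP; split.
  apply: (@measurable_addRn R _ _ n (cst a) fst); last exact: measurable_fst.
  exact: measurable_cst.
apply: (@measurable_addRn R _ _ n (cst b) snd); last exact: measurable_snd.
exact: measurable_cst.
Qed.

(** Functions of the same modulus up to a translation have the same L^1 and
    L^2 sizes; this covers twisted translations and their effect on kernels. *)
Lemma shift_L2 a b phi psi : cmeasurable setT psi ->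
  (forall p, Normc.normc (psi (shift2 a b p)) = Normc.normc (phi p)) ->
  cmeasurable setT phi -> L2normsq mu2 setT psi = L2normsq mu2 setT phi.
Proof.
move=> mpsi h mphi; have m2 := measurable_normc2 mpsi.
rewrite /L2normsq -(integral_R2n_translation a b m2).
  by apply: eq_integral => p _; rewrite -h.
by move=> p; rewrite lee_fin sqr_ge0.
Qed.

Lemma shift_L1 a b phi psi : cmeasurable setT psi ->
  (forall p, Normc.normc (psi (shift2 a b p)) = Normc.normc (phi p)) ->
  L1 mu2 setT phi -> L1 mu2 setT psi.
Proof.
move=> mpsi h [mphi fin]; split => //.
have m2 : measurable_fun setT (fun p => (Normc.normc (psi p))%:E).
  by apply/measurable_EFinP; exact: measurable_normc.
rewrite -(integral_R2n_translation a b m2); last by move=> p; rewrite lee_fin normc_ge0.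
by rewrite (eq_integral (fun p => (Normc.normc (phi p))%:E)) => // p _; rewrite -h.
Qed.

Definition twisted j phi := twisted_translation j.1 j.2 phi.

Lemma cmeasurable_twisted j phi : cmeasurable setT phi -> cmeasurable setT (twisted j phi).
Proof.
move=> mphi; apply: cmeasurableM.
  apply: cmeasurable_cexpi; apply: measurable_funM; first exact: measurable_cst.
  apply: measurable_funB.
    by apply: (@measurable_dotRn R _ _ n fst (cst _)) => //; exact: measurable_cst.
  by apply: (@measurable_dotRn R _ _ n snd (cst _)) => //; exact: measurable_cst.
apply: (cmeasurable_comp mphi); apply/measurable_fun_pairP; split.
  apply: (@measurable_subRn R _ _ n fst (cst _)); first exact: measurable_fst.
  exact: measurable_cst.
apply: (@measurable_subRn R _ _ n snd (cst _)); first exact: measurable_snd.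
exact: measurable_cst.
Qed.

Lemma normc_twisted j phi p :
  Normc.normc (twisted j phi (shift2 (ZnR R j.1) (ZnR R j.2) p)) = Normc.normc (phi p).
Proof.
rewrite /twisted /twisted_translation Normc.normcM normc_cexpi mul1r /shift2.
by rewrite !addRnK; case: p.
Qed.

Lemma L2normsq_twisted j phi : cmeasurable setT phi ->
  L2normsq mu2 setT (twisted j phi) = L2normsq mu2 setT phi.
Proof.
by move=> mphi; exact: (shift_L2 (cmeasurable_twisted j mphi) (normc_twisted j phi) mphi).
Qed.

Lemma L2_twisted j phi : L2 mu2 setT phi -> L2 mu2 setT (twisted j phi).
Proof.
by move=> [mphi fin]; split; [exact: cmeasurable_twisted|rewrite L2normsq_twisted].
Qed.

Lemma nsq_twisted j phi : L2 mu2 setT phi -> nsq mu2 setT (twisted j phi) = nsq mu2 setT phi.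
Proof.
move=> Lphi; apply: EFin_inj; rewrite -!L2normsqE//; last exact: L2_twisted.
by rewrite L2normsq_twisted//; case: Lphi.
Qed.

Lemma L1_twisted j phi : L1 mu2 setT phi -> L1 mu2 setT (twisted j phi).
Proof.
by move=> Lphi; exact: (shift_L1 (cmeasurable_twisted j Lphi.1) (normc_twisted j phi) Lphi).
Qed.

Lemma twisted_sub j phi psi p : twisted j (fun p => phi p - psi p) p = twisted j phi p - twisted j psi p.
Proof. by rewrite /twisted /twisted_translation mulrBr. Qed.

(** By covariance, the operator that a twisted translation induces on kernels. *)
Definition kernel_twist j K p : R[i] :=
  twist j.1 j.2 * echar j.1 p.1 * K (addRn (ZnR R j.2) p.1, p.2).

Lemma add0Rn (x : Rn R n) : addRn (ZnR R (zeroZn n)) x = x.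
Proof. by apply: eq_Rn => i; rewrite tnth_addRn tnth_ZnR tnth_mktuple add0r. Qed.

Lemma normc_kernel_twist j K p : Normc.normc (K (shift2 (ZnR R j.2) (ZnR R (zeroZn n)) p)) =
  Normc.normc (kernel_twist j K p).
Proof.
by rewrite /kernel_twist !Normc.normcM !normc_cexpi !mul1r /shift2 add0Rn.
Qed.

Lemma cmeasurable_kernel_twist j K : cmeasurable setT K -> cmeasurable setT (kernel_twist j K).
Proof.
move=> mK; apply: cmeasurableM.
  apply: cmeasurableZ; apply: (cmeasurable_comp (cmeasurable_echar j.1)).
  exact: measurable_fst.
rewrite (_ : (fun p => _) = (fun p => K (shift2 (ZnR R j.2) (ZnR R (zeroZn n)) p))).
  exact: (cmeasurable_comp mK (measurable_shift2 _ _)).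
by apply/funext => p; rewrite /shift2 add0Rn.
Qed.

Lemma L2normsq_kernel_twist j K : cmeasurable setT K ->
  L2normsq mu2 setT (kernel_twist j K) = L2normsq mu2 setT K.
Proof.
by move=> mK; exact/esym/(shift_L2 mK (normc_kernel_twist j K) (cmeasurable_kernel_twist j mK)).
Qed.

Lemma L2_kernel_twist j K : L2 mu2 setT K -> L2 mu2 setT (kernel_twist j K).
Proof.
by move=> [mK fin]; split; [exact: cmeasurable_kernel_twist|rewrite L2normsq_kernel_twist].
Qed.

Lemma nsq_kernel_twist j K : L2 mu2 setT K -> nsq mu2 setT (kernel_twist j K) = nsq mu2 setT K.
Proof.
move=> LK; apply: EFin_inj; rewrite -!L2normsqE//; last exact: L2_kernel_twist.
by rewrite L2normsq_kernel_twist//; case: LK.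
Qed.

Lemma kernel_twist_sub j phi psi p : kernel_twist j (fun p => phi p - psi p) p = kernel_twist j phi p - kernel_twist j psi p.
Proof. by rewrite /kernel_twist mulrBr. Qed.

(** The slices of an integrable function are integrable for almost every value of
    eta - xi only, so algebraic identities for Weyl kernels hold almost
    everywhere. *)
Lemma ae_weyl_add phi psi : L1 mu2 setT phi -> L1 mu2 setT psi ->
  {ae mu2, forall p, weyl_integral (fun p => phi p + psi p) p =
                     weyl_integral phi p + weyl_integral psi p}.
Proof.
move=> /ae_L1_slice/ae_difference + /ae_L1_slice/ae_difference.
apply: filterS2 => p h1 h2; rewrite /weyl_integral -cintegralD//; last 2 first.
- exact: (L1_weyl_integrand _ h1).
- exact: (L1_weyl_integrand _ h2).
by apply: eq_cintegral => x _; rewrite mulrDl.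
Qed.

Lemma ae_weyl_scale c phi : L1 mu2 setT phi ->
  {ae mu2, forall p, weyl_integral (fun p => c * phi p) p = c * weyl_integral phi p}.
Proof.
move=> /ae_L1_slice/ae_difference; apply: filterS => p h.
rewrite /weyl_integral -cintegralZ//; last exact: (L1_weyl_integrand _ h).
by apply: eq_cintegral => x _; rewrite mulrA.
Qed.

Lemma ae_weyl_sub phi psi : L1 mu2 setT phi -> L1 mu2 setT psi ->
  {ae mu2, forall p, weyl_integral (fun p => phi p - psi p) p =
                     weyl_integral phi p - weyl_integral psi p}.
Proof.
move=> Lphi Lpsi; have := ae_weyl_scale (-1) Lpsi.
have := ae_weyl_add Lphi (L1N measurableT Lpsi); apply: filterS2 => p -> h.
congr (_ + _); rewrite -[RHS]mulN1r -[RHS]h; congr weyl_integral.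
by apply/funext => q; rewrite mulN1r.
Qed.

Lemma ae_weyl_twisted j phi : L1 mu2 setT phi ->
  {ae mu2, forall p, weyl_integral (twisted j phi) p = kernel_twist j (weyl_integral phi) p}.
Proof.
move=> Lphi; have := ae_difference (ae_translate (ZnR R j.2) (ae_L1_slice Lphi)).
apply: filterS => -[xi eta] /= h; apply: weyl_twisted_translation; first by case: Lphi.
move: h; rewrite (_ : subRn (subRn eta xi) _ = subRn eta (addRn (ZnR R j.2) xi))//.
by apply: eq_Rn => i; rewrite !tnth_subRn tnth_addRn; ring.
Qed.

Lemma L1_combination_twisted s phi : L1 mu2 setT phi ->
  L1 mu2 setT (combination twisted s phi).
Proof.
by move=> Lphi; apply: L1_sum => // c; apply: L1Z => //; exact: L1_twisted.
Qed.

Lemma ae_weyl_combination s phi : L1 mu2 setT phi ->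
  {ae mu2, forall p, weyl_integral (combination twisted s phi) p =
                     combination kernel_twist s (weyl_integral phi) p}.
Proof.
move=> Lphi; elim: s => [|[c j] s ih].
  apply: aeW => p; rewrite /combination big_nil /weyl_integral.
  rewrite (@eq_cintegral _ _ _ _ _ _ (fun=> 0)) ?cintegral0// => x _.
  by rewrite big_nil mul0r.
have Lt := L1_twisted j Lphi.
have a1 := ae_weyl_add (L1Z measurableT c Lt) (L1_combination_twisted s Lphi).
have a2 := ae_weyl_scale c Lt; have a3 := ae_weyl_twisted j Lphi.
have a34 : {ae mu2, forall p,
    weyl_integral (twisted j phi) p = kernel_twist j (weyl_integral phi) p /\
    weyl_integral (combination twisted s phi) p =
      combination kernel_twist s (weyl_integral phi) p}.
  by move: a3 ih; apply: filterS2 => p.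
move: a1 a2 a34; apply: filterS3 => p h1 h2 [h3 h4].
rewrite (_ : combination twisted ((c, j) :: s) phi =
  fun p => c * twisted j phi p + combination twisted s phi p); last first.
  by apply/funext => q; rewrite /combination big_cons.
transitivity (c * weyl_integral (twisted j phi) p + weyl_integral (combination twisted s phi) p).
  by rewrite -h2; exact: h1.
by rewrite h3 h4 [RHS]big_cons.
Qed.

Lemma L2_weyl phi : L1 mu2 setT phi -> L2 mu2 setT phi ->
  L2 mu2 setT (weyl_integral phi).
Proof.
move=> L1phi Lphi; split; first by apply: cmeasurable_weyl; case: Lphi.
by rewrite weyl_isometry//; case: Lphi.
Qed.

(** On the intersection of L^1 and L^2 this combines covariance with the isometry
    of the Weyl kernel; the two sides are continuous in phi and in K. *)
Lemma kernel_isometry phi K s : L2 mu2 setT phi -> is_weyl_kernel phi K ->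
  nsq mu2 setT (combination twisted s phi) = nsq mu2 setT (combination kernel_twist s K).
Proof.
move=> Lphi [LK [phi_ [L_ cphi cK]]].
have L1_ k : L1 mu2 setT (phi_ k) by case: (L_ k).
have L2_ k : L2 mu2 setT (phi_ k) by case: (L_ k).
have LW k : L2 mu2 setT (weyl_integral (phi_ k)) by exact: L2_weyl.
have Lt s' psi : L2 mu2 setT psi -> L2 mu2 setT (combination twisted s' psi).
  by apply: L2_combination => // j f; exact: L2_twisted.
have Lk s' psi : L2 mu2 setT psi -> L2 mu2 setT (combination kernel_twist s' psi).
  by apply: L2_combination => // j f; exact: L2_kernel_twist.
apply: (isometry_limit (a_ := fun k => combination twisted s (phi_ k))
  (b_ := fun k => combination kernel_twist s (weyl_integral (phi_ k)))) => //.
- by move=> k; exact: Lt.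
- by move=> k; exact: Lk.
- exact: Lt.
- exact: Lk.
- move=> k; apply: EFin_inj; rewrite -!L2normsqE//; last 2 first.
  + exact: Lk.
  + exact: Lt.
  rewrite -weyl_isometry//; last 2 first.
  + exact: L1_combination_twisted.
  + exact: Lt.
  apply: ae_eq_L2normsq => //.
  + by apply: cmeasurable_weyl; apply: L2_cmeasurable (Lt _ _ _).
  + exact: L2_cmeasurable (Lk _ _ _).
  + by have := ae_weyl_combination s (L1_ k); apply: filterS => p ->.
- apply: combination_cvg => //; [exact: L2_twisted|exact: nsq_twisted|exact: twisted_sub|].
  exact/(L2cvg_nsq measurableT L2_ Lphi).
- apply: combination_cvg => //; [exact: L2_kernel_twist|exact: nsq_kernel_twist|exact: kernel_twist_sub|].
  exact/(L2cvg_nsq measurableT LW LK).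
Qed.

(** The truncations of phi to finitely many cells in both variables are integrable
    and have a Cauchy sequence of kernels, by the isometry. *)
Lemma weyl_kernel_exists phi : L2 mu2 setT phi -> exists K, is_weyl_kernel phi K.
Proof.
move=> Lphi.
pose U N : set (Rn R n * Rn R n) := cells (first_cells N) `*` cells (first_cells N).
have mU N : measurable (U N) by apply: measurableX; exact: measurable_cells.
have fU N : (mu2 (U N) < +oo)%E.
  rewrite /lebesgue_R2n product_measure1E; last 2 first.
  - exact: measurable_cells.
  - exact: measurable_cells.
  have cfin := @cells_finite R n (first_cells N).
  by rewrite lte_mul_pinfty// ge0_fin_numE.
pose phi_ N p := (\1_(U N) p : R)%:C * phi p.
have [L_ c_] : (forall N, L2 mu2 setT (phi_ N)) /\
    (fun N => nsq mu2 setT (fun p => phi_ N p - phi p)) @ \oo --> (0 : R).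
  apply: L2_exhaust => // -[x y].
  have := indic_first_cells (R := R) x; have := indic_first_cells (R := R) y.
  apply: filterS2 => N; rewrite !indicE /U in_setX /=.
  by case: (x \in _) => //; case: (y \in _).
have L1_ N : L1 mu2 setT (phi_ N).
  apply: (L1_of_L2_finite (mU N) (fU N)) => // p Up.
  by rewrite /phi_ indicE memNset// mul0r.
have LW N : L2 mu2 setT (weyl_integral (phi_ N)) by exact: L2_weyl.
have WB N M : nsq mu2 setT (fun p => weyl_integral (phi_ N) p - weyl_integral (phi_ M) p) =
    nsq mu2 setT (fun p => phi_ N p - phi_ M p).
  apply: EFin_inj; rewrite -!L2normsqE//; last 2 first.
  - exact: L2B.
  - exact: L2B.
  rewrite -(weyl_isometry (phi := fun p => phi_ N p - phi_ M p)); last 2 first.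
  - exact: L1B.
  - exact: L2B.
  apply: ae_eq_L2normsq => //.
  - by apply: L2_cmeasurable; exact: L2B.
  - by apply: cmeasurable_weyl; apply: L2_cmeasurable; exact: L2B.
  - by have := ae_weyl_sub (L1_ N) (L1_ M); apply: filterS => p ->.
have [K [LK hK]] : exists K, L2 mu2 setT K /\ forall e : R, 0 < e -> exists N,
    forall k, (N <= k)%N ->
      nsq mu2 setT (fun p => weyl_integral (phi_ k) p - K p) <= e.
  apply: L2_complete => // e e0; have e4 : 0 < e / 4 by rewrite divr_gt0.
  have /cvgrPdist_le/(_ _ e4)[N0 _ hN0] := c_.
  have hN N : (N0 <= N)%N -> nsq mu2 setT (fun p => phi_ N p - phi p) <= e / 4.
    by move=> /hN0; rewrite sub0r normrN ger0_norm ?nsq_ge0.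
  exists N0 => i j Ni Nj; rewrite WB.
  rewrite (le_trans (nsqB_split measurableT (L_ i) Lphi (L_ j)))//.
  by rewrite (nsqBC mu2 setT phi (phi_ j)); have := hN _ Ni; have := hN _ Nj; lra.
exists K; split => //; exists phi_; split => //.
- by apply/(L2cvg_nsq measurableT L_ Lphi).
- apply/(L2cvg_nsq measurableT LW LK)/cvgrPdist_le => e e0.
  have [N hN] := hK e e0; exists N => // k /= /hN.
  by rewrite sub0r normrN ger0_norm ?nsq_ge0.
Qed.

Lemma weyl_kernelP phi : L2 mu2 setT phi -> is_weyl_kernel phi (weyl_kernel phi).
Proof.
by move=> /weyl_kernel_exists[K hK]; exact: (xgetPex (fun=> 0) (ex_intro _ K hK)).
Qed.

End weyl_kernel_theory.

(** * The Zak transform *)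

Lemma ge0_integral_setX d1 d2 (T1 : measurableType d1) (T2 : measurableType d2)
    (R : realType) (m1 : {sigma_finite_measure set T1 -> \bar R})
    (m2 : {sigma_finite_measure set T2 -> \bar R}) (A : set T1) (B : set T2)
    (f : T1 * T2 -> \bar R) : measurable A -> measurable B ->
  measurable_fun setT f -> (forall p, 0 <= f p)%E ->
  (\int[(m1 \x m2)]_(p in A `*` B) f p =
   \int[m1]_(x in A) \int[m2]_(y in B) f (x, y))%E.
Proof.
move=> mA mB mf f0; rewrite integral_mkcond.
rewrite (@fubini_tonelli1 _ _ _ _ R m1 m2)//; last 2 first.
- apply/(measurable_restrictT _ (measurableX mA mB)); exact: measurable_funTS.
- by move=> p; rewrite patchE; case: ifP.
rewrite [RHS]integral_mkcond; apply: eq_integral => x _.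
rewrite /fubini_F patchE; case: ifPn => xA.
  rewrite [RHS]integral_mkcond; apply: eq_integral => y _.
  by rewrite !patchE in_setX xA.
by rewrite integral0_eq// => y _; rewrite patchE in_setX /= (negbTE xA).
Qed.

Section L2sum_algebra.
Context d (T : measurableType d) (R : realType).
Variables (mu : {measure set T -> \bar R}) (D : set T).
Hypothesis mD : measurable D.
Variable I : choiceType.
Implicit Types (z w : I -> T -> R[i]) (Z W : T -> R[i]).

Lemma L2sumD z w Z W : (forall i, L2 mu D (z i)) -> (forall i, L2 mu D (w i)) ->
  L2 mu D Z -> L2 mu D W -> L2sum mu D z Z -> L2sum mu D w W ->
  L2sum mu D (fun i x => z i x + w i x) (fun x => Z x + W x).
Proof.
move=> Lz Lw LZ LW /(L2sumP mD Lz LZ) sz /(L2sumP mD Lw LW) sw.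
apply/L2sumP => //; [by move=> i; exact: L2D|exact: L2D|] => e e0.
have e4 : 0 < e / 4 by rewrite divr_gt0.
have [J1 h1] := sz _ e4; have [J2 h2] := sw _ e4.
exists (J1 `|` J2)%fset => J; rewrite fsubUset => /andP[/h1 + /h2].
rewrite (@eq_nsq _ _ _ _ _ (fun x => \sum_(i <- J) (z i x + w i x) - (Z x + W x))
  (fun x => (\sum_(i <- J) z i x - Z x) + (\sum_(i <- J) w i x - W x))).
  have L1 : L2 mu D (fun x => \sum_(i <- J) z i x - Z x).
    by apply: L2B => //; exact: L2_sum.
  have L2' : L2 mu D (fun x => \sum_(i <- J) w i x - W x).
    by apply: L2B => //; exact: L2_sum.
  by have := nsqD_le mD L1 L2'; lra.
by move=> x _; rewrite big_split /= opprD addrACA.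
Qed.

(** A bijective change of the index permutes the net of finite sets. *)
Lemma L2sum_twist z Z (g : T -> R[i]) (M : R) (s t : I -> I) :
  cmeasurable D g -> (forall x, redot (g x) (g x) = M) -> 0 <= M ->
  cancel s t -> cancel t s -> (forall i, L2 mu D (z i)) -> L2 mu D Z ->
  L2sum mu D z Z -> L2sum mu D (fun i x => g x * z (s i) x) (fun x => g x * Z x).
Proof.
move=> mg gM M0 st ts Lz LZ /(L2sumP mD Lz LZ) sz.
have gM' x : D x -> redot (g x) (g x) <= M by rewrite gM.
apply/L2sumP => //; [by move=> i; exact: L2M gM' (Lz _)|exact: L2M gM' LZ|] => e e0.
have M1 : 0 < M + 1 by lra.
have [|J1 h1] := sz (e / (M + 1)); first by rewrite divr_gt0.
exists [fset t i | i in J1]%fset => J tJ.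
have J1J : (J1 `<=` [fset s i | i in J])%fset.
  apply/fsubsetP => i iJ; apply/imfsetP; exists (t i); last by rewrite ts.
  by apply: (fsubsetP tJ); apply/imfsetP; exists i.
have := h1 _ J1J; rewrite (@eq_nsq _ _ _ _ _ (fun x => \sum_(i <- J) g x * z (s i) x - g x * Z x)
  (fun x => g x * (\sum_(i <- [fset s i | i in J]%fset) z i x - Z x))).
  have L1 : L2 mu D (fun x => \sum_(i <- [fset s i | i in J]%fset) z i x - Z x).
    by apply: L2B => //; exact: L2_sum.
  move=> h; have -> : nsq mu D (fun x => g x *
      (\sum_(i <- [fset s i | i in J]%fset) z i x - Z x)) =
      M * nsq mu D (fun x => \sum_(i <- [fset s i | i in J]%fset) z i x - Z x).
    rewrite nsqE (nsqE _ _ (fun x => _ - _)) -RintegralZl//; last exact: L2_redot.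
    by apply: eq_Rintegral => x _; rewrite redotMM gM.
  move: h; rewrite ltr_pdivlMr// => h.
  have := nsq_ge0 mu D (fun x => \sum_(i <- [fset s i | i in J]%fset) z i x - Z x).
  lra.
move=> x _; rewrite mulrBr big_imfset/=; last by move=> i j _ _; exact: (can_inj st).
by rewrite mulr_sumr.
Qed.

End L2sum_algebra.

Section zak.
Context {R : realType} {n : nat}.
Local Notation mu := (@lebesgue_Rn R n).
Local Notation mu2 := (@lebesgue_R2n R n).
Local Notation mu3 := (@lebesgue_R3n R n).
Local Notation torus := (@torus R n).
Local Notation D3 := (@zak_domain R n).
Local Notation index := (Zn n * Zn n)%type.
Implicit Types (phi K : Rn R n * Rn R n -> R[i]) (m : Zn n) (j : index).

Lemma measurable_zak_domain : measurable D3.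
Proof. by apply: measurableX => //; exact: measurable_torus2. Qed.

Lemma integral_zak_domain (f : Rn R n * Rn R n * Rn R n -> \bar R) :
  measurable_fun setT f -> (forall q, 0 <= f q)%E ->
  (\int[mu3]_(q in D3) f q =
   \int[mu2]_(p in torus `*` torus) \int[mu]_y f (p, y))%E.
Proof.
move=> mf f0; apply: (@ge0_integral_setX _ _ _ _ R mu2 mu) => //.
exact: measurable_torus2.
Qed.

Lemma integral_zak_domain_inner (f : Rn R n * Rn R n * Rn R n -> \bar R) :
  measurable_fun setT f -> (forall q, 0 <= f q)%E ->
  (\int[mu3]_(q in D3) f q =
   \int[mu]_y \int[mu]_(x in torus) \int[mu]_(s in torus) f ((x, s), y))%E.
Proof.
move=> mf f0; rewrite integral_zak_domain//.
rewrite (@integral2_swap _ _ _ _ R mu2 mu)//; last exact: measurable_torus2.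
apply: eq_integral => y _.
apply: (@ge0_integral_setX _ _ _ _ R mu mu torus torus (fun p => f (p, y))) => //.
- exact: measurable_torus.
- exact: measurable_torus.
- by apply: (measurableT_comp mf); exact: measurable_pair2.
Qed.

Definition zak_term K m (q : Rn R n * Rn R n * Rn R n) : R[i] :=
  K (addRn (ZnR R m) q.1.1, q.2) * cexpi (- (2 * pi * dotRn (ZnR R m) q.1.2)).

Lemma cmeasurable_zak_term K m : cmeasurable setT K -> cmeasurable setT (zak_term K m).
Proof.
move=> mK.
have m11 : measurable_fun setT (fun q : Rn R n * Rn R n * Rn R n => q.1.1).
  by apply: measurableT_comp; [exact: measurable_fst|exact: measurable_fst].
have m12 : measurable_fun setT (fun q : Rn R n * Rn R n * Rn R n => q.1.2).
  by apply: measurableT_comp; [exact: measurable_snd|exact: measurable_fst].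
apply: cmeasurableM.
  apply: (cmeasurable_comp mK); apply/measurable_fun_pairP; split.
    apply: (@measurable_addRn R _ _ n (cst _) (fun q => q.1.1)).
      exact: measurable_cst.
    by apply: measurableT_comp; [exact: measurable_fst|exact: measurable_fst].
  exact: measurable_snd.
apply: cmeasurable_cexpi; apply: measurableT_comp => //.
apply: measurable_funM; first exact: measurable_cst.
apply: (@measurable_dotRn R _ _ n (cst _) (fun q => q.1.2)).
  exact: measurable_cst.
by apply: measurableT_comp; [exact: measurable_snd|exact: measurable_fst].
Qed.

Lemma cmeasurableTS d (T : measurableType d) (D : set T) (f : T -> R[i]) :
  cmeasurable setT f -> cmeasurable D f.
Proof. by move=> [f1 f2]; split; exact: measurable_funTS. Qed.

Let measurable_shifted_normc2 K m : cmeasurable setT K ->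
  measurable_fun setT (fun p : Rn R n * Rn R n =>
    ((Normc.normc (K (addRn (ZnR R m) p.1, p.2))) ^+ 2)%:E).
Proof.
move=> mK; apply: measurable_normc2; apply: (cmeasurable_comp mK).
apply/measurable_fun_pairP; split; last exact: measurable_snd.
apply: (@measurable_addRn R _ _ n (cst _) fst); last exact: measurable_fst.
exact: measurable_cst.
Qed.

Let measurable_section_integral (A : set (Rn R n)) (f : Rn R n * Rn R n -> \bar R) :
  measurable A -> measurable_fun setT f -> (forall p, 0 <= f p)%E ->
  measurable_fun setT (fun y => \int[mu]_(x in A) f (x, y))%E.
Proof.
move=> mA mf f0.
have mg : measurable_fun setT (f \_ (A `*` setT)).
  apply/(measurable_restrictT _ (measurableX mA measurableT)).
  exact: measurable_funTS.
have := @measurable_fun_fubini_tonelli_G _ _ _ _ R mu _ mg.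
rewrite (_ : fubini_G _ _ = fun y => \int[mu]_(x in A) f (x, y))%E.
  by apply => p; rewrite patchE; case: ifP.
apply/funext => y; rewrite /fubini_G [RHS]integral_mkcond.
by apply: eq_integral => x _; rewrite !patchE in_setX in_setT andbT.
Qed.

(** Integrating first in the dual variable, where the characters are
    orthonormal, evaluates the square norm of a finite partial sum. *)
Lemma L2normsq_zak_partial K (J : seq (Zn n)) : uniq J -> cmeasurable setT K ->
  L2normsq mu3 D3 (fun q => \sum_(m <- J) zak_term K m q) =
  (\sum_(m <- J) \int[mu]_y \int[mu]_(x in torus)
     ((Normc.normc (K (addRn (ZnR R m) x, y))) ^+ 2)%:E)%E.
Proof.
move=> uJ mK; have mtorus := @measurable_torus R n.
have mS : cmeasurable setT (fun q => \sum_(m <- J) zak_term K m q).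
  by apply: cmeasurable_sum => m; exact: cmeasurable_zak_term.
rewrite /L2normsq integral_zak_domain_inner//; last 2 first.
- exact: measurable_normc2.
- by move=> q; rewrite lee_fin sqr_ge0.
have mKm m := measurable_shifted_normc2 m mK.
transitivity (\int[mu]_y \int[mu]_(x in torus) \sum_(m <- J)
    ((Normc.normc (K (addRn (ZnR R m) x, y))) ^+ 2)%:E)%E.
  apply: eq_integral => y _; apply: eq_integral => x _.
  pose c m := K (addRn (ZnR R m) x, y).
  have Le m : L2 mu torus (echar m).
    apply: (@L2_bounded _ _ _ _ _ mtorus _ _ 1).
    - exact: torus_finite.
    - exact/cmeasurableTS/cmeasurable_echar.
    - by move=> s _; rewrite redot_echar.
  have Lc : L2 mu torus (fun s => \sum_(m <- J) (c m)^* * echar m s).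
    by apply: L2_sum => // m; apply: L2Z.
  transitivity (L2normsq mu torus (fun s => \sum_(m <- J) (c m)^* * echar m s)).
    apply: eq_integral => s _; congr (_%:E); rewrite !normc_redot.
    have -> : \sum_(m <- J) (c m)^* * echar m s =
        (\sum_(m <- J) zak_term K m ((x, s), y))^*.
      rewrite rmorph_sum; apply: eq_bigr => m _ /=.
      by rewrite rmorphM /= -cexpiN opprK.
    rewrite conjCE; case: (\sum_(m <- J) _) => a b; rewrite /redot /=; ring.
  rewrite L2normsqE// nsq_echar_sum// sumEFin; congr (_%:E).
  apply: eq_bigr => m _; rewrite normc_redot conjCE -/(c m).
  by case: (c m) => a b; rewrite /redot /=; ring.
transitivity (\int[mu]_y \sum_(m <- J) \int[mu]_(x in torus)
    ((Normc.normc (K (addRn (ZnR R m) x, y))) ^+ 2)%:E)%E.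
  apply: eq_integral => y _; rewrite ge0_integral_sum//.
  - move=> m; apply: measurable_funTS.
    exact: (measurableT_comp (mKm m) (measurable_pair2 y)).
  - by move=> m x _; rewrite lee_fin sqr_ge0.
rewrite ge0_integral_sum//.
- move=> m; apply: (measurable_section_integral mtorus (mKm m)) => p.
  by rewrite lee_fin sqr_ge0.
- by move=> m y _; apply: integral_ge0 => x _; rewrite lee_fin sqr_ge0.
Qed.

Let cell_energy K m : \bar R := (\int[mu]_y \int[mu]_(x in torus)
     ((Normc.normc (K (addRn (ZnR R m) x, y))) ^+ 2)%:E)%E.

Let cell_energy_ge0 K m : (0 <= cell_energy K m)%E.
Proof.
by apply: integral_ge0 => y _; apply: integral_ge0 => x _; rewrite lee_fin sqr_ge0.
Qed.

Let esum_cell_energy K : cmeasurable setT K ->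
  (\esum_(m in [set: Zn n]) cell_energy K m = L2normsq mu2 setT K)%E.
Proof.
move=> mK; have mK2 := measurable_normc2 mK.
rewrite /L2normsq integral_R2n_swap//; last by move=> p; rewrite lee_fin sqr_ge0.
rewrite -integral_esum//; last 2 first.
- move=> m; apply: (measurable_section_integral measurable_torus (measurable_shifted_normc2 m mK)).
  by move=> p; rewrite lee_fin sqr_ge0.
- by move=> m y; apply: integral_ge0 => x _; rewrite lee_fin sqr_ge0.
apply: eq_integral => y _.
rewrite (integral_tiling (f := fun x => ((Normc.normc (K (x, y))) ^+ 2)%:E))//.
- by apply: (measurableT_comp mK2); exact: measurable_pair2.
- by move=> x; rewrite lee_fin sqr_ge0.
Qed.

Lemma L2_zak_term K m : L2 mu2 setT K -> L2 mu3 D3 (zak_term K m).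
Proof.
move=> [mK fin]; split; first exact/cmeasurableTS/cmeasurable_zak_term.
have := @L2normsq_zak_partial K [:: m] erefl mK.
rewrite (@eq_L2normsq _ _ _ _ _ _ (zak_term K m)) => [->|q _]; last by rewrite big_seq1.
rewrite big_seq1; apply: le_lt_trans fin; rewrite -(esum_cell_energy mK).
by have := @fset_le_esum R _ (cell_energy K) [fset m]%fset (cell_energy_ge0 K);
  rewrite big_seq_fset1.
Qed.

Lemma nsq_zak_partial K (J : seq (Zn n)) : uniq J -> L2 mu2 setT K ->
  (nsq mu3 D3 (fun q => \sum_(m <- J) zak_term K m q))%:E =
  (\sum_(m <- J) cell_energy K m)%E.
Proof.
move=> uJ LK; have mK := LK.1; rewrite -L2normsq_zak_partial// L2normsqE//.
  exact: measurable_zak_domain.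
by apply: L2_sum; [exact: measurable_zak_domain|move=> m; exact: L2_zak_term].
Qed.

Lemma nsq_zak_term K m : L2 mu2 setT K -> (nsq mu3 D3 (zak_term K m))%:E = cell_energy K m.
Proof.
move=> LK; have := @nsq_zak_partial K [:: m] erefl LK.
rewrite big_seq1 => <-; congr (_%:E); apply: eq_nsq => q _.
by rewrite big_seq1.
Qed.

Lemma zak_term_orthogonal K m m' : L2 mu2 setT K -> m != m' ->
  rinner mu3 D3 (zak_term K m) (zak_term K m') = 0.
Proof.
move=> LK mm'; have um : uniq [:: m; m'] by rewrite /= inE mm'.
have E : nsq mu3 D3 (fun q => zak_term K m q + zak_term K m' q) =
    nsq mu3 D3 (zak_term K m) + nsq mu3 D3 (zak_term K m').
  have h := nsq_zak_partial um LK.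
  rewrite big_cons big_seq1 -(nsq_zak_term m LK) -(nsq_zak_term m' LK) in h.
  case: h => <-; apply: eq_nsq => q _.
  by rewrite big_cons big_seq1.
move: E; rewrite nsqD//; first by lra.
- exact: measurable_zak_domain.
- exact: L2_zak_term.
- exact: L2_zak_term.
Qed.

(** The terms of the Zak series are orthogonal, and their energies are those of K
    on the strips (m + [0, 1)^n) x R^n. *)
Lemma zak_isometry K Z : L2 mu2 setT K -> L2 mu3 D3 Z ->
  L2sum mu3 D3 (zak_term K) Z -> nsq mu3 D3 Z = nsq mu2 setT K.
Proof.
move=> LK LZ sZ; have mK := LK.1; apply: EFin_inj.
rewrite -(L2sum_orthogonal_nsq measurable_zak_domain _ _ LZ sZ); last 2 first.
- by move=> m; exact: L2_zak_term.
- by move=> m m'; exact: zak_term_orthogonal.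
rewrite -L2normsqE// -esum_cell_energy//.
by apply: eq_esum => m _; rewrite nsq_zak_term.
Qed.

Lemma zak_exists K : L2 mu2 setT K ->
  exists Z, L2 mu3 D3 Z /\ L2sum mu3 D3 (zak_term K) Z.
Proof.
move=> LK; apply: L2sum_orthogonal_exists.
- exact: measurable_zak_domain.
- by move=> m; exact: L2_zak_term.
- by move=> m m'; exact: zak_term_orthogonal.
- rewrite (eq_esum (b := cell_energy K)); last by move=> m _; rewrite nsq_zak_term.
  by rewrite esum_cell_energy; case: LK.
Qed.

Lemma weyl_zakP phi : L2 mu2 setT phi -> is_weyl_zak phi (weyl_zak phi).
Proof.
move=> Lphi; have [LK _] := weyl_kernelP Lphi.
have [Z hZ] := zak_exists LK.
exact: (xgetPex (fun=> 0) (ex_intro _ Z hZ : exists Z, is_weyl_zak phi Z)).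
Qed.

(** Twisted translations act on Zak transforms as multiplications by these
    unimodular functions of the base point, which are the characters of the
    2n-dimensional torus up to constants. *)
Definition zak_factor j (p : Rn R n * Rn R n) : R[i] := twist j.1 j.2 * echar2 j p.

Lemma redot_zak_factor j p : redot (zak_factor j p) (zak_factor j p) = 1.
Proof. by rewrite redotMM redot_twist redot_echar2 mulr1. Qed.

Lemma cmeasurable_zak_factor j : cmeasurable setT (zak_factor j).
Proof. exact/cmeasurableZ/cmeasurable_echar2. Qed.

(** The translation by j.2 permutes the terms, and the discrepancy between the
    exponentials of m and of m + j.2 is a character of frequency j.2. *)
Lemma zak_term_twist j K m q :
  zak_term (kernel_twist j K) m q = zak_factor j q.1 * zak_term K (addZn m j.2) q.
Proof.
rewrite /zak_term /kernel_twist /zak_factor /echar2 /= echar_period addRnA -ZnR_add.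
rewrite (_ : addZn j.2 m = addZn m j.2); last first.
  by apply: eq_from_tnth => i; rewrite !tnth_mktuple addrC.
have -> : cexpi (- (2 * pi * dotRn (ZnR R m) q.1.2)) = echar j.2 q.1.2 *
    cexpi (- (2 * pi * dotRn (ZnR R (addZn m j.2)) q.1.2)).
  by rewrite /echar -cexpiD; congr cexpi; rewrite ZnR_add dotRnDl; ring.
move: (K _) (cexpi _) (echar _ _) (echar _ _) (twist _ _) => a b c d e.
ring.
Qed.

Lemma L2_zak_factor j Z : L2 mu3 D3 Z -> L2 mu3 D3 (fun q => zak_factor j q.1 * Z q).
Proof.
apply: (@L2M _ _ _ _ _ measurable_zak_domain Z (fun q => zak_factor j q.1) 1).
  apply: cmeasurableTS; apply: (cmeasurable_comp (cmeasurable_zak_factor j)).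
  exact: measurable_fst.
by move=> q _; rewrite redot_zak_factor.
Qed.

Lemma L2sum_kernel_twist j K Z : L2 mu2 setT K -> L2 mu3 D3 Z -> L2sum mu3 D3 (zak_term K) Z ->
  L2sum mu3 D3 (zak_term (kernel_twist j K)) (fun q => zak_factor j q.1 * Z q).
Proof.
move=> LK LZ sZ.
rewrite (_ : zak_term (kernel_twist j K) =
  fun m q => zak_factor j q.1 * zak_term K (addZn m j.2) q); last first.
  by apply/funext => m; apply/funext => q; exact: zak_term_twist.
apply: (@L2sum_twist _ _ _ _ _ measurable_zak_domain _ (zak_term K) Z
  (fun q => zak_factor j q.1) 1 (fun m => addZn m j.2) (fun m => addZn m (oppZn j.2))) => //.
- apply: cmeasurableTS; apply: (cmeasurable_comp (cmeasurable_zak_factor j)).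
  exact: measurable_fst.
- by move=> q; exact: redot_zak_factor.
- by move=> m; apply: eq_from_tnth => i; rewrite !tnth_mktuple addrK.
- by move=> m; apply: eq_from_tnth => i; rewrite !tnth_mktuple subrK.
- by move=> m; exact: L2_zak_term.
Qed.

Definition zak_combination (s : seq (R[i] * index)) (p : Rn R n * Rn R n) : R[i] :=
  \sum_(c <- s) c.1 * zak_factor c.2 p.

Lemma L2_zak_combination s Z : L2 mu3 D3 Z ->
  L2 mu3 D3 (fun q => zak_combination s q.1 * Z q).
Proof.
move=> LZ; apply: (@eq_L2 _ _ _ _ _
    (fun q => \sum_(c <- s) c.1 * (zak_factor c.2 q.1 * Z q))).
  by move=> q _; rewrite mulr_suml; apply: eq_bigr => c _; rewrite mulrA.
apply: L2_sum; first exact: measurable_zak_domain.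
by move=> c; apply: L2Z; [exact: measurable_zak_domain|exact: L2_zak_factor].
Qed.

Lemma L2sum_combination s K Z : L2 mu2 setT K -> L2 mu3 D3 Z ->
  L2sum mu3 D3 (zak_term K) Z ->
  L2sum mu3 D3 (zak_term (combination kernel_twist s K)) (fun q => zak_combination s q.1 * Z q).
Proof.
move=> LK LZ sZ; have mD3 := measurable_zak_domain.
have Lk s' : L2 mu2 setT (combination kernel_twist s' K).
  by apply: L2_combination => // j f; exact: L2_kernel_twist.
elim: s => [|[c j] s ih].
  move=> e e0; exists fset0 => J _.
  rewrite (@eq_L2normsq _ _ _ _ _ _ (fun=> 0)).
    by rewrite L2normsqE ?nsqE//; [rewrite /Rintegral integral0_eq//= => x _;
      rewrite /redot /= mulr0 addr0|exact: L2_0].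
  move=> q _; rewrite /zak_combination big_nil mul0r subr0 big1// => m _.
  by rewrite /zak_term /combination big_nil mul0r.
rewrite (_ : zak_term _ = fun m q => c * zak_term (kernel_twist j K) m q +
    zak_term (combination kernel_twist s K) m q); last first.
  apply/funext => m; apply/funext => q.
  by rewrite /zak_term /combination big_cons mulrDl mulrA.
rewrite (_ : (fun q => _) = fun q => c * (zak_factor j q.1 * Z q) +
    zak_combination s q.1 * Z q); last first.
  by apply/funext => q; rewrite /zak_combination big_cons mulrDl mulrA.
have Lj := L2_kernel_twist j LK.
apply: L2sumD => //.
- by move=> m; apply: L2Z => //; exact: L2_zak_term.
- by move=> m; apply: L2_zak_term.
- by apply: L2Z => //; exact: L2_zak_factor.
- exact: L2_zak_combination.
apply: (@L2sum_twist _ _ _ _ _ mD3 _ (zak_term (kernel_twist j K)) _ (fun=> c) (redot c c) id id) => //.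
- exact: redot_ge0.
- by move=> m; exact: L2_zak_term.
- exact: L2_zak_factor.
- exact: L2sum_kernel_twist.
Qed.

(** The passage to kernels and the Zak transform are both isometric, and together
    they turn twisted translations into multiplications. *)
Lemma zak_combination_isometry phi s : L2 mu2 setT phi ->
  nsq mu2 setT (combination twisted s phi) =
  nsq mu3 D3 (fun q => zak_combination s q.1 * weyl_zak phi q).
Proof.
move=> Lphi; have hK := weyl_kernelP Lphi; have [LZ sZ] := weyl_zakP Lphi.
rewrite (kernel_isometry s Lphi hK).
rewrite (@zak_isometry (combination kernel_twist s (weyl_kernel phi)) _ _ _ (L2sum_combination s hK.1 LZ sZ))//.
  by apply: L2_combination => //; [move=> j f; exact: L2_kernel_twist|exact: hK.1].
exact: L2_zak_combination.
Qed.

End zak.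

(** * Frame bounds on closed spans *)

Section convergence.
Context d (T : measurableType d) (R : realType).
Variables (mu : {measure set T -> \bar R}) (D : set T).
Hypothesis mD : measurable D.

Lemma cvg_nsq_small (f_ : nat -> T -> R[i]) :
  (forall k, nsq mu D (f_ k) <= (2^-1) ^+ k) ->
  (fun k => nsq mu D (f_ k)) @ \oo --> (0 : R).
Proof.
move=> small; apply: (@squeeze_cvgr _ _ _ _ (fun=> 0) (fun k => (2^-1 : R) ^+ k)).
- by apply: nearW => k; rewrite nsq_ge0 small.
- exact: cvg_cst.
- by apply: cvg_expr; rewrite ger0_norm ?invr_ge0// invf_lt1 ?ltr1n.
Qed.

Lemma rinner_cvg (f_ : nat -> T -> R[i]) f g : (forall k, L2 mu D (f_ k)) ->
  L2 mu D f -> L2 mu D g ->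
  (fun k => nsq mu D (fun x => f_ k x - f x)) @ \oo --> (0 : R) ->
  (fun k => rinner mu D (f_ k) g) @ \oo --> rinner mu D f g.
Proof.
move=> Lf_ Lf Lg cf; apply/cvgrPdist_le => e e0.
have N0 : 0 < nsq mu D g + 1 by have := nsq_ge0 mu D g; lra.
have e1 : 0 < e ^+ 2 / (nsq mu D g + 1) by rewrite divr_gt0// exprn_gt0.
move: cf => /cvgrPdist_le/(_ _ e1); apply: filterS => k.
rewrite sub0r normrN ger0_norm ?nsq_ge0// => hk.
rewrite distrC -rinnerBl// -(@ler_pXn2r _ 2)// ?nnegrE ?normr_ge0 ?(ltW e0)//.
rewrite real_normK ?num_real//.
have LB := L2B mD (Lf_ k) Lf.
apply: (le_trans (rinner_CS mD LB Lg)).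
rewrite ler_pdivlMr// in hk; apply: le_trans hk.
by rewrite ler_wpM2l ?nsq_ge0//; lra.
Qed.

Lemma coefficient_cvg (f_ : nat -> T -> R[i]) f g : (forall k, L2 mu D (f_ k)) ->
  L2 mu D f -> L2 mu D g ->
  (fun k => nsq mu D (fun x => f_ k x - f x)) @ \oo --> (0 : R) ->
  (fun k => Normc.normc (L2inner mu D (f_ k) g) ^+ 2) @ \oo -->
    Normc.normc (L2inner mu D f g) ^+ 2.
Proof.
move=> Lf_ Lf Lg cf; rewrite L2inner_normc2.
rewrite (_ : (fun k => _) = fun k => rinner mu D (f_ k) g ^+ 2 +
  rinner mu D (f_ k) (fun x => 'i * g x) ^+ 2); last first.
  by apply/funext => k; rewrite L2inner_normc2.
have sq (u : nat -> R) (l : R) : u @ \oo --> l -> (fun k => u k ^+ 2) @ \oo --> l ^+ 2.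
  by move=> ul; rewrite expr2; under eq_fun do rewrite expr2; exact: cvgM.
by apply: cvgD; apply: sq; apply: rinner_cvg => //; exact: L2Z.
Qed.

End convergence.

(** Coefficients with equal indices are added up; J and c depend on s only, so
    they serve several families at once. *)
Lemma lincomb_by_index (R : realType) (I : choiceType) (s : seq (R[i] * I)) :
  exists (J : {fset I}) (c : I -> R[i]),
  forall d (T : measurableType d) (f : I -> T -> R[i]) x,
    lincomb f s x = \sum_(j <- J) c j * f j x.
Proof.
exists [fset j in map snd s]%fset, (fun j => \sum_(p <- s | p.2 == j) p.1).
move=> d T f x.
under eq_bigr do rewrite mulr_suml big_mkcond.
rewrite exchange_big /= /lincomb big_seq [RHS]big_seq; apply: eq_bigr => p ps.
have pJ : p.2 \in [fset j in map snd s]%fset by rewrite inE; exact: map_f.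
rewrite (bigD1_seq p.2)//= eqxx big1 ?addr0// => j jp.
by rewrite eq_sym (negbTE jp).
Qed.

Section frame_closure.
Context d (T : measurableType d) (R : realType).
Variables (mu : {measure set T -> \bar R}) (D : set T).
Hypothesis mD : measurable D.
Variables (I : choiceType) (f : I -> T -> R[i]).
Hypothesis Lf : forall i, L2 mu D (f i).

Local Notation F := (lincomb f).
Local Notation energy g j := (Normc.normc (L2inner mu D g (f j)) ^+ 2).

Lemma L2_lincomb s : L2 mu D (F s).
Proof. by apply: L2_sum => // p; exact: L2Z. Qed.

Lemma lincomb_fset (J : {fset I}) (c : I -> R[i]) x :
  F [seq (c j, j) | j <- J] x = \sum_(j <- J) c j * f j x.
Proof. by rewrite /lincomb big_map. Qed.

Lemma lincomb_closed_span s : L2closed_span mu D f (F s).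
Proof.
split => [|e e0]; first exact: L2_lincomb.
have [J [c h]] := lincomb_by_index s; exists J, c.
rewrite (@eq_L2normsq _ _ _ _ _ _ (fun=> 0)) => [|x _]; last by rewrite h subrr.
rewrite L2normsqE//; last exact: L2_0.
rewrite nsqE lte_fin /Rintegral integral0_eq//= => x _.
by rewrite /redot /= mulr0 addr0.
Qed.

Lemma closed_span_approx h : L2closed_span mu D f h ->
  exists s_ : nat -> seq (R[i] * I),
    (fun k => nsq mu D (fun x => F (s_ k) x - h x)) @ \oo --> (0 : R).
Proof.
move=> [Lh hh].
have step k : exists s, nsq mu D (fun x => F s x - h x) <= 2^-1 ^+ k.
  have [|J [c hJ]] := hh (2^-1 ^+ k); first by rewrite exprn_gt0// invr_gt0.
  exists [seq (c j, j) | j <- J]; rewrite nsqBC.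
  have LS := L2_lincomb [seq (c j, j) | j <- J].
  rewrite -lee_fin -L2normsqE//; last exact: L2B.
  apply/ltW; rewrite (@eq_L2normsq _ _ _ _ _ _
    (fun x => h x - \sum_(j <- J) c j * f j x))// => x _.
  by rewrite lincomb_fset.
exists (fun k => sval (cid (step k))); apply: cvg_nsq_small => // k.
exact: svalP (cid (step k)).
Qed.

Lemma bessel_limit (B : R) (s_ : nat -> seq (R[i] * I)) h (J : {fset I}) :
  (forall s (J : {fset I}), \sum_(j <- J) energy (F s) j <= B * nsq mu D (F s)) ->
  L2 mu D h ->
  (fun k => nsq mu D (fun x => F (s_ k) x - h x)) @ \oo --> (0 : R) ->
  \sum_(j <- J) energy h j <= B * nsq mu D h.
Proof.
move=> hB Lh ch.
have LF k := L2_lincomb (s_ k).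
have cE j : (fun k => energy (F (s_ k)) j) @ \oo --> energy h j.
  exact: coefficient_cvg.
have cS : (fun k => \sum_(j <- J) energy (F (s_ k)) j) @ \oo -->
    \sum_(j <- J) energy h j.
  elim: (J : seq I) => [|j t ih].
    by under eq_fun do rewrite big_nil; rewrite big_nil; exact: cvg_cst.
  by under eq_fun do rewrite big_cons; rewrite big_cons; exact: cvgD.
have cN : (fun k => B * nsq mu D (F (s_ k))) @ \oo --> B * nsq mu D h.
  by apply: cvgMl_tmp; exact: nsq_cvg.
rewrite -(cvg_lim _ cS)// -(cvg_lim _ cN)//.
apply: ler_lim; [exact: cvgP cS|exact: cvgP cN|].
by apply: nearW => k.
Qed.

(** The difference F s - h is again a limit of linear combinations. *)
Lemma bessel_sub_limit (B : R) (s_ : nat -> seq (R[i] * I)) s h (J : {fset I}) :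
  (forall s (J : {fset I}), \sum_(j <- J) energy (F s) j <= B * nsq mu D (F s)) ->
  L2 mu D h ->
  (fun k => nsq mu D (fun x => F (s_ k) x - h x)) @ \oo --> (0 : R) ->
  \sum_(j <- J) energy (fun x => F s x - h x) j <=
    B * nsq mu D (fun x => F s x - h x).
Proof.
move=> hB Lh ch; have Ls := L2_lincomb s.
pose t k := s ++ [seq (- p.1, p.2) | p <- s_ k].
have tE k x : F (t k) x = F s x - F (s_ k) x.
  rewrite /lincomb big_cat big_map -sumrN; congr (_ + _).
  by apply: eq_bigr => p _; rewrite mulNr.
apply: (@bessel_limit B t) => //; first exact: L2B.
rewrite (_ : (fun k => _) = fun k => nsq mu D (fun x => F (s_ k) x - h x))//.
apply/funext => k; rewrite nsqBC; apply: eq_nsq => x _.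
by rewrite tE; ring.
Qed.

(** Young's inequality: the difference of both sides is |r z - w|^2 / r. *)
Let redotD_weighted (z w : R[i]) (r : R) : 0 < r ->
  redot (z + w) (z + w) <= (1 + r) * redot z z + (1 + r^-1) * redot w w.
Proof.
move=> r0; case: z => a b; case: w => c e; rewrite /redot /= -subr_ge0.
have -> : (1 + r) * (a * a + b * b) + (1 + r^-1) * (c * c + e * e) -
    ((a + c) * (a + c) + (b + e) * (b + e)) =
    r^-1 * ((r * a - c) ^+ 2 + (r * b - e) ^+ 2).
  by field; rewrite gt_eqF.
by rewrite mulr_ge0 ?invr_ge0 ?(ltW r0)// addr_ge0// sqr_ge0.
Qed.

(** The frame inequalities pass from finite linear combinations to their
    closure: the upper one because each finite part of the coefficient energy is
    L2-continuous, the lower one because, thanks to the upper one, so is the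
    whole energy. *)
Lemma frame_bounds_closure (A B : R) : 0 <= A ->
  (forall s (J : {fset I}), \sum_(j <- J) energy (F s) j <= B * nsq mu D (F s)) ->
  (forall s, ((A * nsq mu D (F s))%:E <=
     \esum_(j in [set: I]) (energy (F s) j)%:E)%E) ->
  forall h, L2closed_span mu D f h ->
    (A%:E * L2normsq mu D h <= \esum_(j in [set: I]) (energy h j)%:E)%E /\
    (\esum_(j in [set: I]) (energy h j)%:E <= B%:E * L2normsq mu D h)%E.
Proof.
move=> A0 hB hA h hh; have Lh := hh.1; have [s_ cs] := closed_span_approx hh.
have e0 g j : (0 <= (energy g j)%:E)%E by rewrite lee_fin sqr_ge0.
have upper : (\esum_(j in [set: I]) (energy h j)%:E <= (B * nsq mu D h)%:E)%E.
  by apply: esum_le_fset => J; rewrite sumEFin lee_fin; exact: (bessel_limit _ hB Lh cs).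
rewrite L2normsqE// -!EFinM; split => //.
have S0 : (0 <= \esum_(j in [set: I]) (energy h j)%:E)%E by exact: esum_ge0.
case ES : (\esum_(j in [set: I]) (energy h j)%:E)%E S0 upper => [S| |]//.
rewrite !lee_fin => S0 _.
have weighted (r : R) : 0 < r -> A * nsq mu D h <= (1 + r) * S.
  move=> r0; pose c := 1 + r^-1.
  have c0 : 0 <= c by rewrite addr_ge0// invr_ge0 ltW.
  have step k : A * nsq mu D (F (s_ k)) <=
      (1 + r) * S + c * B * nsq mu D (fun x => F (s_ k) x - h x).
    rewrite -lee_fin; apply: (le_trans (hA _)); apply: esum_le_fset => J.
    rewrite sumEFin lee_fin.
    apply: (@le_trans _ _ (\sum_(j <- J) ((1 + r) * energy h j +
        c * energy (fun x => F (s_ k) x - h x) j))).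
      apply: ler_sum => j _; rewrite !normc_redot.
      have -> : L2inner mu D (F (s_ k)) (f j) = L2inner mu D h (f j) +
          L2inner mu D (fun x => F (s_ k) x - h x) (f j).
        have LF := L2_lincomb (s_ k).
        by rewrite L2innerBl// addrC subrK.
      exact: redotD_weighted.
    rewrite big_split -!mulr_sumr lerD//.
      rewrite ler_wpM2l//; first by lra.
      rewrite -lee_fin -ES -sumEFin.
      exact: (@fset_le_esum R _ (fun j => (energy h j)%:E)).
    by rewrite -mulrA ler_wpM2l//; exact: (bessel_sub_limit _ _ hB Lh cs).
  have c1 : (fun k => A * nsq mu D (F (s_ k))) @ \oo --> A * nsq mu D h.
    by apply: cvgMl_tmp; apply: nsq_cvg => // k; exact: L2_lincomb.
  have c2 : (fun k => (1 + r) * S + c * B * nsq mu D (fun x => F (s_ k) x - h x))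
      @ \oo --> (1 + r) * S + c * B * 0.
    by apply: cvgD; [exact: cvg_cst|exact: cvgMl_tmp].
  rewrite mulr0 addr0 in c2.
  by apply: (ler_cvg_to c1 c2); exact: nearW.
apply/ler_addgt0Pr => e e_gt0.
have S1 : 0 < S + 1 by lra.
have := weighted (e / (S + 1)) (divr_gt0 e_gt0 S1).
move=> /le_trans; apply; rewrite mulrDl mul1r lerD2l mulrAC ler_pdivrMr//.
by rewrite ler_wpM2l ?(ltW e_gt0)//; lra.
Qed.

End frame_closure.

(** * Frames isometric to weighted characters *)

(** Tested on the set where h is negative. *)
Lemma ae_ge0_of_Rintegral d (T : measurableType d) (R : realType)
    (mu : {measure set T -> \bar R}) (D : set T) (h : T -> R) : measurable D ->
  mu.-integrable D (EFin \o h) ->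
  (forall E, measurable E -> 0 <= \int[mu]_(x in D) (\1_E x * h x)) ->
  {ae mu, forall x, D x -> 0 <= h x}.
Proof.
move=> mD ih hE; have mh : measurable_fun D h.
  exact/measurable_EFinP/(measurable_int mu ih).
pose E := D `&` h @^-1` `]-oo, 0[.
have mE : measurable E by exact: mh.
have m1 : measurable_fun D (fun x => \1_E x * h x).
  by apply: measurable_funM => //; exact: measurable_indic.
have i1 : mu.-integrable D (EFin \o (fun x => \1_E x * h x)).
  apply: le_integrable ih => //; first exact/measurable_EFinP.
  move=> x _; rewrite /= lee_fin normrM ler_piMl// indicE.
  by case: (_ \in _); rewrite /= ?normr0 ?normr1.
have neg x : \1_E x * h x <= 0.
  rewrite indicE; case: (boolP (x \in E)); rewrite ?mul0r// inE => -[_].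
  by rewrite /= in_itv /= mul1r => /ltW.
have : (\int[mu]_(x in D) `|(EFin \o (fun x => (\1_E x * h x)%R)) x| = 0)%E.
  rewrite (eq_integral (fun x => (- (EFin \o (fun x => (\1_E x * h x)%R)) x)%E));
    last by move=> x _ /=; rewrite ler0_norm.
  apply/eqP; rewrite eq_le; apply/andP; split; last first.
    by apply: integral_ge0 => x _; rewrite /= lee_fin oppr_ge0.
  rewrite integralN; last first.
    by apply: (integrable_add_def mD); exact: i1.
  rewrite leeNl oppe0; have := hE E mE; rewrite /Rintegral.
  by rewrite -lee_fin fineK//; exact: integrable_fin_num.
move/(ae_eq_integral_abs mu mD ((measurable_EFinP _ _).2 m1)).
apply: filterS => x hx Dx; rewrite leNgt; apply/negP => hx0.
have := hx Dx; rewrite /= => -[]; rewrite indicE mem_set ?mul1r; last first.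
  by split => //; rewrite /= in_itv.
by move=> /eqP; rewrite lt_eqF.
Qed.

Lemma eq_nsq_ae d (T : measurableType d) (R : realType)
    (mu : {measure set T -> \bar R}) (D : set T) (f g : T -> R[i]) :
  measurable D -> L2 mu D f -> cmeasurable D g ->
  {ae mu, forall x, D x -> f x = g x} -> L2 mu D g /\ nsq mu D f = nsq mu D g.
Proof.
move=> mD Lf mg fg; have E := ae_eq_L2normsq mD Lf.1 mg fg.
have Lg : L2 mu D g by split; [|rewrite -E; case: Lf].
by split => //; apply: EFin_inj; rewrite -!L2normsqE.
Qed.

Lemma nsq_mono d (T : measurableType d) (R : realType)
    (mu : {measure set T -> \bar R}) (D : set T) (f g : T -> R[i]) (a b : R) :
  measurable D -> L2 mu D f -> L2 mu D g ->
  (forall x, D x -> a * redot (f x) (f x) <= b * redot (g x) (g x)) ->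
  a * nsq mu D f <= b * nsq mu D g.
Proof.
move=> mD Lf Lg fg; have If := L2_redot_self Lf; have Ig := L2_redot_self Lg.
rewrite !nsqE -!RintegralZl//; apply: le_Rintegral => //; exact: integrable_scale.
Qed.

(** A converse to the monotonicity of integrals: the difference of the densities
    has a nonnegative integral over every measurable set. *)
Lemma ae_redot_le d (T : measurableType d) (R : realType)
    (mu : {measure set T -> \bar R}) (D : set T) (a b : T -> R[i]) (p q : R) :
  measurable D -> L2 mu D a -> L2 mu D b ->
  (forall E, measurable E -> p * nsq mu D (fun x => (\1_E x)%:C * a x) <=
     q * nsq mu D (fun x => (\1_E x)%:C * b x)) ->
  {ae mu, forall x, D x -> p * redot (a x) (a x) <= q * redot (b x) (b x)}.
Proof.
move=> mD La Lb hab.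
pose h x := q * redot (b x) (b x) - p * redot (a x) (a x).
have iscale r u : L2 mu D u ->
    mu.-integrable D (EFin \o (fun x => r * redot (u x) (u x))).
  by move=> Lu; apply: integrable_scale => //; exact: L2_redot_self.
have ih : mu.-integrable D (EFin \o h).
  rewrite (_ : _ \o _ = (fun x => (q * redot (b x) (b x))%:E -
      (p * redot (a x) (a x))%:E)%E)//.
  by apply: integrableB => //; exact: iscale.
have : {ae mu, forall x, D x -> 0 <= h x}.
  apply: ae_ge0_of_Rintegral => // E mE.
  have L1E u : L2 mu D u -> L2 mu D (fun x => (\1_E x)%:C * u x).
    apply: (@L2M _ _ _ _ _ mD u (fun x => (\1_E x)%:C) 1).
      by apply: cmeasurable_real => //; exact: measurable_indic.
    by move=> x _; rewrite redot_real indicE; case: (_ \in _); rewrite ?expr1n ?expr0n.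
  rewrite (@eq_Rintegral _ _ _ _ _
    (fun x => q * redot ((\1_E x)%:C * b x) ((\1_E x)%:C * b x) -
      p * redot ((\1_E x)%:C * a x) ((\1_E x)%:C * a x))).
    rewrite RintegralB//; [|exact/iscale/L1E..].
    rewrite !RintegralZl//; [|exact/L2_redot_self/L1E..].
    by rewrite subr_ge0 -!nsqE; exact: hab.
  move=> x _; rewrite !redotMM redot_real /h indicE.
  by case: (_ \in _); rewrite ?expr1n ?expr0n /=; ring.
by apply: filterS => x hx Dx; rewrite -subr_ge0; exact: hx.
Qed.

Section weights.
Context d (T : measurableType d) (R : realType).
Variables (mu : {measure set T -> \bar R}) (D : set T).
Hypothesis mD : measurable D.

Definition weight (w : T -> R) :=
  [/\ measurable_fun D w, forall x, D x -> 0 <= w x & mu.-integrable D (EFin \o w)].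

Definition sqrt_weight (w : T -> R) x : R[i] := (Num.sqrt (w x))%:C.

Lemma redot_sqrt_weight w x : weight w -> D x ->
  redot (sqrt_weight w x) (sqrt_weight w x) = w x.
Proof. by move=> [_ w0 _] Dx; rewrite redot_real sqr_sqrtr// w0. Qed.

Lemma cmeasurable_sqrt_weight w : weight w -> cmeasurable D (sqrt_weight w).
Proof.
move=> [mw _ _]; apply: cmeasurable_real => //.
apply: measurableT_comp mw; apply: continuous_measurable_fun.
exact: sqrt_continuous.
Qed.

Lemma L2_sqrt_weight w : weight w -> L2 mu D (sqrt_weight w).
Proof.
move=> ww; have [_ _ iw] := ww.
apply: (L2_dominated mD (cmeasurable_sqrt_weight ww) iw) => x Dx.
by rewrite redot_sqrt_weight.
Qed.

(** Replacing the values outside S by 0 turns an almost everywhere bound into a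
    pointwise one. *)
Lemma weight_clip w (S : set R) : weight w -> measurable S ->
  {ae mu, forall x, D x -> w x != 0 -> S (w x)} ->
  exists w', [/\ weight w', forall x, D x -> w' x != 0 -> S (w' x) &
    {ae mu, forall x, D x -> w x = w' x}].
Proof.
move=> [mw w0 iw] mS aeS.
pose E := D `&` w @^-1` S; have mE : measurable E by exact: mw.
have le x : D x -> 0 <= \1_E x * w x <= w x.
  move=> Dx; rewrite indicE; have := w0 _ Dx.
  by case: (_ \in _); rewrite ?mul1r ?mul0r /= lexx => ->.
have m' : measurable_fun D (fun x => \1_E x * w x).
  by apply: measurable_funM => //; exact: measurable_indic.
exists (fun x => \1_E x * w x); split.
- split => //; first by move=> x /le /andP[].
  apply: le_integrable iw => //; first exact/measurable_EFinP.
  move=> x Dx /=; have /andP[h0 h1] := le x Dx.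
  by rewrite lee_fin !ger0_norm// w0.
- move=> x Dx; rewrite indicE; case: (boolP (x \in E)); rewrite ?mul0r ?eqxx//.
  by rewrite inE => -[_ Sx]; rewrite mul1r.
- move: aeS; apply: filterS => x hx Dx; rewrite indicE.
  case: (eqVneq (w x) 0) => [->|wx]; first by rewrite mulr0.
  by rewrite mem_set ?mul1r//; split => //; exact: hx.
Qed.

End weights.

Section weighted_frames.
Context d d' (T : measurableType d) (T' : measurableType d') (R : realType).
Variables (mu : {measure set T -> \bar R}) (D : set T).
Variables (mu' : {measure set T' -> \bar R}) (D' : set T').
Hypotheses (mD : measurable D) (mD' : measurable D') (muD : (mu D < +oo)%E).
Variables (I : countType) (g : I -> T -> R[i]) (f : I -> T' -> R[i]).
Hypothesis mg : forall i, cmeasurable D (g i).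
Hypothesis g_unit : forall i x, redot (g i x) (g i x) = 1.
Hypothesis g_orthonormal : forall i j, L2inner mu D (g i) (g j) = (i == j)%:R.
Hypothesis g_parseval : forall u, L2 mu D u ->
  \esum_(i in [set: I]) ((Normc.normc (L2inner mu D u (g i))) ^+ 2)%:E =
  (nsq mu D u)%:E.
Hypothesis g_dense : forall s E (r : R), L2 mu D s -> measurable E -> 0 < r ->
  exists t, nsq mu D (fun x => ((\1_E x)%:C - lincomb g t x) * s x) <= r.
Hypothesis Lf : forall i, L2 mu' D' (f i).

Local Notation F := (lincomb f).
Local Notation G := (lincomb g).
Local Notation weight := (weight mu D).
Local Notation energy u j := (Normc.normc (L2inner mu' D' u (f j)) ^+ 2).
Implicit Types (w : T -> R) (s t : seq (R[i] * I)).

(** By polarization, f has the same Gram matrix as the family g weighted by the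
    square root of w. *)
Definition isometric w :=
  forall s, nsq mu' D' (F s) = nsq mu D (fun x => G s x * sqrt_weight w x).

Lemma L2_lincomb_weight s (u : T -> R[i]) : L2 mu D u -> L2 mu D (fun x => G s x * u x).
Proof.
have [M _ hM] := lincomb_bounded g_unit s.
by apply: (L2M mD) => //; exact: cmeasurable_lincomb.
Qed.

Lemma isometric_ae w w' : weight w -> weight w' -> isometric w ->
  {ae mu, forall x, D x -> w x = w' x} -> isometric w'.
Proof.
move=> ww ww' iw e s; rewrite iw.
have L u : weight u -> L2 mu D (fun x => G s x * sqrt_weight u x).
  by move=> wu; apply: L2_lincomb_weight; exact: L2_sqrt_weight.
apply: (eq_nsq_ae mD (L _ ww) (L _ ww').1 _).2.
by move: e; apply: filterS => x hx Dx; rewrite /sqrt_weight hx.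
Qed.

Lemma inner_isometric w s t : weight w -> isometric w ->
  rinner mu' D' (F s) (F t) = rinner mu D
    (fun x => G s x * sqrt_weight w x) (fun x => G t x * sqrt_weight w x).
Proof.
move=> ww iw; have Lw := L2_sqrt_weight mD ww.
have Lh := L2_lincomb mD' Lf; have LG u := L2_lincomb_weight u Lw.
have := iw (s ++ t).
rewrite (@eq_nsq _ _ _ _ _ _ (fun x => F s x + F t x)) => [|x _]; last exact: lincomb_cat.
rewrite [RHS](@eq_nsq _ _ _ _ _ _ (fun x => G s x * sqrt_weight w x +
    G t x * sqrt_weight w x)) => [|x _]; last by rewrite lincomb_cat mulrDl.
by rewrite !nsqD// !iw; lra.
Qed.

(** Both square roots of w go to the first factor: the coefficients of F s are the
    Fourier coefficients of G s * w. *)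
Lemma coefficient_isometric w s j : weight w -> isometric w ->
  L2inner mu' D' (F s) (f j) = L2inner mu D (fun x => G s x * (w x)%:C) (g j).
Proof.
move=> ww iw.
have -> : L2inner mu D (fun x => G s x * (w x)%:C) (g j) =
    L2inner mu D (fun x => G s x * sqrt_weight w x) (fun x => g j x * sqrt_weight w x).
  rewrite /L2inner; congr (_ +i* _); apply: eq_Rintegral => x; rewrite inE => Dx;
    rewrite -(redot_sqrt_weight ww Dx) redot_real /sqrt_weight;
    move: (G s x) (g j x) (Num.sqrt _) => [a b] [c e] v; rewrite conjCE /=; ring.
rewrite !L2innerE; congr (_ +i* _).
  rewrite (@eq_rinner _ _ _ _ _ _ (F s) _ (F [:: (1, j)]))//; last first.
    by move=> x _; rewrite /lincomb big_seq1 mul1r.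
  rewrite (inner_isometric _ _ ww iw); apply: eq_rinner => // x _.
  by rewrite /lincomb big_seq1 mul1r.
rewrite (@eq_rinner _ _ _ _ _ _ (F s) _ (F [:: ('i, j)]))//; last first.
  by move=> x _; rewrite /lincomb big_seq1.
rewrite (inner_isometric _ _ ww iw); apply: eq_rinner => // x _.
by rewrite /lincomb big_seq1 mulrA.
Qed.

Lemma energy_bounded w (M : R) s : weight w -> isometric w ->
  (forall x, D x -> w x <= M) ->
  L2 mu D (fun x => (w x)%:C) /\
  \esum_(j in [set: I]) (energy (F s) j)%:E =
    (nsq mu D (fun x => G s x * (w x)%:C))%:E.
Proof.
move=> ww iw wM; have [mw w0 intw] := ww.
have Lw : L2 mu D (fun x => (w x)%:C).
  apply: (L2_dominated mD _ (integrable_scale mD M intw)).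
    exact: cmeasurable_real.
  by move=> x Dx; rewrite redot_real expr2 ler_wpM2r ?w0 ?wM.
split => //; rewrite -g_parseval; last exact: L2_lincomb_weight.
by apply: eq_esum => j _; rewrite (coefficient_isometric _ _ ww iw).
Qed.

(** For a weight with values in {0} and [A, B], the coefficient energy of F s is
    the integral of |G s|^2 w^2 by Parseval, to be compared with the integral of
    |G s|^2 w. *)
Lemma frame_of_bounded_weight w (A B : R) : weight w -> isometric w ->
  0 < A -> 0 < B -> (forall x, D x -> w x != 0 -> A <= w x <= B) ->
  frame_sequence mu' D' f A B.
Proof.
move=> ww iw A0 B0 wAB; have [mw w0 intw] := ww.
have wB x : D x -> w x <= B.
  by move=> Dx; case: (eqVneq (w x) 0) => [->|/(wAB _ Dx)/andP[]//]; exact: ltW.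
have Lsw := L2_sqrt_weight mD ww.
have sq s x : D x -> redot (G s x * sqrt_weight w x) (G s x * sqrt_weight w x) =
    redot (G s x) (G s x) * w x.
  by move=> Dx; rewrite redotMM (redot_sqrt_weight ww).
have sq2 s x : redot (G s x * (w x)%:C) (G s x * (w x)%:C) =
    redot (G s x) (G s x) * w x ^+ 2 by rewrite redotMM redot_real.
split => //; apply: frame_bounds_closure => //; first exact: ltW.
- move=> s J; have [Lw En] := energy_bounded s ww iw wB.
  have : (\sum_(j <- J) (energy (F s) j)%:E <=
      (nsq mu D (fun x => G s x * (w x)%:C))%:E)%E.
    rewrite -En; apply: (@fset_le_esum R _ (fun j => (energy (F s) j)%:E)) => j.
    by rewrite lee_fin sqr_ge0.
  rewrite sumEFin lee_fin => /le_trans; apply.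
  rewrite iw -[X in X <= _]mul1r; apply: nsq_mono => //.
  + exact: L2_lincomb_weight.
  + exact: L2_lincomb_weight.
  + move=> x Dx; rewrite sq// sq2 mul1r mulrCA.
    by rewrite ler_wpM2r ?wB// mulr_ge0 ?redot_ge0 ?w0.
- move=> s; have [Lw ->] := energy_bounded s ww iw wB.
  rewrite lee_fin iw -[X in _ <= X]mul1r; apply: nsq_mono => //.
  + exact: L2_lincomb_weight.
  + exact: L2_lincomb_weight.
  + move=> x Dx; rewrite sq// sq2 mul1r expr2.
    rewrite mulrCA ler_wpM2l ?redot_ge0//.
    case: (eqVneq (w x) 0) => [->|wx]; first by rewrite !mulr0.
    by rewrite ler_wpM2r ?w0//; have /andP[] := wAB x Dx wx.
Qed.

(** The upper frame bound, read on the adjoint operator, bounds the norm of F s by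
    the coefficients of s, whose square sum is the square norm of G s. *)
Lemma synthesis_le s (A B : R) : frame_sequence mu' D' f A B ->
  nsq mu' D' (F s) <= B * nsq mu D (G s).
Proof.
move=> [_ _ B0 /(_ _ (lincomb_closed_span mD' Lf s))[_ hB]].
have [J [c hJ]] := lincomb_by_index s.
have Lg j : L2 mu D (g j).
  by apply: (@L2_bounded _ _ _ _ _ mD muD _ 1 (mg j)) => x _; rewrite g_unit.
have LFs := L2_lincomb mD' Lf s; have LGs := L2_lincomb mD Lg s.
rewrite L2normsqE// -EFinM in hB.
have e0 j : (0 <= (energy (F s) j)%:E)%E by rewrite lee_fin sqr_ge0.
have eB : \sum_(j <- J) energy (F s) j <= B * nsq mu' D' (F s).
  by rewrite -lee_fin -sumEFin; exact: le_trans (fset_le_esum _ e0) hB.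
have cG : \sum_(j <- J) redot (c j) (c j) <= nsq mu D (G s).
  rewrite -lee_fin -(g_parseval LGs) -sumEFin.
  apply: le_trans (fset_le_esum J _) => [|j]; last by rewrite lee_fin sqr_ge0.
  rewrite big_seq [X in (_ <= X)%E]big_seq; apply: lee_sum => j jJ.
  rewrite lee_fin normc_redot.
  have -> // : L2inner mu D (G s) (g j) = c j.
  rewrite (_ : G s = fun x => \sum_(i <- J) c i * g i x); last first.
    by apply/funext => x; exact: hJ.
  rewrite L2inner_suml//; last by move=> i; exact: L2Z.
  under eq_bigr do rewrite L2innerZl// g_orthonormal.
  rewrite (bigD1_seq j)//= eqxx mulr1 big1 ?addr0// => i ij.
  by rewrite (negbTE ij) mulr0.
have NE : nsq mu' D' (F s) = \sum_(j <- J) redot (c j) (L2inner mu' D' (F s) (f j)).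
  transitivity (complex.Re (L2inner mu' D' (F s) (F s))).
    by rewrite L2inner_self.
  rewrite {1}(_ : F s = fun x => \sum_(i <- J) c i * f i x); last first.
    by apply/funext => x; exact: hJ.
  rewrite L2inner_suml//; last by move=> i; exact: L2Z.
  rewrite raddf_sum; apply: eq_bigr => j _; rewrite L2innerZl// (L2inner_conj mD' LFs (Lf j)).
  move: (c j) (L2inner _ _ _ _) => [a b] [x y]; rewrite conjCE /redot /=; ring.
suff : 2 * nsq mu' D' (F s) <= B * nsq mu D (G s) + nsq mu' D' (F s) by lra.
rewrite {1}NE mulr_sumr.
apply: (@le_trans _ _ (\sum_(j <- J) (B * redot (c j) (c j) +
    B^-1 * energy (F s) j))).
  (* Young's inequality with the weight B: the second terms then add up to at
     most nsq (F s), which the left-hand side absorbs *)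
  apply: ler_sum => j _; rewrite normc_redot.
  move: (c j) (L2inner _ _ _ _) => [a b] [x y]; rewrite /redot /= -subr_ge0.
  have -> : B * (a * a + b * b) + B^-1 * (x * x + y * y) - 2 * (a * x + b * y) =
      B^-1 * ((B * a - x) ^+ 2 + (B * b - y) ^+ 2) by field; rewrite gt_eqF.
  by rewrite mulr_ge0 ?invr_ge0 ?(ltW B0)// addr_ge0// sqr_ge0.
rewrite big_split -!mulr_sumr lerD//; first by rewrite ler_wpM2l// ltW.
by rewrite mulrC ler_pdivrMr// mulrC.
Qed.

(** Approximation in L^2((1 + w) mu) is approximation in L^2(|u|^2 mu) for every
    u with |u|^2 <= M (1 + w); below u is 1, the square root of w, or w. *)
Lemma indicator_limit w E : weight w -> measurable E ->
  exists t_ : nat -> seq (R[i] * I), forall (u : T -> R[i]) (M : R),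
    L2 mu D u -> 0 <= M -> (forall x, D x -> redot (u x) (u x) <= M * (1 + w x)) ->
    (fun k => nsq mu D (fun x => G (t_ k) x * u x)) @ \oo -->
      nsq mu D (fun x => (\1_E x)%:C * u x).
Proof.
move=> [mw w0 iw] mE; pose v x := 1 + w x.
have wv : weight v.
  split.
  - by apply: measurable_funD => //; exact: measurable_cst.
  - by move=> x Dx; rewrite addr_ge0 ?w0.
  - have i1 : mu.-integrable D (EFin \o (fun=> 1 : R)).
      have := L2_redot_self (@L2_bounded _ _ _ _ _ mD muD (fun=> 1) 1 _ _).
      rewrite (_ : (fun x => redot _ _) = fun=> 1).
        by apply=> [|x _]; [exact: cmeasurable_cst|rewrite redot_real expr1n].
      by apply/funext => x; rewrite redot_real expr1n.
    rewrite (_ : _ \o _ = (fun x => (EFin \o (fun=> 1%R)) x + (EFin \o w) x)%E)//.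
    exact: integrableD.
have Lv := L2_sqrt_weight mD wv.
have step k : exists t, nsq mu D (fun x => ((\1_E x)%:C - G t x) * sqrt_weight v x)
    <= 2^-1 ^+ k.
  by apply: g_dense => //; rewrite exprn_gt0// invr_gt0.
pose t_ k := sval (cid (step k)); exists t_ => u M Lu M0 uM.
have L1E z : L2 mu D z -> L2 mu D (fun x => (\1_E x)%:C * z x).
  apply: (@L2M _ _ _ _ _ mD z (fun x => (\1_E x)%:C) 1).
    by apply: cmeasurable_real => //; exact: measurable_indic.
  by move=> x _; rewrite redot_real indicE; case: (_ \in _); rewrite ?expr1n ?expr0n.
have LB z k : L2 mu D z -> L2 mu D (fun x => ((\1_E x)%:C - G (t_ k) x) * z x).
  move=> Lz; have := L2B mD (L1E _ Lz) (L2_lincomb_weight (t_ k) Lz).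
  by apply: eq_L2 => x _; rewrite mulrBl.
apply: nsq_cvg => //; [by move=> k; exact: L2_lincomb_weight|exact: L1E|].
apply: (@squeeze_cvgr _ _ _ _ (fun=> 0) (fun k => M * (2^-1 : R) ^+ k)).
- apply: nearW => k; rewrite nsq_ge0 /= nsqBC.
  rewrite (@eq_nsq _ _ _ _ _ _ (fun x => ((\1_E x)%:C - G (t_ k) x) * u x));
    last by move=> x _; rewrite mulrBl.
  apply: (@le_trans _ _ (M * nsq mu D
      (fun x => ((\1_E x)%:C - G (t_ k) x) * sqrt_weight v x))); last first.
    by rewrite ler_wpM2l//; exact: (svalP (cid (step k))).
  rewrite -[X in X <= _]mul1r; apply: nsq_mono => //; try exact: LB.
  move=> x Dx; rewrite mul1r !redotMM (redot_sqrt_weight wv Dx) mulrCA.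
  by rewrite ler_wpM2l ?redot_ge0// uM.
- exact: cvg_cst.
- rewrite -[X in _ --> X](mulr0 M); apply: cvgMl_tmp.
  by apply: cvg_expr; rewrite ger0_norm ?invr_ge0// invf_lt1 ?ltr1n.
Qed.

(** The synthesis bound, extended from trigonometric sums to indicators of sets,
    says that the integral of w over E is at most B times the measure of E. *)
Lemma frame_weight_le w (A B : R) : weight w -> isometric w ->
  frame_sequence mu' D' f A B -> {ae mu, forall x, D x -> w x <= B}.
Proof.
move=> ww iw fr; have Lw := L2_sqrt_weight mD ww; have [_ w0 _] := ww.
have L1 : L2 mu D (fun=> 1).
  by apply: (@L2_bounded _ _ _ _ _ mD muD _ 1) => [|x _];
    [exact: cmeasurable_cst|rewrite redot_real expr1n].
have : {ae mu, forall x, D x -> 1 * redot (sqrt_weight w x) (sqrt_weight w x) <=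
    B * redot (1 : R[i]) 1}.
  apply: ae_redot_le => // E mE; rewrite mul1r.
  have [t_ ht] := indicator_limit ww mE.
  have b1 x : D x -> redot (sqrt_weight w x) (sqrt_weight w x) <= 1 * (1 + w x).
    by move=> Dx; rewrite (redot_sqrt_weight ww Dx); lra.
  have b2 x : D x -> redot (1 : R[i]) 1 <= 1 * (1 + w x).
    by move=> Dx; rewrite redot_real expr1n; have := w0 x Dx; lra.
  have c1 := ht _ 1 Lw ler01 b1; have c2 := @cvgMl_tmp R nat \oo eventually_filter _ B _ (ht _ 1 L1 ler01 b2).
  apply: (ler_cvg_to c1 c2); apply: nearW => k; rewrite -iw; apply: (le_trans (synthesis_le (t_ k) fr)).
    by rewrite (@eq_nsq _ _ _ _ _ _ (fun x => G (t_ k) x * 1))// => x _; rewrite mulr1.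
apply: filterS => x hx Dx; have := hx Dx.
by rewrite (redot_sqrt_weight ww Dx) redot_real expr1n; lra.
Qed.

(** For a bounded weight, Parseval turns the lower frame bound into an inequality
    between the integrals of A |G s|^2 w and of |G s|^2 w^2, which passes to
    indicators and gives A w <= w^2 almost everywhere. *)
Lemma frame_weight_ge w (A B : R) : weight w -> isometric w ->
  (forall x, D x -> w x <= B) ->
  frame_sequence mu' D' f A B -> {ae mu, forall x, D x -> w x != 0 -> A <= w x}.
Proof.
move=> ww iw wB fr; have Lw := L2_sqrt_weight mD ww; have [_ w0 _] := ww.
have [_ A0 B0 hf] := fr; have L2w := (energy_bounded [::] ww iw wB).1.
have : {ae mu, forall x, D x -> A * redot (sqrt_weight w x) (sqrt_weight w x) <=
    1 * redot (w x)%:C (w x)%:C}.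
  apply: ae_redot_le => // E mE; rewrite mul1r.
  have [t_ ht] := indicator_limit ww mE.
  have b1 x : D x -> redot (sqrt_weight w x) (sqrt_weight w x) <= 1 * (1 + w x).
    by move=> Dx; rewrite (redot_sqrt_weight ww Dx); lra.
  have b2 x : D x -> redot (w x)%:C (w x)%:C <= B ^+ 2 * (1 + w x).
    move=> Dx; rewrite redot_real -[X in X <= _]mulr1 ler_pM ?sqr_ge0//.
      by rewrite ler_pXn2r// ?nnegrE ?w0 ?wB// ltW.
    by have := w0 x Dx; lra.
  have c1 := @cvgMl_tmp R nat \oo eventually_filter _ A _ (ht _ 1 Lw ler01 b1).
  have c2 := ht _ (B ^+ 2) L2w (sqr_ge0 B) b2.
  apply: (ler_cvg_to c1 c2); apply: nearW => k; have [+ _] := hf _ (lincomb_closed_span mD' Lf (t_ k)).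
    rewrite L2normsqE//; last exact: L2_lincomb.
    by rewrite (energy_bounded _ ww iw wB).2 -EFinM lee_fin iw.
apply: filterS => x hx Dx wx; have := hx Dx.
rewrite (redot_sqrt_weight ww Dx) redot_real mul1r expr2 ler_pM2r//.
by rewrite lt_neqAle eq_sym wx w0.
Qed.

(** The upper bound on w comes first, as it allows to replace w by a bounded weight
    before Parseval's identity is applied to G s * w. *)
Theorem weighted_frame_sequence w (A B : R) : weight w -> isometric w ->
  0 < A -> 0 < B -> frame_sequence mu' D' f A B <->
  {ae mu, forall x, D x -> w x != 0 -> A <= w x <= B}.
Proof.
move=> ww iw A0 B0; split=> [fr|aeAB].
- have aeB := frame_weight_le ww iw fr.
  have aeB' : {ae mu, forall x, D x -> w x != 0 -> [set r | r <= B] (w x)}.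
    by move: aeB; apply: filterS => x hx Dx _; exact: hx.
  have mS : measurable [set r : R | r <= B].
    rewrite (_ : mkset _ = `]-oo, B]%classic); first exact: measurable_itv.
    by apply/seteqP; split => r; rewrite /= in_itv.
  have [w' [ww' w'B e]] := weight_clip mD ww mS aeB'.
  have {}w'B x : D x -> w' x <= B.
    by move=> Dx; case: (eqVneq (w' x) 0) => [->|/(w'B _ Dx)//]; exact: ltW.
  have := frame_weight_ge ww' (isometric_ae ww ww' iw e) w'B fr.
  move: aeB e; apply: filterS3 => x hB e hA Dx wx.
  by rewrite hB// andbT e// hA// -e.
- have mS : measurable [set r : R | A <= r <= B].
    rewrite (_ : mkset _ = `[A, B]%classic); first exact: measurable_itv.
    by apply/seteqP; split => r; rewrite /= in_itv.
  have [w' [ww' w'AB e]] := weight_clip mD ww mS aeAB.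
  exact: (frame_of_bounded_weight ww' (isometric_ae ww ww' iw e)).
Qed.

End weighted_frames.

(** * The bracket as a weight on the torus *)

(** The factors of the twisted translations differ from the characters of the torus
    by unimodular constants, which leaves orthonormality, Parseval's identity and
    the density of linear combinations intact. *)
Section rotated_characters.
Context {R : realType} {n : nat}.
Local Notation mu2 := (@lebesgue_R2n R n).
Local Notation torus2 := (@torus R n `*` @torus R n).
Local Notation index := (Zn n * Zn n)%type.
Implicit Types (j : index) (u : Rn R n * Rn R n -> R[i]).

Let torus2_finite : (mu2 torus2 < +oo)%E.
Proof. by rewrite torus2_measure ltry. Qed.

Let m_echar2 j : cmeasurable torus2 (echar2 (R := R) j).
Proof. exact/cmeasurableTS/cmeasurable_echar2. Qed.

Let echar2_one : exists k, forall p, torus2 p -> echar2 (R := R) (n := n) k p = 1.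
Proof.
by exists (zeroZn n, zeroZn n) => p _; rewrite /echar2 !echar0 mulr1.
Qed.

Let echar2_mul j l : exists k, forall p, torus2 p ->
  echar2 k p = echar2 (R := R) j p * echar2 l p.
Proof.
exists (addZn j.1 l.1, addZn j.2 l.2) => p _.
by rewrite /echar2 !echar_add mulrACA.
Qed.

Let echar2_conj j : exists k, forall p, torus2 p -> echar2 k p = (echar2 (R := R) j p)^*.
Proof.
by exists (oppZn j.1, oppZn j.2) => p _; rewrite /echar2 !echar_opp rmorphM.
Qed.

Let L2_echar2 j : L2 mu2 torus2 (echar2 j).
Proof.
apply: (@L2_bounded _ _ R mu2 torus2 (@measurable_torus2 R n) torus2_finite (echar2 j) 1) => // p _.
by rewrite redot_echar2.
Qed.

Let conj_twist j : twist (R := R) j.1 j.2 * (twist j.1 j.2)^* = 1.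
Proof.
have := redot_twist (R := R) j.1 j.2; rewrite conjCE.
case: (twist _ _) => a b; rewrite /redot /= => h.
by apply/eqP; rewrite eq_complex /=; apply/andP; split; apply/eqP; lra.
Qed.

Let L2inner_zak_factor u j : L2 mu2 torus2 u ->
  L2inner mu2 torus2 u (zak_factor j) = (twist j.1 j.2)^* * L2inner mu2 torus2 u (echar2 j).
Proof.
move=> Lu; have mD := @measurable_torus2 R n; have Lj := L2_echar2 j.
rewrite (L2inner_conj mD (L2Z mD (twist j.1 j.2) Lj) Lu) L2innerZl//.
by rewrite (L2inner_conj mD Lj Lu); exact: rmorphM.
Qed.

Lemma zak_factor_orthonormal j l :
  L2inner mu2 torus2 (zak_factor j) (zak_factor l) = (j == l)%:R.
Proof.
have mD := @measurable_torus2 R n.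
rewrite L2inner_zak_factor; last exact: L2Z.
rewrite L2innerZl// echar2_orthonormal; case: eqVneq => [->|_]; last by rewrite !mulr0.
by rewrite mulr1 mulrC conj_twist.
Qed.

Lemma zak_factor_parseval u : L2 mu2 torus2 u ->
  \esum_(j in [set: index]) ((Normc.normc (L2inner mu2 torus2 u (zak_factor j))) ^+ 2)%:E =
  (nsq mu2 torus2 u)%:E.
Proof.
move=> Lu; rewrite -(@parseval _ _ R mu2 torus2 (@measurable_torus2 R n) _ (@echar2 R n)
  m_echar2 (@redot_echar2 R n) echar2_one echar2_mul echar2_conj
  (@echar2_generate R n) torus2_finite (@echar2_orthonormal R n) u Lu).
apply: eq_esum => j _; rewrite L2inner_zak_factor// !normc_redot redotMM.
have := redot_twist (R := R) j.1 j.2; rewrite conjCE.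
by case: (twist _ _) => a b; rewrite /redot /= mulrNN => ->; rewrite mul1r.
Qed.

Lemma zak_factor_dense u E (r : R) : L2 mu2 torus2 u -> measurable E -> 0 < r ->
  exists t, nsq mu2 torus2
    (fun p => ((\1_E p)%:C - lincomb (@zak_factor R n) t p) * u p) <= r.
Proof.
move=> Lu mE r0.
have [|t ht] := @lincomb_dense _ _ R mu2 torus2 (@measurable_torus2 R n) _ (@echar2 R n) m_echar2
  (@redot_echar2 R n) echar2_one echar2_mul echar2_conj _ u Lu E mE r r0.
  exact: echar2_generate.
exists [seq (p.1 * (twist p.2.1 p.2.2)^*, p.2) | p <- t].
rewrite (_ : lincomb _ _ = lincomb (@echar2 R n) t)//.
apply/funext => p; rewrite /lincomb big_map; apply: eq_bigr => c _ /=.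
by rewrite /zak_factor mulrA -(mulrA c.1) (mulrC (_ ^*)) conj_twist mulr1.
Qed.

End rotated_characters.

Section bracket_weight.
Context {R : realType} {n : nat}.
Local Notation mu := (@lebesgue_Rn R n).
Local Notation mu2 := (@lebesgue_R2n R n).
Local Notation mu3 := (@lebesgue_R3n R n).
Local Notation torus2 := (@torus R n `*` @torus R n).
Local Notation D3 := (@zak_domain R n).
Implicit Types (phi : Rn R n * Rn R n -> R[i]) (p : Rn R n * Rn R n).
Implicit Types (Z : Rn R n * Rn R n * Rn R n -> R[i]).

Lemma integral_zak_domain_fibers (h : Rn R n * Rn R n * Rn R n -> \bar R) :
  measurable_fun D3 h -> (forall q, 0 <= h q)%E ->
  measurable_fun torus2 (fun p => \int[mu]_y h (p, y))%E /\
  (\int[mu3]_(q in D3) h q = \int[mu2]_(p in torus2) \int[mu]_y h (p, y))%E.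
Proof.
move=> mh h0; have mD := @measurable_zak_domain R n.
pose h' := h \_ D3.
have mh' : measurable_fun setT h' by apply/(measurable_restrictT _ mD).
have h'0 q : (0 <= h' q)%E by rewrite /h' patchE; case: ifP.
have E p y : torus2 p -> h' (p, y) = h (p, y).
  by move=> hp; rewrite /h' patchE mem_set.
split.
  apply: (@eq_measurable_fun _ _ _ _ _ (fun p => \int[mu]_y h' (p, y))%E).
    by move=> p; rewrite inE => hp; apply: eq_integral => y _; rewrite E.
  apply: measurable_funTS.
  exact: (@measurable_fun_fubini_tonelli_F _ _ _ _ R mu h' mh' h'0).
transitivity (\int[mu3]_(q in D3) h' q)%E.
  by apply: eq_integral => q qD; rewrite /h' patchE qD.
rewrite integral_zak_domain//; apply: eq_integral => p; rewrite inE => hp.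
by apply: eq_integral => y _; rewrite E.
Qed.

(** On the null set of base points p over which Z is not square integrable, the
    value of this integral is 0. *)
Definition fiber_norm Z p : R := \int[mu]_y redot (Z (p, y)) (Z (p, y)).

Lemma bracket_real phi p : bracket phi phi p = (fiber_norm (weyl_zak phi) p)%:C.
Proof.
rewrite /bracket /cintegral; congr (_ +i* _).
  apply: eq_Rintegral => y _; move: (weyl_zak _ _) => [a b].
  by rewrite conjCE /redot /=; ring.
rewrite /Rintegral integral0_eq//= => y _; move: (weyl_zak _ _) => [a b].
by rewrite conjCE /=; congr EFin; ring.
Qed.

Let fiber Z p : \bar R := (\int[mu]_y ((Normc.normc (Z (p, y))) ^+ 2)%:E)%E.

Let fiber_normE Z p : fiber_norm Z p = fine (fiber Z p).
Proof.
congr fine; apply: eq_integral => y _; congr EFin.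
by rewrite normc_redot.
Qed.

Let fiber_ge0 Z p : (0 <= fiber Z p)%E.
Proof. by apply: integral_ge0 => y _; rewrite lee_fin sqr_ge0. Qed.

Let fiber_facts Z : L2 mu3 D3 Z ->
  measurable_fun torus2 (fiber Z) /\ {ae mu2, forall p, torus2 p -> fiber Z p \is a fin_num}
  /\ (\int[mu2]_(p in torus2) fiber Z p < +oo)%E.
Proof.
move=> [mZ finZ]; have mD := @measurable_torus2 R n.
have [mF FE] := integral_zak_domain_fibers (measurable_normc2 mZ)
  (fun q => @sqr_ge0 _ _).
have fin : (\int[mu2]_(p in torus2) fiber Z p < +oo)%E by rewrite -FE.
split => //; split => //; apply: (integrable_ae mD).
apply/integrableP; split => //.
by under eq_integral do rewrite gee0_abs//.
Qed.

Lemma weight_fiber_norm Z : L2 mu3 D3 Z -> weight mu2 torus2 (fiber_norm Z).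
Proof.
move=> LZ; have [mF [aeF fin]] := fiber_facts LZ.
have mD := @measurable_torus2 R n.
have mW : measurable_fun torus2 (fiber_norm Z).
  apply: (@eq_measurable_fun _ _ _ _ _ (fine \o fiber Z)).
    by move=> p _; rewrite fiber_normE.
  exact: (measurableT_comp (fine_measurable measurableT) mF).
split => //.
  by move=> p _; apply: Rintegral_ge0 => y _; exact: redot_ge0.
apply/integrableP; split; first exact/measurable_EFinP.
apply: le_lt_trans fin; apply: ge0_le_integral => //.
- by apply: measurableT_comp => //; exact/measurable_EFinP.
- move=> p _; rewrite /= fiber_normE ger0_norm ?fine_ge0//.
  have := fiber_ge0 Z p; case: (fiber Z p) => //= _; exact: leey.
Qed.

(** Tonelli over the fibres: multiplication by a function of the base point only
    sees the fibre norms. *)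
Lemma nsq_fiber_norm Z (r : Rn R n * Rn R n -> R[i]) : L2 mu3 D3 Z ->
  L2 mu3 D3 (fun q => r q.1 * Z q) ->
  cmeasurable torus2 r ->
  L2 mu2 torus2 (fun p => r p * sqrt_weight (fiber_norm Z) p) ->
  nsq mu3 D3 (fun q => r q.1 * Z q) =
  nsq mu2 torus2 (fun p => r p * sqrt_weight (fiber_norm Z) p).
Proof.
move=> LZ LrZ mr Lr; have [mF [aeF fin]] := fiber_facts LZ.
have mD := @measurable_torus2 R n; have mD3 := @measurable_zak_domain R n.
apply: EFin_inj; rewrite -!L2normsqE// /L2normsq.
have [_ ->] := integral_zak_domain_fibers (measurable_normc2 LrZ.1)
  (fun q => @sqr_ge0 _ _).
apply: ge0_ae_eq_integral => //.
- by have [] := integral_zak_domain_fibers (measurable_normc2 LrZ.1)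
    (fun q => @sqr_ge0 _ _).
- exact: measurable_normc2 Lr.1.
- by move=> p _; apply: integral_ge0 => y _; rewrite lee_fin sqr_ge0.
- by move=> p _; rewrite lee_fin sqr_ge0.
have W := weight_fiber_norm LZ.
move: aeF; apply: filterS => p hp Dp.
rewrite (eq_integral (fun y => (redot (r p) (r p))%:E *
    ((Normc.normc (Z (p, y))) ^+ 2)%:E)%E); last first.
  by move=> y _; rewrite !normc_redot redotMM.
rewrite ge0_integralZl//.
- rewrite -/(fiber Z p) -(fineK (hp Dp)) -fiber_normE -EFinM; congr EFin.
  by rewrite normc_redot redotMM (redot_sqrt_weight W Dp).
- pose h := (fun q => ((Normc.normc (Z q)) ^+ 2)%:E) \_ D3.
  have mh : measurable_fun setT h.
    by apply/(measurable_restrictT _ mD3); exact: measurable_normc2 LZ.1.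
  apply: (@eq_measurable_fun _ _ _ _ _ (fun y => h (p, y))).
    move=> y _; rewrite /h patchE ifT// inE.
    by split => //; case: Dp.
  by apply: (measurableT_comp mh); exact: measurable_pair1.
- by move=> y _; rewrite lee_fin sqr_ge0.
- by rewrite lee_fin redot_ge0.
Qed.

End bracket_weight.

(** * The characterization *)

Theorem theorem4p2 (R : realType) (n : nat)
    (phi : Rn R n * Rn R n -> R[i])
    (phiL2 : L2 lebesgue_R2n setT phi)
    (A B : R) (A_gt0 : 0 < A) (B_gt0 : 0 < B) :
  frame_sequence lebesgue_R2n setT
    (fun kl : Zn n * Zn n => twisted_translation kl.1 kl.2 phi) A B
  <->
  {ae lebesgue_R2n, forall p : Rn R n * Rn R n,
     Omega phi p -> A%:C <= bracket phi phi p <= B%:C}.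
Proof.
have [LZ _] := weyl_zakP phiL2; set Z := weyl_zak phi in LZ.
pose torus2 := @torus R n `*` @torus R n.
have mD : measurable torus2 := @measurable_torus2 R n.
have muD : (lebesgue_R2n torus2 < +oo)%E by rewrite torus2_measure ltry.
have mz j : cmeasurable torus2 (@zak_factor R n j).
  exact/cmeasurableTS/cmeasurable_zak_factor.
have ww : weight lebesgue_R2n torus2 (fiber_norm Z) := weight_fiber_norm LZ.
have Ltw (j : Zn n * Zn n) : L2 lebesgue_R2n setT (twisted j phi) by exact: L2_twisted.
have iw : isometric lebesgue_R2n torus2 lebesgue_R2n setT
    (@zak_factor R n) (fun j => twisted j phi) (fiber_norm Z).
  move=> s; rewrite (zak_combination_isometry s phiL2); apply: nsq_fiber_norm => //.
  - exact: L2_zak_combination.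
  - exact: cmeasurable_lincomb.
  - apply: L2_lincomb_weight => //; last exact: L2_sqrt_weight.
    exact: redot_zak_factor.
rewrite (weighted_frame_sequence mD measurableT muD mz (@redot_zak_factor R n)
  (@zak_factor_orthonormal R n) (@zak_factor_parseval R n) (@zak_factor_dense R n) Ltw
  ww iw A_gt0 B_gt0).
have eqC (r : R) : (r%:C != 0) = (r != 0) by rewrite eq_complex /= eqxx andbT.
have leC (r s : R) : (r%:C <= s%:C) = (r <= s) by rewrite lecE /= eqxx.
split; apply: filterS => p hp; move: hp; rewrite /Omega /= bracket_real eqC !leC => hp.
  by move=> [Dp wp]; exact: hp.
by move=> Dp wp; exact: hp.
Qed.
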